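(* Let $R>1$, $A[1,R]=\{z\in\mathbb C: 1\le|z|\le R\}$, $A(1,R)=\{z\in\mathbb C:1<|z|<R\}$, $\mathbb T=\{|z|=1\}$ and $\mathbb T_R=\{|z|=R\}$. Let $h:A[1,R]\to\mathbb C$ be a $C^1$-mapping that is harmonic in $A(1,R)$ and satisfies the following conditions at the inner boundary $\mathbb T$: (i) $h$ restricted to $\mathbb T$ is an orientation-preserving homeomorphism of $\mathbb T$ onto $\mathbb T$; (ii) there is $1\le K<\infty$ such that $\|Dh(z)\|^2\le K\,J(z,h)$ for all $z\in\mathbb T$. Then $$\sup_{|z|=R}|h(z)|\ \ge\ \left[\frac{1}{2\pi R}\int_{\mathbb T_R}|h|^2\,|dz|\right]^{1/2}\ \ge\ \frac{K+1}{2K}\,R+\frac{K-1}{2K}\,\frac1R .$$ Equality is attained, uniquely up to rotation (multiplication of $h$ by a unimodular constant), for $$h(z)=\frac{K+1}{2K}\,z+\frac{K-1}{2K}\,\frac1{\bar z}.$$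
   Context: Harmonic means that the real and imaginary parts of $h$ are harmonic. $C^1$ on the closed annulus means that $h$ and its first-order partial derivatives extend continuously to $A[1,R]$. Write $h_z=\frac12(h_x-ih_y)$, $h_{\bar z}=\frac12(h_x+ih_y)$, $\|Dh\|=|h_z|+|h_{\bar z}|$ (operator norm of the differential) and $J(z,h)=|h_z|^2-|h_{\bar z}|^2$ (Jacobian determinant). *)

(* Defs.v *)
(* Classical reals with Coquelicot; the complex plane is Coquelicot's [C]. *)
From Stdlib Require Import Reals.
From Coquelicot Require Import Coquelicot.
Open Scope R_scope.

Definition closed_annulus (rho : R) (z : C) : Prop := 1 <= Cmod z <= rho.
Definition open_annulus (rho : R) (z : C) : Prop := 1 < Cmod z < rho.
Definition unit_circle (z : C) : Prop := Cmod z = 1.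

Definition cis (t : R) : C := (cos t, sin t).

(* [ex_diff_n u 2], required at every point of an open set, says that u is C^2
   there. *)
Definition harmonic_on (D : C -> Prop) (u : R -> R -> R) : Prop :=
  forall x y : R, D (x, y) ->
    ex_diff_n u 2 x y /\
    partial_derive 2 0 u x y + partial_derive 0 2 u x y = 0.

Definition complex_harmonic_on (D : C -> Prop) (h : C -> C) : Prop :=
  harmonic_on D (fun x y => Re (h (x, y))) /\
  harmonic_on D (fun x y => Im (h (x, y))).

(* hx and hy are the continuous extensions to the closed annulus of the partial
   derivatives of h; they are unique there.  Only values of h on the closed
   annulus matter: continuity is relative to it, and derivatives are taken at
   points of the open annulus. *)
Definition C1_closed_annulus (rho : R) (h hx hy : C -> C) : Prop :=
  continuous_on (closed_annulus rho) h /\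
  continuous_on (closed_annulus rho) hx /\
  continuous_on (closed_annulus rho) hy /\
  forall x y : R, open_annulus rho (x, y) ->
    is_derive (fun t : R => h (t, y)) x (hx (x, y)) /\
    is_derive (fun t : R => h (x, t)) y (hy (x, y)).

Definition wirtinger_z (hx hy : C -> C) (z : C) : C :=
  (/ 2 * (hx z - Ci * hy z))%C.
Definition wirtinger_zbar (hx hy : C -> C) (z : C) : C :=
  (/ 2 * (hx z + Ci * hy z))%C.

Definition opnorm (hx hy : C -> C) (z : C) : R :=
  Cmod (wirtinger_z hx hy z) + Cmod (wirtinger_zbar hx hy z).
Definition jacobian (hx hy : C -> C) (z : C) : R :=
  Cmod (wirtinger_z hx hy z) ^ 2 - Cmod (wirtinger_zbar hx hy z) ^ 2.

Definition circle_homeo (h : C -> C) : Prop :=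
  continuous_on unit_circle h /\
  (forall z, unit_circle z -> unit_circle (h z)) /\
  exists g : C -> C,
    continuous_on unit_circle g /\
    (forall z, unit_circle z -> unit_circle (g z)) /\
    (forall z, unit_circle z -> g (h z) = z) /\
    (forall z, unit_circle z -> h (g z) = z).

(* Orientation of a circle homeomorphism: it has an increasing lift to the
   universal cover. *)
Definition orientation_preserving (h : C -> C) : Prop :=
  exists phi : R -> R,
    (forall t, continuous phi t) /\
    (forall s t, s < t -> phi s < phi t) /\
    (forall t, h (cis t) = cis (phi t)).

Definition admissible (rho K : R) (h : C -> C) : Prop :=
  complex_harmonic_on (open_annulus rho) h /\
  circle_homeo h /\
  orientation_preserving h /\
  exists hx hy : C -> C,
    C1_closed_annulus rho h hx hy /\
    forall z, unit_circle z -> opnorm hx hy z ^ 2 <= K * jacobian hx hy z.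

Definition sup_modulus (rho : R) (h : C -> C) : Rbar :=
  Lub_Rbar (fun y => exists z : C, Cmod z = rho /\ y = Cmod (h z)).

(* Integral over |z| = rho with respect to arc length |dz| = rho dt. *)
Definition circle_integral (rho : R) (f : C -> R) : R :=
  RInt (fun t => f (rho * cis t)%C * rho) 0 (2 * PI).

Definition quadratic_mean (rho : R) (h : C -> C) : R :=
  sqrt (/ (2 * PI * rho) * circle_integral rho (fun z => Cmod (h z) ^ 2)).

Definition lower_bound (rho K : R) : R :=
  (K + 1) / (2 * K) * rho + (K - 1) / (2 * K) * / rho.

Definition extremal (K : R) (z : C) : C :=
  (((K + 1) / (2 * K))%R * z + ((K - 1) / (2 * K))%R * / Cconj z)%C.

(* Main.v *)
Require Import Defs.
From Stdlib Require Import Reals Lra Lia Psatz FunctionalExtensionality.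
From Coquelicot Require Import Coquelicot.
Open Scope R_scope.

(** Expand [h] on circles, h(r e^(it)) = sum c_n(r) e^(int).  Harmonicity makes
    every c_n a solution of (r d/dr)^2 c = n^2 c, so that
    c_n(rho) = ch_n p_n + sh_n q_n ([mode_evolution]), where p_n and q_n are
    the coefficients of h and of its radial derivative N on the unit circle,
    ch_n = cosh (n log rho) and sh_n = sinh (n log rho) / n.  By Bessel's
    inequality the mean square of h on |z| = rho is at least sum |c_n(rho)|^2.

    On the unit circle h = e^(i phi) with phi increasing, phi' = v >= 0, and
    the distortion condition gives Re (conj h * N) >= v / K pointwise
    ([normal_derivative_bound]).  This may be integrated against any
    nonnegative density; the proof depends on using 1 + y v, with y = [weight].
    As v h is the tangential derivative of h divided by i, its coefficients are
    n p_n, and Parseval turns the integrated inequality into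
      sum (1 + y n) (Re (conj p_n * q_n) - n |p_n|^2 / K) >= 0.
    Completing the square in c_n(rho) ([mode_decomposition]) then leaves
      mean square on |z| = rho  >=  sum f(n) |p_n|^2
    with an explicit f ([mode_value]) and f(1) = (1 + y)^2, the square of the
    asserted bound.  A constant density would fail for large rho: the mode
    n = 0 grows only like log rho, and a small p_0 would make f(0) |p_0|^2
    too negative.  The term y v is what tames that mode.

    It remains to bound sum f(n) |p_n|^2 from below by f(1).  Three moments of
    |p_n|^2 are under control: sum |p_n|^2 = 1 since |h| = 1,
    sum n |p_n|^2 = 1 since h has degree one, and sum n |n| |p_n|^2 >= 1
    ([abs_moment]).  The last one holds because
      sum |p_n|^2 sin (n x) = average of sin (phi (t + x) - phi t) <= sin x
    for 0 <= x <= pi ([avg_sin_increment], a concavity argument that pairs t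
    with t + pi).  Hence it suffices to find alpha >= 0 and lambda with
      f(n) >= f(1) + lambda (n - 1) + alpha (n |n| - 1)   for all integers n
    ([mode_gap]); once coth is replaced by a rational majorant this is a
    polynomial inequality all of whose coefficients have the right sign.

    The inequality of [mode_gap] is strict for n <> 1, so in the case of
    equality all modes but the first vanish and h is a rotation of the
    extremal map ([rigidity]). *)

(** * The polynomial core of the spectral inequality *)

Ltac nonneg_sum :=
  repeat match goal with
  | |- 0 <= _ + _ => apply Rplus_le_le_0_compat
  | |- 0 <= _ * _ => apply Rmult_le_pos
  | |- 0 <= _ ^ _ => apply pow_le
  | |- 0 <= _ => lra
  end.

(** The values sinh (ln rho) and cosh (ln rho), kept rational in [rho] so that
    the inequalities below stay algebraic. *)
Definition sh1 (rho : R) := (rho - / rho) / 2.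
Definition ch1 (rho : R) := (rho + / rho) / 2.
Definition tilt (rho K : R) := sh1 rho / K.
(** The coefficient y of v in the test density 1 + y v.  It is chosen so that
    1 + y is the bound to be proved, and so that the optimal first mode for this
    density is the first mode of the extremal map. *)
Definition weight (rho K : R) := ch1 rho - 1 + tilt rho K.
(** The multiplier alpha of the moment n |n|.  As n tends to minus infinity,
    [mode_value] behaves like - alpha n^2, so this is the least admissible choice. *)
Definition quad_slope (rho K : R) :=
  2 * weight rho K * (sh1 rho - tilt rho K).
(** The multiplier lambda of the moment n.  It makes the comparison at n = 0
    read 2 s - s^2 >= 2 c - c^2 with s = sinh (ln rho) / ln rho and
    c = cosh (ln rho), which holds because 1 <= s <= c. *)
Definition lin_slope (rho K : R) :=
  (1 + weight rho K) ^ 2 - 2 * ch1 rho + ch1 rho ^ 2 - quad_slope rho K.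

(** The weight of |p_n|^2 left after completing the square in the n-th mode;
    G stands for sinh (ln rho) * n * coth (n ln rho). *)
Definition mode_value (rho K n G : R) :=
  2 * (1 + weight rho K * n) * (G + tilt rho K * n)
  - (1 + weight rho K * n) ^ 2 * (G ^ 2 - n ^ 2 * sh1 rho ^ 2).
Definition mode_target (rho K n : R) :=
  (1 + weight rho K) ^ 2 + lin_slope rho K * (n - 1)
  + quad_slope rho K * (n * Rabs n - 1).

(** Three times the expansion up to order p^3 of ((1 + 2 p)^n - 1) / (2 n p).
    Fewer terms would not do: for negative n the comparison needs the cubic
    decay of the reciprocal. *)
Definition denom (n p : R) :=
  3 + 3 * (n - 1) * p + 2 * (n - 1) * (n - 2) * p ^ 2
    + (n - 1) * (n - 2) * (n - 3) * p ^ 3.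

Definition coth_majorant (rho n : R) :=
  n * sh1 rho + 3 / (rho * denom n ((rho ^ 2 - 1) / 2)).

(** After clearing denominators, and with rho = 1 + 2 x, K = 1 + m and
    n = 3 + j (or n = 2), the expression becomes a polynomial in x, m, j whose
    coefficients are all nonnegative, so its expansion proves its sign.  The
    term x^2 is split off to obtain strictness. *)
Lemma pos_numerator (x m n : R) : 0 < x -> 0 <= m -> n = 2 \/ 3 <= n ->
  let z := 1 + 2 * x in let K := 1 + m in
  let p := 2 * x * (1 + x) in
  let y := K * (2 * x ^ 2) + p in
  let D := denom n p in
  let M := z * K + y * n in
  0 < (2 * n * (K * p + p) * M
       - ((z * K + y) ^ 2
          + (n - 1) * ((z * K + y) ^ 2 - 2 * (1 + p) * z * K ^ 2
                       + (1 + p) ^ 2 * K ^ 2 + 2 * y * (K * p - p) * n)))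
      * z ^ 2 * D ^ 2
      - 6 * n * p * M ^ 2 * D + 6 * M * K * z ^ 2 * D - 9 * M ^ 2.
Proof.
  intros Hx Hm Hn; cbv zeta.
  apply Rlt_le_trans with (x ^ 2); [apply pow_lt; lra|].
  apply Rminus_le_0.
  destruct Hn as [-> | Hn].
  - unfold denom; match goal with |- 0 <= ?e => ring_simplify e end.
    nonneg_sum.
  - replace n with (3 + (n - 3)) by ring.
    assert (Hj : 0 <= n - 3) by lra.
    set (j := n - 3) in *; clearbody j; clear n Hn.
    unfold denom; match goal with |- 0 <= ?e => ring_simplify e end.
    nonneg_sum.
Qed.

Lemma neg_numerator (x m n : R) : 0 < x -> 0 <= m -> n = 2 \/ 3 <= n ->
  let z := 1 + 2 * x in let K := 1 + m in
  let p := 2 * x * (1 + x) in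
  let y := K * (2 * x ^ 2) + p in
  let D := denom n p in
  let M := z * K - y * n in
  0 < (2 * n * (K * p - p) * M
       - ((z * K + y) ^ 2
          - (n + 1) * ((z * K + y) ^ 2 - 2 * (1 + p) * z * K ^ 2
                       + (1 + p) ^ 2 * K ^ 2)
          - 2 * y * (K * p - p) * n * (n - 1)))
      * z ^ 2 * D ^ 2
      - 6 * n * p * M ^ 2 * D + 6 * M * K * z ^ 2 * D - 9 * M ^ 2.
Proof.
  intros Hx Hm Hn; cbv zeta.
  apply Rlt_le_trans with (x ^ 2); [apply pow_lt; lra|].
  apply Rminus_le_0.
  destruct Hn as [-> | Hn].
  - unfold denom; match goal with |- 0 <= ?e => ring_simplify e end.
    nonneg_sum.
  - replace n with (3 + (n - 3)) by ring.
    assert (Hj : 0 <= n - 3) by lra.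
    set (j := n - 3) in *; clearbody j; clear n Hn.
    unfold denom; match goal with |- 0 <= ?e => ring_simplify e end.
    nonneg_sum.
Qed.

Lemma denom_pos (n p : R) : 0 <= p -> n = 2 \/ 3 <= n -> 0 < denom n p.
Proof.
  intros Hp [-> | Hn]; unfold denom.
  - nra.
  - replace n with (3 + (n - 3)) by ring.
    assert (Hj : 0 <= n - 3) by lra.
    set (j := n - 3) in *; clearbody j; clear n Hn.
    apply Rlt_le_trans with 3; [lra|]. apply Rminus_le_0.
    match goal with |- 0 <= ?e => ring_simplify e end.
    nonneg_sum.
Qed.

(** The gap, multiplied by rho^4 K^2 [denom]^2, is the polynomial of
    [pos_numerator]. *)
Lemma majorant_above (rho K n : R) : 1 < rho -> 1 <= K -> n = 2 \/ 3 <= n ->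
  mode_target rho K n < mode_value rho K n (coth_majorant rho n).
Proof.
  intros Hr HK Hn.
  set (x := (rho - 1) / 2). set (m := K - 1).
  assert (Er : rho = 1 + 2 * x) by (unfold x; field).
  assert (EK : K = 1 + m) by (unfold m; ring).
  assert (Hx : 0 < x) by (unfold x; lra). assert (Hm : 0 <= m) by (unfold m; lra).
  clearbody x m.
  pose proof (pos_numerator x m n Hx Hm Hn) as HP; cbv zeta in HP.
  set (p := 2 * x * (1 + x)) in *.
  assert (HD : 0 < denom n p) by (apply denom_pos; [unfold p; nra | exact Hn]).
  assert (Ep : (rho ^ 2 - 1) / 2 = p) by (rewrite Er; unfold p; field).
  apply Rminus_lt_0.
  match type of HP with 0 < ?e =>
    replace (mode_value rho K n (coth_majorant rho n) - mode_target rho K n)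
      with (e / (rho ^ 4 * K ^ 2 * denom n p ^ 2)) end.
  - apply Rdiv_lt_0_compat; [exact HP|].
    repeat apply Rmult_lt_0_compat; first [apply pow_lt; lra | lra].
  - unfold mode_value, mode_target, coth_majorant; rewrite Ep.
    rewrite Rabs_pos_eq by lra.
    unfold lin_slope, quad_slope, weight, tilt, sh1, ch1.
    rewrite Er, EK.
    set (D := denom n p) in *; clearbody D; clear HP Ep; unfold p.
    field; lra.
Qed.

Lemma majorant_below (rho K n : R) : 1 < rho -> 1 <= K -> n = 2 \/ 3 <= n ->
  mode_target rho K (- n) < mode_value rho K (- n) (coth_majorant rho n).
Proof.
  intros Hr HK Hn.
  set (x := (rho - 1) / 2). set (m := K - 1).
  assert (Er : rho = 1 + 2 * x) by (unfold x; field).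
  assert (EK : K = 1 + m) by (unfold m; ring).
  assert (Hx : 0 < x) by (unfold x; lra). assert (Hm : 0 <= m) by (unfold m; lra).
  clearbody x m.
  pose proof (neg_numerator x m n Hx Hm Hn) as HP; cbv zeta in HP.
  set (p := 2 * x * (1 + x)) in *.
  assert (HD : 0 < denom n p) by (apply denom_pos; [unfold p; nra | exact Hn]).
  assert (Ep : (rho ^ 2 - 1) / 2 = p) by (rewrite Er; unfold p; field).
  apply Rminus_lt_0.
  match type of HP with 0 < ?e =>
    replace (mode_value rho K (- n) (coth_majorant rho n) - mode_target rho K (- n))
      with (e / (rho ^ 4 * K ^ 2 * denom n p ^ 2)) end.
  - apply Rdiv_lt_0_compat; [exact HP|].
    repeat apply Rmult_lt_0_compat; first [apply pow_lt; lra | lra].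
  - unfold mode_value, mode_target, coth_majorant; rewrite Ep.
    rewrite Rabs_Ropp, Rabs_pos_eq by lra.
    unfold lin_slope, quad_slope, weight, tilt, sh1, ch1.
    rewrite Er, EK.
    set (D := denom n p) in *; clearbody D; clear HP Ep; unfold p.
    field; lra.
Qed.

(** * Hyperbolic modes and the spectral inequality *)

(** The missing terms of the binomial expansion are nonnegative; in the
    induction the surplus is n (n-1) (n-2) (n-3) q^5 / 24, and a product of
    four consecutive integers is never negative. *)
Lemma binomial_lower (q : R) (n : nat) : 0 <= q -> let m := INR n in
  1 + m * q + m * (m - 1) / 2 * q ^ 2 + m * (m - 1) * (m - 2) / 6 * q ^ 3
    + m * (m - 1) * (m - 2) * (m - 3) / 24 * q ^ 4 <= (1 + q) ^ n.
Proof.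
  intros Hq m; unfold m; clear m. induction n as [|n IH].
  - simpl; lra.
  - rewrite S_INR; change ((1 + q) ^ S n) with ((1 + q) * (1 + q) ^ n).
    apply Rle_trans with ((1 + q) * (1 + INR n * q + INR n * (INR n - 1) / 2 * q ^ 2 +
      INR n * (INR n - 1) * (INR n - 2) / 6 * q ^ 3 +
      INR n * (INR n - 1) * (INR n - 2) * (INR n - 3) / 24 * q ^ 4)).
    2: apply Rmult_le_compat_l; lra.
    apply Rminus_le_0.
    assert (H : 0 <= INR n * (INR n - 1) * (INR n - 2) * (INR n - 3)).
    { destruct n as [|[|[|n]]]; [simpl; lra..|].
      pose proof (pos_INR n); rewrite !S_INR.
      repeat apply Rmult_le_pos; lra. }
    match goal with |- 0 <= ?e => replace e with
     (INR n * (INR n - 1) * (INR n - 2) * (INR n - 3) * (q ^ 5 / 24)) by field end.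
    apply Rmult_le_pos; [exact H|]. pose proof (pow_le q 5 Hq); lra.
Qed.

Definition ch (n r : R) := cosh (n * ln r).
(** The solution of (r d/dr)^2 s = n^2 s with s = 0 and r s' = 1 at r = 1; for
    n = 0 it degenerates to the logarithm. *)
Definition sh (n r : R) :=
  if Req_EM_T n 0 then ln r else sinh (n * ln r) / n.

Lemma cosh_opp x : cosh (- x) = cosh x.
Proof. unfold cosh; rewrite Ropp_involutive; field. Qed.
Lemma sinh_opp x : sinh (- x) = - sinh x.
Proof. unfold sinh; rewrite Ropp_involutive; field. Qed.
Lemma cosh_sinh_sq x : cosh x ^ 2 - sinh x ^ 2 = 1.
Proof.
  unfold cosh, sinh.
  assert (H : exp x * exp (- x) = 1).
  { rewrite <- exp_plus, Rplus_opp_r; apply exp_0. }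
  nra.
Qed.
Lemma cosh_ge_1 x : 1 <= cosh x.
Proof.
  unfold cosh.
  assert (H : exp x * exp (- x) = 1).
  { rewrite <- exp_plus, Rplus_opp_r; apply exp_0. }
  assert (E : exp (- x) * (exp x - 1) ^ 2 = exp x + exp (- x) - 2).
  { replace (exp (- x) * (exp x - 1) ^ 2)
      with (exp x * exp (- x) * exp x - 2 * (exp x * exp (- x)) + exp (- x)) by ring.
    rewrite H; ring. }
  pose proof (Rmult_le_pos _ _ (Rlt_le _ _ (exp_pos (- x))) (pow2_ge_0 (exp x - 1))).
  lra.
Qed.

Lemma ch_sh_sq n r : ch n r ^ 2 - n ^ 2 * sh n r ^ 2 = 1.
Proof.
  unfold ch, sh; destruct (Req_EM_T n 0) as [-> | Hn].
  - rewrite Rmult_0_l; unfold cosh; rewrite Ropp_0, exp_0; field.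
  - rewrite <- (cosh_sinh_sq (n * ln r)); field; exact Hn.
Qed.

Lemma ch_even n r : ch (- n) r = ch n r.
Proof.
  unfold ch; replace (- n * ln r) with (- (n * ln r)) by ring; apply cosh_opp.
Qed.

Lemma sh_even n r : sh (- n) r = sh n r.
Proof.
  unfold sh; destruct (Req_EM_T n 0) as [-> | Hn].
  - rewrite Ropp_0; destruct (Req_EM_T 0 0); congruence.
  - destruct (Req_EM_T (- n) 0); [lra|].
    replace (- n * ln r) with (- (n * ln r)) by ring.
    rewrite sinh_opp; field; exact Hn.
Qed.

Lemma lt_of_derive_pos (f df : R -> R) x : 0 < x ->
  (forall t, is_derive f t (df t)) -> (forall t, 0 < t -> 0 < df t) -> f 0 < f x.
Proof.
  intros Hx Hd Hp.
  destruct (MVT_cor2 f df 0 x Hx) as [c [Hc Hc']].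
  { intros c _; apply is_derive_Reals, Hd. }
  assert (0 < df c * (x - 0)); [|lra].
  apply Rmult_lt_0_compat; [apply Hp|]; lra.
Qed.

Lemma sinh_gt_id x : 0 < x -> x < sinh x.
Proof.
  intros Hx.
  assert (H : sinh 0 - 0 < sinh x - x).
  { apply (lt_of_derive_pos (fun t => sinh t - t) (fun t => cosh t - 1) x Hx).
    - intros t. unfold sinh, cosh; auto_derive; [exact I|field].
    - intros t Ht. unfold cosh.
      assert (H : exp t * exp (- t) = 1).
      { rewrite <- exp_plus, Rplus_opp_r; apply exp_0. }
      pose proof (exp_ineq1 t (Rgt_not_eq _ _ Ht)); pose proof (exp_pos (- t)). nra. }
  rewrite sinh_0 in H; lra.
Qed.

Lemma sinh_lt_id_cosh x : 0 < x -> sinh x < x * cosh x.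
Proof.
  intros Hx.
  assert (H : 0 * cosh 0 - sinh 0 < x * cosh x - sinh x).
  { apply (lt_of_derive_pos (fun t => t * cosh t - sinh t) (fun t => t * sinh t) x Hx).
    - intros t. unfold sinh, cosh; auto_derive; [exact I|field].
    - intros t Ht. apply Rmult_lt_0_compat; [exact Ht|].
      pose proof (sinh_gt_id t Ht); lra. }
  rewrite sinh_0 in H; lra.
Qed.

Lemma ln_pos r : 1 < r -> 0 < ln r.
Proof. intros H; rewrite <- ln_1; apply ln_increasing; lra. Qed.

Lemma sh1_eq rho : 0 < rho -> sh1 rho = sinh (ln rho).
Proof. intros H; unfold sh1, sinh; rewrite exp_Ropp, exp_ln; auto. Qed.
Lemma ch1_eq rho : 0 < rho -> ch1 rho = cosh (ln rho).
Proof. intros H; unfold ch1, cosh; rewrite exp_Ropp, exp_ln; auto. Qed.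

Lemma sh_pos n r : 1 < r -> 0 < sh n r.
Proof.
  intros Hr; pose proof (ln_pos r Hr) as Hl.
  assert (Hp : forall m, 0 < m -> 0 < sh m r).
  { intros m Hm; unfold sh; destruct (Req_EM_T m 0); [lra|].
    assert (0 < m * ln r) by now apply Rmult_lt_0_compat.
    apply Rdiv_lt_0_compat; [|exact Hm].
    pose proof (sinh_gt_id (m * ln r)); lra. }
  destruct (total_order_T n 0) as [[Hn | ->] | Hn].
  - rewrite <- sh_even; apply Hp; lra.
  - unfold sh; destruct (Req_EM_T 0 0); lra.
  - apply Hp; lra.
Qed.

Definition mode_coth (rho n : R) := sh1 rho * ch n rho / sh n rho.

Lemma mode_coth_ge_1 rho n : 1 < rho -> 0 < n -> 1 <= mode_coth rho n.
Proof.
  intros Hr Hn; pose proof (ln_pos rho Hr) as Hl.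
  pose proof (sh_pos n rho Hr) as Hs.
  apply Rmult_le_reg_r with (sh n rho); [exact Hs|].
  unfold mode_coth, Rdiv; rewrite Rmult_assoc, Rinv_l, Rmult_1_l, Rmult_1_r by lra.
  unfold sh; destruct (Req_EM_T n 0); [lra|].
  unfold ch; rewrite sh1_eq by lra.
  assert (Hx : 0 < n * ln rho) by now apply Rmult_lt_0_compat.
  apply Rmult_le_reg_r with n; [exact Hn|].
  replace (sinh (n * ln rho) / n * n) with (sinh (n * ln rho)) by (field; lra).
  pose proof (sinh_lt_id_cosh _ Hx).
  pose proof (sinh_gt_id _ Hl). pose proof (cosh_ge_1 (n * ln rho)).
  apply Rle_trans with (n * ln rho * cosh (n * ln rho)); [lra|].
  replace (sinh (ln rho) * cosh (n * ln rho) * n) with (n * sinh (ln rho) * cosh (n * ln rho))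
    by ring.
  apply Rmult_le_compat_r; [lra|]. apply Rmult_le_compat_l; lra.
Qed.

Lemma INR_two_or_more (n : nat) : (2 <= n)%nat -> INR n = 2 \/ 3 <= INR n.
Proof.
  intros Hn; destruct (Nat.eq_dec n 2) as [-> | H]; [left; simpl; ring|right].
  replace 3 with (INR 3) by (simpl; ring). apply le_INR; lia.
Qed.

(** The excess of n coth (n x) over n is 2 n / (exp (2 n x) - 1), and the
    exponential is a power of 1 + 2 p, bounded below by its binomial expansion. *)
Lemma mode_coth_le_majorant rho (n : nat) : 1 < rho -> (2 <= n)%nat ->
  mode_coth rho (INR n) <= coth_majorant rho (INR n).
Proof.
  intros Hr Hn.
  pose proof (INR_two_or_more n Hn) as Hn'.
  set (p := (rho ^ 2 - 1) / 2). assert (Hp : 0 < p) by (unfold p; nra).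
  pose proof (denom_pos (INR n) p (Rlt_le _ _ Hp) Hn') as HD.
  pose proof (binomial_lower (2 * p) n ltac:(lra)) as HB; cbv zeta in HB.
  assert (HN : 0 < INR n) by (destruct Hn'; lra).
  unfold mode_coth, coth_majorant, ch, sh; fold p.
  destruct (Req_EM_T (INR n) 0); [lra|].
  set (e := rho ^ n).
  assert (He : exp (INR n * ln rho) = e).
  { unfold e; rewrite <- Rpower_pow by lra; reflexivity. }
  assert (He1 : 1 < e) by (apply Rlt_pow_R1; [lra|lia]).
  unfold cosh, sinh; rewrite exp_Ropp, He.
  assert (HE : (1 + 2 * p) ^ n = e ^ 2).
  { replace (1 + 2 * p) with (rho ^ 2) by (unfold p; field).
    unfold e; rewrite <- !pow_mult; f_equal; lia. }
  rewrite HE in HB.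
  assert (H : 2 * INR n * p * denom (INR n) p <= 3 * (e ^ 2 - 1)).
  { unfold denom. nra. }
  replace (sh1 rho * ((e + / e) / 2) / ((e - / e) / 2 / INR n))
    with (INR n * sh1 rho + 2 * INR n * p / (rho * (e ^ 2 - 1))).
  2: { unfold sh1, p; field. repeat split; nra. }
  apply Rplus_le_compat_l.
  apply Rminus_le_0.
  replace (3 / (rho * denom (INR n) p) - 2 * INR n * p / (rho * (e ^ 2 - 1)))
    with ((3 * (e ^ 2 - 1) - 2 * INR n * p * denom (INR n) p) / (rho * denom (INR n) p
      * (e ^ 2 - 1))).
  2: { field. repeat split; nra. }
  apply Rle_div_r; [|lra].
  repeat apply Rmult_lt_0_compat; nra.
Qed.

Lemma sh1_pos rho : 1 < rho -> 0 < sh1 rho.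
Proof.
  intros H; rewrite sh1_eq by lra. pose proof (sinh_gt_id _ (ln_pos _ H)).
  pose proof (ln_pos _ H); lra.
Qed.
Lemma tilt_pos rho K : 1 < rho -> 1 <= K -> 0 < tilt rho K.
Proof. intros H HK; apply Rdiv_lt_0_compat; [now apply sh1_pos|lra]. Qed.
Lemma tilt_le rho K : 1 < rho -> 1 <= K -> tilt rho K <= sh1 rho.
Proof.
  intros H HK; unfold tilt. pose proof (sh1_pos rho H).
  apply Rle_div_l; nra.
Qed.
Lemma ch1_gt_1 rho : 1 < rho -> 1 < ch1 rho.
Proof.
  intros H. assert (E : ch1 rho = 1 + (rho - 1) ^ 2 / (2 * rho)) by (unfold ch1; field; lra).
  rewrite E. assert (0 < (rho - 1) ^ 2 / (2 * rho)); [|lra].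
  apply Rdiv_lt_0_compat; nra.
Qed.
Lemma ch1_lt rho : 1 < rho -> ch1 rho < 1 + sh1 rho.
Proof.
  intros H; unfold ch1, sh1.
  assert (/ rho < 1) by (rewrite <- Rinv_1; apply Rinv_lt_contravar; lra). lra.
Qed.
Lemma weight_pos rho K : 1 < rho -> 1 <= K -> 0 < weight rho K.
Proof.
  intros H HK; unfold weight; pose proof (tilt_pos rho K H HK); pose proof (ch1_gt_1 rho H);
    lra.
Qed.

(** Written this way, the dependence on G sits in one square, which makes
    monotonicity in G a matter of the sign of (1 + y n) G - 1. *)
Lemma mode_value_eq rho K n G : mode_value rho K n G =
  1 + 2 * tilt rho K * n * (1 + weight rho K * n) + (1 + weight rho K * n) ^ 2 * n ^ 2 * sh1
    rho ^ 2
  - ((1 + weight rho K * n) * G - 1) ^ 2.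
Proof. unfold mode_value; ring. Qed.

Lemma gap_zero rho K : 1 < rho -> 1 <= K ->
  mode_target rho K 0 < mode_value rho K 0 (mode_coth rho 0).
Proof.
  intros Hr HK.
  set (s := mode_coth rho 0).
  assert (Hs : 1 <= s < ch1 rho).
  { pose proof (ln_pos rho Hr) as Hl.
    pose proof (sinh_gt_id _ Hl). pose proof (sinh_lt_id_cosh _ Hl).
    unfold s, mode_coth, ch, sh; destruct (Req_EM_T 0 0); [|lra].
    rewrite Rmult_0_l, cosh_0, sh1_eq, ch1_eq, Rmult_1_r by lra. split.
    - apply Rle_div_r; lra.
    - apply Rlt_div_l; lra. }
  unfold mode_target, mode_value, lin_slope. rewrite Rabs_R0. nra.
Qed.

Lemma gap_minus_one rho K : 1 < rho -> 1 <= K ->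
  mode_target rho K (-1) < mode_value rho K (-1) (mode_coth rho (-1)).
Proof.
  intros Hr HK.
  assert (E : mode_coth rho (-1) = ch1 rho).
  { unfold mode_coth; replace (-1) with (- (1)) by ring.
    rewrite ch_even, sh_even; unfold ch, sh.
    destruct (Req_EM_T 1 0); [lra|]. rewrite Rmult_1_l, <- sh1_eq, <- ch1_eq by lra.
    pose proof (sh1_pos rho Hr); field; lra. }
  rewrite E; unfold mode_target, mode_value, lin_slope. rewrite (Rabs_left (-1)) by lra.
  assert (Hq : ch1 rho ^ 2 - sh1 rho ^ 2 = 1) by (unfold ch1, sh1; field; lra).
  pose proof (ch1_gt_1 rho Hr). pose proof (tilt_pos rho K Hr HK).
  assert (Hw : weight rho K = ch1 rho - 1 + tilt rho K) by reflexivity.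
  set (y := weight rho K) in *. set (k := tilt rho K) in *. set (c := ch1 rho) in *.
  set (s := sh1 rho) in *. clearbody y k c s. subst y.
  apply Rminus_lt_0.
  match goal with |- 0 < ?g => replace g with
    (2 * k ^ 2 + 4 * (c - 1) + (2 - c - k) ^ 2 * (1 - (c ^ 2 - s ^ 2))) by ring end.
  rewrite Hq; nra.
Qed.

Lemma gap_above rho K (n : nat) : 1 < rho -> 1 <= K -> (2 <= n)%nat ->
  mode_target rho K (INR n) < mode_value rho K (INR n) (mode_coth rho (INR n)).
Proof.
  intros Hr HK Hn.
  pose proof (INR_two_or_more n Hn) as Hn'.
  eapply Rlt_le_trans; [apply majorant_above; eassumption|].
  pose proof (mode_coth_le_majorant rho n Hr Hn) as Hb.
  assert (H0 : 0 < INR n) by (destruct Hn'; lra).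
  pose proof (mode_coth_ge_1 rho (INR n) Hr H0) as H1.
  pose proof (weight_pos rho K Hr HK).
  rewrite !mode_value_eq.
  set (M := 1 + weight rho K * INR n). assert (HM : 1 <= M) by (unfold M; nra).
  assert (0 <= (M * coth_majorant rho (INR n) - 1) ^ 2 - (M * mode_coth rho (INR n) - 1) ^ 2);
    [|lra].
  set (g := mode_coth rho (INR n)) in *. set (b := coth_majorant rho (INR n)) in *.
  replace ((M * b - 1) ^ 2 - (M * g - 1) ^ 2) with (M * (b - g) * (M * (b + g) - 2)) by ring.
  repeat apply Rmult_le_pos; nra.
Qed.

(** Write M = 1 - y n.  If M <= 0 or M G >= 1, then |M G - 1| grows with G and
    the majorant of G may be substituted.  Otherwise 0 <= 1 - M G <= 1 - M,
    because G >= 1, and this crude bound is enough. *)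
Lemma gap_below rho K (n : nat) : 1 < rho -> 1 <= K -> (2 <= n)%nat ->
  mode_target rho K (- INR n) < mode_value rho K (- INR n) (mode_coth rho (- INR n)).
Proof.
  intros Hr HK Hn.
  pose proof (INR_two_or_more n Hn) as Hn'.
  pose proof (majorant_below rho K (INR n) Hr HK Hn') as Hm.
  pose proof (mode_coth_le_majorant rho n Hr Hn) as Hb.
  assert (H0 : 0 < INR n) by (destruct Hn'; lra).
  pose proof (mode_coth_ge_1 rho (INR n) Hr H0) as H1.
  assert (E : mode_coth rho (- INR n) = mode_coth rho (INR n)).
  { unfold mode_coth; now rewrite ch_even, sh_even. }
  rewrite E; clear E.
  rewrite mode_value_eq in Hm |- *.
  pose proof (weight_pos rho K Hr HK) as Hw. pose proof (tilt_pos rho K Hr HK) as Ht.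
  pose proof (tilt_le rho K Hr HK) as Hts. pose proof (ch1_lt rho Hr) as Hcs.
  pose proof (ch1_gt_1 rho Hr) as Hc.
  assert (Ew : weight rho K = ch1 rho - 1 + tilt rho K) by reflexivity.
  set (g := mode_coth rho (INR n)) in *. set (b := coth_majorant rho (INR n)) in *.
  set (M := 1 + weight rho K * - INR n) in *.
  destruct (Rle_dec M 0) as [HM | HM]; [|destruct (Rle_dec 1 (M * g)) as [HMg | HMg]].
  - assert (0 <= (M * b - 1) ^ 2 - (M * g - 1) ^ 2); [|lra].
    replace ((M * b - 1) ^ 2 - (M * g - 1) ^ 2) with (- M * (b - g) * (2 - M * (b + g)))
      by ring.
    repeat apply Rmult_le_pos; nra.
  - assert (0 <= (M * b - 1) ^ 2 - (M * g - 1) ^ 2); [|lra].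
    replace ((M * b - 1) ^ 2 - (M * g - 1) ^ 2) with (M * (b - g) * (M * (b + g) - 2)) by ring.
    repeat apply Rmult_le_pos; nra.
  - clear Hm Hb. clearbody b. apply Rnot_le_lt in HM. apply Rnot_le_lt in HMg.
    assert (HMg2 : (M * g - 1) ^ 2 <= (M - 1) ^ 2).
    { apply Rminus_le_0.
      replace ((M - 1) ^ 2 - (M * g - 1) ^ 2) with (M * (g - 1) * (2 - M - M * g)) by ring.
      repeat apply Rmult_le_pos; nra. }
    apply Rlt_le_trans with (1 + 2 * tilt rho K * - INR n * M + M ^ 2 * (- INR n) ^ 2 * sh1
      rho ^ 2 - (M - 1) ^ 2); [|lra].
    clear HMg2 HMg. unfold mode_target, lin_slope, quad_slope.
    rewrite Rabs_Ropp, Rabs_pos_eq by lra.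
    assert (HM2 : 0 < M ^ 2 * (- INR n) ^ 2 * sh1 rho ^ 2).
    { pose proof (sh1_pos rho Hr).
      replace (M ^ 2 * (- INR n) ^ 2 * sh1 rho ^ 2) with ((M * INR n * sh1 rho) ^ 2) by ring.
      apply pow_lt; do 2 (apply Rmult_lt_0_compat; [|assumption]); assumption. }
    unfold M in *. clear M HM. set (y := weight rho K) in *. set (k := tilt rho K) in *.
    set (c := ch1 rho) in *. set (s := sh1 rho) in *. set (m := INR n) in *.
    clearbody y k c s m g. apply Rminus_lt_0.
    match type of HM2 with 0 < ?e => match goal with |- 0 < ?g =>
      replace g with (e + 2 * m * (c - 1) + (m + 1) * (c - 1) ^ 2
         + y * (m * m * (k - c + 1) + 2 * (s - k) * m * (m - 1)) + m * y * (y - c + 1 - k)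
         + m * y * (c - 1 + k)) end end.
    2: { subst y. ring. }
    assert (Hm2 : 2 <= m) by (destruct Hn'; lra).
    assert (0 <= y * (m * m * (k - c + 1) + 2 * (s - k) * m * (m - 1))).
    { apply Rmult_le_pos; [lra|].
      assert (m * m <= 2 * m * (m - 1)) by nra.
      assert (0 <= (s - k) * (2 * m * (m - 1) - m * m)) by nra.
      nra. }
    subst y.
    assert (0 <= m * (c - 1)) by nra.
    assert (0 <= (m + 1) * (c - 1) ^ 2) by nra.
    assert (0 <= m * (c - 1 + k) * (c - 1 + k)) by nra.
    nra.
Qed.

(** The spectral inequality: it converts the three moment estimates for
    |p_n|^2 into the lower bound for sum f(n) |p_n|^2, and its strictness
    yields the equality case. *)
Lemma mode_gap rho K (n : Z) : 1 < rho -> 1 <= K -> n <> 1%Z ->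
  mode_target rho K (IZR n) < mode_value rho K (IZR n) (mode_coth rho (IZR n)).
Proof.
  intros Hr HK Hn.
  destruct (Z.eq_dec n 0) as [-> | H0]; [now apply gap_zero|].
  destruct (Z.eq_dec n (-1)) as [-> | H1]; [now apply gap_minus_one|].
  destruct (Z.lt_ge_cases 0 n).
  - replace (IZR n) with (INR (Z.to_nat n)) by (rewrite INR_IZR_INZ; f_equal; lia).
    apply gap_above; auto; lia.
  - replace (IZR n) with (- INR (Z.to_nat (- n)))
      by (rewrite INR_IZR_INZ, <- opp_IZR; f_equal; lia).
    apply gap_below; auto; lia.
Qed.

(** * Averages over a period *)

Definition cts (f : R -> R) : Prop := forall x, continuous f x.
Definition cts2 (F : R -> R -> R) : Prop := forall x y, continuity_2d_pt F x y.
Definition per (f : R -> R) : Prop := forall t, f (t + 2 * PI) = f t.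

Lemma cts_const c : cts (fun _ => c).
Proof. intros x; apply continuous_const. Qed.
Lemma cts_id : cts (fun x => x).
Proof. intros x; apply continuous_id. Qed.
Lemma cts_plus f g : cts f -> cts g -> cts (fun x => f x + g x).
Proof. intros Hf Hg x; apply @continuous_plus; auto. Qed.
Lemma cts_opp f : cts f -> cts (fun x => - f x).
Proof. intros Hf x; apply @continuous_opp; auto. Qed.
Lemma cts_minus f g : cts f -> cts g -> cts (fun x => f x - g x).
Proof. intros Hf Hg; apply cts_plus; [|apply cts_opp]; auto. Qed.
Lemma cts_mult f g : cts f -> cts g -> cts (fun x => f x * g x).
Proof. intros Hf Hg x; apply @continuous_mult; auto. Qed.
Lemma cts_div f c : cts f -> cts (fun x => f x / c).
Proof. intros Hf; apply cts_mult; [auto|apply cts_const]. Qed.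
Lemma cts_pow f n : cts f -> cts (fun x => f x ^ n).
Proof.
  intros Hf; induction n as [|n IH]; simpl; [apply cts_const|now apply cts_mult].
Qed.
Lemma cts_comp f g : cts f -> cts g -> cts (fun x => f (g x)).
Proof. intros Hf Hg x; apply continuous_comp; auto. Qed.
Lemma cts_cos f : cts f -> cts (fun x => cos (f x)).
Proof. apply cts_comp; intros x; apply continuous_cos. Qed.
Lemma cts_sin f : cts f -> cts (fun x => sin (f x)).
Proof. apply cts_comp; intros x; apply continuous_sin. Qed.
Lemma cts_shift f a : cts f -> cts (fun x => f (x + a)).
Proof. intros Hf; apply (cts_comp f); auto. apply cts_plus; [apply cts_id|apply cts_const].
  Qed.
Lemma cts_shift' f a : cts f -> cts (fun x => f (a + x)).
Proof. intros Hf; apply (cts_comp f); auto. apply cts_plus; [apply cts_const|apply cts_id].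
  Qed.
Lemma cts_ext f g : (forall x, f x = g x) -> cts f -> cts g.
Proof. intros E Hf x; apply (continuous_ext f); auto. Qed.
Lemma cts_derive f df : (forall x, is_derive f x (df x)) -> cts f.
Proof. intros H x; apply @ex_derive_continuous; exists (df x); apply H. Qed.

Create HintDb cts.
#[export] Hint Resolve cts_const cts_id cts_plus cts_opp cts_minus cts_mult cts_div
  cts_pow cts_cos cts_sin cts_shift cts_shift' : cts.
Ltac cts := solve [auto 20 with cts].

Lemma cts_ex_RInt f a b : cts f -> ex_RInt f a b.
Proof. intros H; apply @ex_RInt_continuous; intros; apply H. Qed.
#[export] Hint Resolve cts_ex_RInt : cts.

Lemma RInt_ext_all (f g : R -> R) a b : (forall x, f x = g x) -> RInt f a b = RInt g a b.
Proof. intros H; apply RInt_ext; auto. Qed.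

Lemma is_RInt_cts f a b : cts f -> is_RInt f a b (RInt f a b).
Proof. intros H; apply @RInt_correct; cts. Qed.

Lemma is_derive_primitive f a x : cts f -> is_derive (fun b => RInt f a b) x (f x).
Proof.
  intros H; apply (is_derive_RInt f (fun b => RInt f a b) a); [|apply H].
  exists (mkposreal 1 Rlt_0_1); intros y _; now apply is_RInt_cts.
Qed.

Lemma RInt_primitive f df a b : (forall x, is_derive f x (df x)) -> cts df ->
  RInt df a b = f b - f a.
Proof.
  intros Hd Hc; apply is_RInt_unique.
  apply (is_RInt_derive f df a b); intros; auto.
Qed.

Definition avg (f : R -> R) : R := RInt f 0 (2 * PI) / (2 * PI).

Lemma two_pi_pos : 0 < 2 * PI.
Proof. pose proof PI_RGT_0; lra. Qed.

Lemma avg_ext f g : (forall x, f x = g x) -> avg f = avg g.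
Proof. intros H; unfold avg; now rewrite (RInt_ext_all f g). Qed.
Lemma avg_plus f g : cts f -> cts g -> avg (fun x => f x + g x) = avg f + avg g.
Proof.
  intros Hf Hg; unfold avg.
  rewrite (RInt_plus f g) by cts. unfold plus; simpl. pose proof two_pi_pos; field; lra.
Qed.
Lemma avg_minus f g : cts f -> cts g -> avg (fun x => f x - g x) = avg f - avg g.
Proof.
  intros Hf Hg; unfold avg.
  rewrite (RInt_minus f g) by cts. unfold minus, plus, opp; simpl. pose proof two_pi_pos;
    field; lra.
Qed.
Lemma avg_scal c f : cts f -> avg (fun x => c * f x) = c * avg f.
Proof.
  intros Hf; unfold avg.
  rewrite (RInt_scal f) by cts. unfold scal; simpl; unfold mult; simpl. pose proof two_pi_pos;
    field; lra.
Qed.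
Lemma avg_const c : avg (fun _ => c) = c.
Proof.
  unfold avg; rewrite RInt_const. unfold scal; simpl; unfold mult; simpl.
  pose proof two_pi_pos; field; lra.
Qed.
Lemma avg_le f g : cts f -> cts g ->
  (forall x, 0 < x < 2 * PI -> f x <= g x) -> avg f <= avg g.
Proof.
  intros Hf Hg H; unfold avg. pose proof two_pi_pos.
  apply Rmult_le_compat_r; [left; apply Rinv_0_lt_compat; lra|].
  apply RInt_le; auto with cts; lra.
Qed.
Lemma avg_ge_0 f : cts f -> (forall x, 0 < x < 2 * PI -> 0 <= f x) -> 0 <= avg f.
Proof.
  intros Hf H; rewrite <- (avg_const 0); apply avg_le; auto with cts.
Qed.

Lemma avg_primitive f df : (forall x, is_derive f x (df x)) -> cts df -> per f ->
  avg df = 0.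
Proof.
  intros Hd Hc Hp; unfold avg; rewrite (RInt_primitive f df) by auto.
  rewrite <- (Hp 0), Rplus_0_l. unfold Rminus, Rdiv; rewrite Rplus_opp_r; ring.
Qed.

Lemma is_derive_Rmult (f g : R -> R) x df dg :
  is_derive f x df -> is_derive g x dg ->
  is_derive (fun s => f s * g s) x (df * g x + f x * dg).
Proof.
  intros Hf Hg; apply (is_derive_mult f g x df dg Hf Hg). intros; apply Rmult_comm.
Qed.

Lemma avg_by_parts f df g dg :
  (forall x, is_derive f x (df x)) -> (forall x, is_derive g x (dg x)) ->
  cts df -> cts dg -> per f -> per g ->
  avg (fun x => df x * g x) = - avg (fun x => f x * dg x).
Proof.
  intros Hf Hg Hdf Hdg Pf Pg.
  pose proof (cts_derive _ _ Hf). pose proof (cts_derive _ _ Hg).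
  assert (H1 : avg (fun x => df x * g x + f x * dg x) = 0).
  { apply (avg_primitive (fun x => f x * g x)).
    - intros x; now apply is_derive_Rmult.
    - cts.
    - intros t; now rewrite Pf, Pg. }
  rewrite avg_plus in H1 by cts. lra.
Qed.

Lemma RInt_period_shift f a : cts f -> per f -> RInt f a (a + 2 * PI) = RInt f 0 (2 * PI).
Proof.
  intros Hf Hp.
  assert (HE : RInt f (2 * PI) (a + 2 * PI) = RInt f 0 a).
  { pose proof (RInt_comp_lin f 1 (2 * PI) 0 a) as H.
    rewrite !Rmult_1_l, Rplus_0_l in H. rewrite <- H by cts.
    apply RInt_ext_all; intros x. unfold scal; simpl; unfold mult; simpl.
    now rewrite !Rmult_1_l, Hp. }
  assert (H1 := RInt_Chasles f 0 a (a + 2 * PI) ltac:(cts) ltac:(cts)).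
  assert (H2 := RInt_Chasles f 0 (2 * PI) (a + 2 * PI) ltac:(cts) ltac:(cts)).
  unfold plus in *; simpl in *. lra.
Qed.

Lemma avg_shift f a : cts f -> per f -> avg (fun x => f (x + a)) = avg f.
Proof.
  intros Hf Hp; unfold avg; f_equal.
  pose proof (RInt_comp_lin f 1 a 0 (2 * PI)) as H.
  rewrite !Rmult_1_l, Rplus_0_l in H.
  rewrite <- (RInt_period_shift f a) by auto.
  rewrite (Rplus_comm a). rewrite <- H by cts.
  apply RInt_ext_all; intros x. unfold scal; simpl; unfold mult; simpl.
  now rewrite !Rmult_1_l.
Qed.

Lemma cts_pos_near f x : cts f -> 0 < f x ->
  exists d, 0 < d /\ forall y, Rabs (y - x) < d -> 0 < f y.
Proof.
  intros Hf H.
  destruct (Hf x (fun y => 0 < y)) as [d Hd].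
  - exists (mkposreal _ H); intros y Hy.
    unfold ball in Hy; simpl in Hy; unfold AbsRing_ball, abs, minus, plus, opp in Hy;
      simpl in Hy.
    apply Rabs_def2 in Hy; lra.
  - exists d; split; [apply cond_pos|]. intros y Hy; apply Hd, Hy.
Qed.

(** A positive value at one point would persist on an interval and make the
    integral positive. *)
Lemma avg_eq_0 f : cts f -> (forall x, 0 <= f x) -> avg f = 0 ->
  forall x, 0 < x < 2 * PI -> f x = 0.
Proof.
  intros Hf Hp H0 x Hx.
  destruct (Req_dec (f x) 0) as [|Hn]; [assumption|exfalso].
  assert (Hfx : 0 < f x) by (pose proof (Hp x); lra).
  destruct (cts_pos_near f x Hf Hfx) as [d [Hd Hdf]].
  set (e := Rmin (x / 2) (d / 2)).
  assert (He : 0 < e) by (unfold e; apply Rmin_glb_lt; lra).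
  assert (He1 : e <= x / 2) by apply Rmin_l. assert (He2 : e <= d / 2) by apply Rmin_r.
  assert (Hpos : 0 < RInt f (x - e) x).
  { apply RInt_gt_0; [lra| |intros; apply Hf].
    intros y Hy; apply Hdf; apply Rabs_def1; lra. }
  assert (H1 := RInt_Chasles f 0 (x - e) x ltac:(cts) ltac:(cts)).
  assert (H2 := RInt_Chasles f 0 x (2 * PI) ltac:(cts) ltac:(cts)).
  assert (H3 : 0 <= RInt f 0 (x - e)) by (apply RInt_ge_0; auto with cts; lra).
  assert (H4 : 0 <= RInt f x (2 * PI)) by (apply RInt_ge_0; auto with cts; lra).
  unfold avg in H0. pose proof two_pi_pos.
  apply Rmult_integral in H0; destruct H0 as [H0|H0].
  - unfold plus in *; simpl in *. lra.
  - apply Rinv_neq_0_compat in H0; [assumption|lra].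
Qed.

Lemma cts2_section F x : cts2 F -> cts (F x).
Proof.
  intros H y P [e He]. destruct (H x y e) as [d Hd].
  exists d; intros z Hz. apply He. apply (Hd x z); [|exact Hz].
  rewrite Rminus_diag, Rabs_R0; apply cond_pos.
Qed.
Lemma cts2_section' F y : cts2 F -> cts (fun x => F x y).
Proof.
  intros H x P [e He]. destruct (H x y e) as [d Hd].
  exists d; intros z Hz. apply He. apply (Hd z y); [exact Hz|].
  rewrite Rminus_diag, Rabs_R0; apply cond_pos.
Qed.

Lemma cts_RInt_param_le F a b : a <= b -> cts2 F -> cts (fun x => RInt (F x) a b).
Proof.
  intros Hab HF x P [e He].
  assert (He' : 0 < e / (b - a + 1)) by (apply Rdiv_lt_0_compat; [apply cond_pos|lra]).
  destruct (uniform_continuity_2d_1d' F a b x (fun t _ => HF x t) (mkposreal _ He')) as [d Hd].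
  exists d; intros y Hy; apply He.
  change (Rabs (RInt (F y) a b - RInt (F x) a b) < e).
  change (Rabs (y - x) < d) in Hy.
  pose proof (cts2_section F x HF). pose proof (cts2_section F y HF).
  rewrite <- (RInt_minus (F y) (F x)) by cts.
  apply Rle_lt_trans with ((b - a) * (e / (b - a + 1))).
  - apply abs_RInt_le_const; [exact Hab|unfold minus, plus, opp; simpl; cts|].
    intros t Ht. left.
    apply Rabs_def2 in Hy. pose proof (cond_pos d).
    apply (Hd t x t y); try lra. rewrite Rminus_diag, Rabs_R0; lra.
  - replace (pos e) with ((b - a + 1) * (e / (b - a + 1))) at 2 by (field; lra).
    apply Rmult_lt_compat_r; lra.
Qed.

Lemma cts_RInt_param F a b : cts2 F -> cts (fun x => RInt (F x) a b).
Proof.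
  intros HF; destruct (Rle_dec a b) as [H|H]; [now apply cts_RInt_param_le|].
  apply (cts_ext (fun x => - RInt (F x) b a)).
  - intros x; apply (opp_RInt_swap (F x)); apply cts_ex_RInt, cts2_section, HF.
  - apply cts_opp, cts_RInt_param_le; [lra|exact HF].
Qed.

Lemma cts_avg_param F : cts2 F -> cts (fun x => avg (F x)).
Proof.
  intros H; apply cts_div, cts_RInt_param; auto.
Qed.

Lemma cts2_swap F : cts2 F -> cts2 (fun x y => F y x).
Proof.
  intros H x y e; destruct (H y x e) as [d Hd]; exists d; auto.
Qed.

(** As functions of the upper limit b, both sides vanish at 0 and have the
    same derivative. *)
Lemma Fubini_cts F a b : 0 < a -> 0 < b -> cts2 F ->
  RInt (fun x => RInt (F x) 0 b) 0 a = RInt (fun t => RInt (fun x => F x t) 0 a) 0 b.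
Proof.
  intros Ha Hb HF.
  pose proof (cts_RInt_param (fun t x => F x t) 0 a (cts2_swap _ HF)) as HC.
  cbv beta in HC.
  set (D := fun s => RInt (fun x => RInt (F x) 0 s) 0 a
                     - RInt (fun t => RInt (fun x => F x t) 0 a) 0 s).
  assert (E : D 0 = D b).
  { apply (eq_is_derive D 0 b); [|exact Hb]. intros s Hs.
    evar_last; [|exact (Rminus_diag (RInt (fun x => F x s) 0 a))].
    unfold D. apply @is_derive_minus.
    - assert (Hd : forall u x, Derive (fun s => RInt (F x) 0 s) u = F x u).
      { intros u x; apply is_derive_unique, is_derive_primitive, cts2_section, HF. }
      replace (RInt (fun x => F x s) 0 a) with
        (RInt (fun x => Derive (fun s => RInt (F x) 0 s) s) 0 a)
        by (apply RInt_ext_all; intros; apply Hd).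
      apply (is_derive_RInt_param (fun s x => RInt (F x) 0 s)).
      + exists (mkposreal 1 Rlt_0_1); intros y _ t _. exists (F t y).
        apply is_derive_primitive, cts2_section, HF.
      + intros t _. apply (continuity_2d_pt_ext (fun u v => F v u)); [intros; now rewrite Hd|].
        apply (cts2_swap _ HF).
      + exists (mkposreal 1 Rlt_0_1); intros y _. apply cts_ex_RInt, cts_RInt_param, HF.
    - apply (is_derive_primitive (fun t => RInt (fun x => F x t) 0 a) 0 s HC). }
  unfold D in E. rewrite !RInt_point in E.
  rewrite (RInt_ext_all (fun x => RInt (F x) 0 0) (fun _ => 0)) in E
    by (intros x; exact (RInt_point 0 (F x))).
  rewrite RInt_const in E. unfold scal, zero in E; simpl in E; unfold mult in E; simpl in E.
  lra.
Qed.

Lemma avg_swap F : cts2 F ->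
  avg (fun x => avg (F x)) = avg (fun t => avg (fun x => F x t)).
Proof.
  intros HF; unfold avg. pose proof two_pi_pos as H2.
  rewrite (RInt_ext_all (fun x => RInt (F x) 0 (2 * PI) / (2 * PI))
             (fun x => scal (/ (2 * PI)) (RInt (F x) 0 (2 * PI))))
    by (intros; unfold scal; simpl; unfold mult; simpl; field; lra).
  rewrite (RInt_ext_all (fun t => RInt (fun x => F x t) 0 (2 * PI) / (2 * PI))
             (fun t => scal (/ (2 * PI)) (RInt (fun x => F x t) 0 (2 * PI))))
    by (intros; unfold scal; simpl; unfold mult; simpl; field; lra).
  rewrite !RInt_scal.
  - now rewrite Fubini_cts.
  - apply cts_ex_RInt, (cts_RInt_param (fun t x => F x t)), cts2_swap, HF.
  - apply cts_ex_RInt, cts_RInt_param, HF.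
Qed.

Lemma cts2_plus F G : cts2 F -> cts2 G -> cts2 (fun x y => F x y + G x y).
Proof. intros H K x y; apply continuity_2d_pt_plus; auto. Qed.
Lemma cts2_minus F G : cts2 F -> cts2 G -> cts2 (fun x y => F x y - G x y).
Proof. intros H K x y; apply continuity_2d_pt_minus; auto. Qed.
Lemma cts2_mult F G : cts2 F -> cts2 G -> cts2 (fun x y => F x y * G x y).
Proof. intros H K x y; apply continuity_2d_pt_mult; auto. Qed.
Lemma cts2_opp F : cts2 F -> cts2 (fun x y => - F x y).
Proof. intros H x y; apply continuity_2d_pt_opp; auto. Qed.
Lemma cts2_comp f F : cts f -> cts2 F -> cts2 (fun x y => f (F x y)).
Proof.
  intros H K x y; apply continuity_1d_2d_pt_comp; auto.
  apply continuity_pt_filterlim, H.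
Qed.
Lemma cts2_fst : cts2 (fun x _ => x).
Proof. intros x y; apply continuity_2d_pt_id1. Qed.
Lemma cts2_snd : cts2 (fun _ y => y).
Proof. intros x y; apply continuity_2d_pt_id2. Qed.
Lemma cts2_1 f : cts f -> cts2 (fun x _ => f x).
Proof. intros H; apply (cts2_comp f); [auto|apply cts2_fst]. Qed.
Lemma cts2_2 f : cts f -> cts2 (fun _ y => f y).
Proof. intros H; apply (cts2_comp f); [auto|apply cts2_snd]. Qed.
Lemma cts2_sum f : cts f -> cts2 (fun x y => f (y + x)).
Proof.
  intros H; apply (cts2_comp f); [auto|apply cts2_plus; [apply cts2_snd|apply cts2_fst]].
Qed.
#[export] Hint Resolve cts2_plus cts2_minus cts2_mult cts2_opp cts2_fst cts2_snd
  cts2_1 cts2_2 cts2_sum cts_RInt_param cts2_section cts2_section' : cts.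

(** * The Fejér kernel and Parseval's identity *)

Lemma cos_sin_2PI_Z (n : Z) : cos (IZR n * (2 * PI)) = 1 /\ sin (IZR n * (2 * PI)) = 0.
Proof.
  assert (Hn : forall k : nat, cos (INR k * (2 * PI)) = 1 /\ sin (INR k * (2 * PI)) = 0).
  { intros k. replace (INR k * (2 * PI)) with (0 + 2 * INR k * PI) by ring.
    now rewrite cos_period, sin_period, cos_0, sin_0. }
  destruct (Z.le_gt_cases 0 n).
  - replace (IZR n) with (INR (Z.to_nat n)) by (rewrite INR_IZR_INZ; f_equal; lia). apply Hn.
  - replace (IZR n) with (- INR (Z.to_nat (- n)))
      by (rewrite INR_IZR_INZ, <- opp_IZR; f_equal; lia).
    rewrite Ropp_mult_distr_l_reverse, cos_neg, sin_neg.
    destruct (Hn (Z.to_nat (- n))) as [-> ->]; split; ring.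
Qed.

Lemma per_cos (n : Z) : per (fun t => cos (IZR n * t)).
Proof.
  intros t; rewrite Rmult_plus_distr_l, cos_plus.
  destruct (cos_sin_2PI_Z n) as [-> ->]; ring.
Qed.
Lemma per_sin (n : Z) : per (fun t => sin (IZR n * t)).
Proof.
  intros t; rewrite Rmult_plus_distr_l, sin_plus.
  destruct (cos_sin_2PI_Z n) as [-> ->]; ring.
Qed.

Lemma is_derive_cos_lin n x : is_derive (fun t => cos (n * t)) x (- n * sin (n * x)).
Proof. auto_derive; [exact I|ring]. Qed.
Lemma is_derive_sin_lin n x : is_derive (fun t => sin (n * t)) x (n * cos (n * x)).
Proof. auto_derive; [exact I|ring]. Qed.

Lemma avg_cos (n : Z) : n <> 0%Z -> avg (fun t => cos (IZR n * t)) = 0.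
Proof.
  intros Hn; apply (avg_primitive (fun t => sin (IZR n * t) / IZR n)).
  - intros x; auto_derive; [exact I|]. field. now apply not_0_IZR.
  - cts.
  - intros t; f_equal; apply per_sin.
Qed.

Definition ca (f : R -> R) (n : R) := avg (fun t => f t * cos (n * t)).
Definition sa (f : R -> R) (n : R) := avg (fun t => f t * sin (n * t)).

(** The correlation of f with its translates; its cosine coefficients are the
    squared Fourier coefficients of f, so convolution kernels integrated
    against it produce weighted sums of those squares. *)
Definition autocorr (f : R -> R) (x : R) := avg (fun t => f (t + x) * f t).

Lemma cts_autocorr f : cts f -> cts (autocorr f).
Proof. intros H; apply (cts_avg_param (fun x t => f (t + x) * f t)); cts. Qed.

Lemma autocorr_coef f (n : Z) : cts f -> per f ->
  avg (fun x => autocorr f x * cos (IZR n * x)) = ca f (IZR n) ^ 2 + sa f (IZR n) ^ 2.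
Proof.
  intros Hf Pf. set (m := IZR n).
  rewrite (avg_ext _ (fun x => avg (fun t => f (t + x) * f t * cos (m * x)))).
  2: { intros x. unfold autocorr. rewrite Rmult_comm, <- avg_scal by cts.
       apply avg_ext; intros; ring. }
  rewrite avg_swap by cts.
  rewrite (avg_ext _ (fun t => ca f m * (f t * cos (m * t)) + sa f m * (f t * sin (m * t)))).
  { rewrite avg_plus, !avg_scal by cts. fold (ca f m) (sa f m). ring. }
  intros t.
  rewrite <- (avg_shift (fun x => f (t + x) * f t * cos (m * x)) (- t)).
  - rewrite (avg_ext _ (fun x => (f t * cos (m * t)) * (f x * cos (m * x))
                                + (f t * sin (m * t)) * (f x * sin (m * x)))).
    { rewrite avg_plus, !avg_scal by cts. fold (ca f m) (sa f m). ring. }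
    intros x. replace (t + (x + - t)) with x by ring.
    replace (m * (x + - t)) with (m * x - m * t) by ring.
    rewrite cos_minus; ring.
  - cts.
  - intros x. unfold m; rewrite (per_cos n x). now rewrite <- Rplus_assoc, Pf.
Qed.

Fixpoint Dirichlet (N : nat) (x : R) : R :=
  match N with O => 1 | S M => Dirichlet M x + 2 * cos (INR (S M) * x) end.
(** The Fejér kernel without its normalisation, that is, N + 1 times the usual
    one. *)
Fixpoint Fejer (N : nat) (x : R) : R :=
  match N with O => 1 | S M => Fejer M x + Dirichlet (S M) x end.
(** The partial sum of |c_n|^2 over |n| <= N for the complex Fourier
    coefficients c_n of f. *)
Fixpoint energy (f : R -> R) (N : nat) : R :=
  match N with
  | O => ca f 0 ^ 2 + sa f 0 ^ 2
  | S M => energy f M + 2 * (ca f (INR (S M)) ^ 2 + sa f (INR (S M)) ^ 2)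
  end.

Lemma cts_Dirichlet N : cts (Dirichlet N).
Proof. induction N; cbn [Dirichlet]; cts. Qed.
#[export] Hint Resolve cts_Dirichlet cts_autocorr : cts.
Lemma cts_Fejer N : cts (Fejer N).
Proof. induction N; cbn [Fejer]; cts. Qed.
#[export] Hint Resolve cts_Fejer : cts.

Lemma Dirichlet_eq N x :
  Dirichlet N x * (1 - cos x) = cos (INR N * x) - cos (INR (S N) * x).
Proof.
  induction N as [|N IH].
  - simpl. rewrite Rmult_0_l, cos_0, !Rmult_1_l; ring.
  - cbn [Dirichlet]. rewrite Rmult_plus_distr_r, IH.
    rewrite (S_INR (S N)). set (a := INR (S N)).
    replace (INR N) with (a - 1) by (unfold a; rewrite S_INR; ring).
    replace ((a - 1) * x) with (a * x - x) by ring.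
    replace ((a + 1) * x) with (a * x + x) by ring.
    rewrite cos_minus, cos_plus; ring.
Qed.

Lemma Fejer_eq N x : Fejer N x * (1 - cos x) = 1 - cos (INR (S N) * x).
Proof.
  induction N as [|N IH].
  - simpl; rewrite !Rmult_1_l; ring.
  - cbn [Fejer]. rewrite Rmult_plus_distr_r, IH, Dirichlet_eq; ring.
Qed.

(** Away from cos x = 1 the closed form decides; where cos x = 1 all cosines
    in the sum equal 1. *)
Lemma Fejer_nonneg N x : 0 <= Fejer N x.
Proof.
  destruct (Req_dec (cos x) 1) as [H1 | H1].
  - assert (Hc : forall n, cos (INR n * x) = 1).
    { assert (Hs : sin x = 0).
      { pose proof (sin2_cos2 x) as H; unfold Rsqr in H. rewrite H1 in H. nra. }
      induction n; [now rewrite Rmult_0_l, cos_0|].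
      rewrite S_INR; replace ((INR n + 1) * x) with (INR n * x + x) by ring.
      rewrite cos_plus, IHn, H1, Hs; ring. }
    assert (HD : forall n, 0 <= Dirichlet n x).
    { induction n; cbn [Dirichlet]; [|rewrite Hc]; lra. }
    induction N; cbn [Fejer]; [lra|]. pose proof (HD (S N)); lra.
  - pose proof (COS_bound x). pose proof (COS_bound (INR (S N) * x)).
    pose proof (Fejer_eq N x).
    apply Rmult_le_reg_r with (1 - cos x); lra.
Qed.

Lemma avg_Dirichlet_autocorr f N : cts f -> per f ->
  avg (fun x => Dirichlet N x * autocorr f x) = energy f N.
Proof.
  intros Hf Pf.
  assert (HN : forall n, avg (fun x => autocorr f x * cos (INR n * x)) = ca f (INR n) ^ 2 + sa
    f (INR n) ^ 2).
  { intros n; rewrite INR_IZR_INZ; now apply autocorr_coef. }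
  induction N as [|N IH]; cbn [Dirichlet energy].
  - change 0 with (INR 0); rewrite <- (HN O). apply avg_ext; intros x. simpl;
      rewrite Rmult_0_l, cos_0; ring.
  - rewrite <- IH, <- HN, <- avg_scal, <- avg_plus by cts.
    apply avg_ext; intros; ring.
Qed.

Lemma avg_Dirichlet N : avg (Dirichlet N) = 1.
Proof.
  induction N as [|N IH]; cbn [Dirichlet].
  - apply avg_const.
  - rewrite avg_plus, avg_scal, IH by cts.
    rewrite INR_IZR_INZ, avg_cos by lia. ring.
Qed.

Lemma avg_cos_cos (j k : Z) : j <> k -> j <> (- k)%Z ->
  avg (fun x => cos (IZR j * x) * cos (IZR k * x)) = 0.
Proof.
  intros H1 H2.
  rewrite (avg_ext _ (fun x => / 2 * cos (IZR (j - k) * x) + / 2 * cos (IZR (j + k) * x))).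
  - rewrite avg_plus, !avg_scal by cts. rewrite !avg_cos by lia. ring.
  - intros x. rewrite minus_IZR, plus_IZR.
    rewrite Rmult_minus_distr_r, Rmult_plus_distr_r, cos_minus, cos_plus. field.
Qed.
Lemma avg_cos_sqr (j : Z) : j <> 0%Z ->
  avg (fun x => cos (IZR j * x) * cos (IZR j * x)) = / 2.
Proof.
  intros H.
  rewrite (avg_ext _ (fun x => / 2 + / 2 * cos (IZR (2 * j) * x))).
  - rewrite avg_plus, avg_const, avg_scal, avg_cos by (cts || lia). ring.
  - intros x. rewrite mult_IZR. replace (2 * IZR j * x) with (2 * (IZR j * x)) by ring.
    rewrite cos_2a_cos; field.
Qed.

Lemma avg_cos_Dirichlet (j N : nat) :
  avg (fun x => cos (INR j * x) * Dirichlet N x) = if (j <=? N)%nat then 1 else 0.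
Proof.
  induction N as [|N IH]; cbn [Dirichlet].
  - destruct j; simpl Nat.leb; cbv iota.
    + rewrite (avg_ext _ (fun _ => 1)); [apply avg_const|].
      intros x; simpl; rewrite Rmult_0_l, cos_0; ring.
    + rewrite (avg_ext _ (fun x => cos (IZR (Z.of_nat (S j)) * x))); [apply avg_cos; lia|].
      intros x; rewrite INR_IZR_INZ; ring.
  - rewrite (avg_ext _ (fun x => cos (INR j * x) * Dirichlet N x
        + 2 * (cos (IZR (Z.of_nat j) * x) * cos (IZR (Z.of_nat (S N)) * x)))).
    2: { intros x; rewrite !INR_IZR_INZ; ring. }
    rewrite avg_plus, avg_scal, IH by cts.
    destruct (Nat.eq_dec j (S N)) as [-> | Hj].
    + rewrite avg_cos_sqr by lia.
      rewrite (proj2 (Nat.leb_gt (S N) N)) by lia. rewrite (proj2 (Nat.leb_le _ _))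
        by lia. field.
    + rewrite avg_cos_cos by lia.
      destruct (Nat.leb_spec j N); destruct (Nat.leb_spec j (S N)); try lia; ring.
Qed.

Lemma avg_cos_Fejer (j N : nat) : (j <= S N)%nat ->
  avg (fun x => cos (INR j * x) * Fejer N x) = INR (S N) - INR j.
Proof.
  assert (H0 : forall N, (j <= N)%nat ->
     avg (fun x => cos (INR j * x) * Fejer N x) = INR (S N) - INR j).
  { assert (Hlt : forall N, (N < j)%nat -> avg (fun x => cos (INR j * x) * Fejer N x) = 0).
    { intros L; induction L as [|M IH]; intros H.
      - pose proof (avg_cos_Dirichlet j 0) as HD; cbn [Dirichlet] in HD; cbn [Fejer].
        rewrite (proj2 (Nat.leb_gt _ _) H) in HD. exact HD.
      - rewrite (avg_ext _ (fun x => cos (INR j * x) * Fejer M x + cos (INR j * x) * Dirichlet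
          (S M) x))
          by (intros; cbn [Fejer]; ring).
        rewrite avg_plus, IH, avg_cos_Dirichlet, (proj2 (Nat.leb_gt _ _)) by (cts ||
          lia). ring. }
    intros L; induction L as [|M IH]; intros H.
    - replace j with O by lia. pose proof (avg_cos_Dirichlet 0 0) as HD.
      cbn [Dirichlet] in HD; cbn [Fejer]. transitivity 1; [exact HD|simpl; ring].
    - rewrite (avg_ext _ (fun x => cos (INR j * x) * Fejer M x + cos (INR j * x) * Dirichlet
        (S M) x))
        by (intros; cbn [Fejer]; ring).
      rewrite avg_plus, avg_cos_Dirichlet, (proj2 (Nat.leb_le _ _)) by (cts || lia).
      destruct (Nat.eq_dec j (S M)) as [-> | Hj].
      + rewrite Hlt by lia. rewrite (S_INR (S M)); ring.
      + rewrite IH by lia. rewrite (S_INR (S M)); ring. }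
  intros H. destruct (Nat.eq_dec j (S N)) as [-> | Hj]; [|apply H0; lia].
  specialize (H0 (S N) (Nat.le_refl _)).
  rewrite (avg_ext _ (fun x => cos (INR (S N) * x) * Fejer N x + cos (INR (S N) * x)
    * Dirichlet (S N) x)) in H0
    by (intros; cbn [Fejer]; ring).
  rewrite avg_plus, avg_cos_Dirichlet, (proj2 (Nat.leb_le _ _)) in H0 by (cts || lia).
  rewrite (S_INR (S N)) in H0. lra.
Qed.

(** The sum over M <= N of the defects avg f^2 - [energy f M].  Cesàro summation
    replaces the Dirichlet kernel by the nonnegative Fejér kernel. *)
Fixpoint deficit_sum (f : R -> R) (N : nat) : R :=
  match N with
  | O => avg (fun t => f t ^ 2) - energy f 0
  | S M => deficit_sum f M + (avg (fun t => f t ^ 2) - energy f (S M))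
  end.

Lemma energy_le f M N : (M <= N)%nat -> energy f M <= energy f N.
Proof.
  induction 1 as [|N _ IH]; [lra|]. cbn [energy].
  pose proof (pow2_ge_0 (ca f (INR (S N)))). pose proof (pow2_ge_0 (sa f (INR (S N)))). lra.
Qed.

Lemma deficit_sum_eq f N : cts f -> per f ->
  deficit_sum f N = avg (fun x => Fejer N x * (autocorr f 0 - autocorr f x)).
Proof.
  intros Hf Pf.
  assert (HD : forall M, avg (fun t => f t ^ 2) - energy f M
             = avg (fun x => Dirichlet M x * (autocorr f 0 - autocorr f x))).
  { intros M. rewrite <- avg_Dirichlet_autocorr by auto.
    rewrite (avg_ext (fun x => Dirichlet M x * (autocorr f 0 - autocorr f x))
      (fun x => autocorr f 0 * Dirichlet M x - Dirichlet M x * autocorr f x)) by (intros;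
        ring).
    rewrite avg_minus, avg_scal, avg_Dirichlet by cts.
    rewrite Rmult_1_r. f_equal. apply avg_ext; intros t. rewrite Rplus_0_r; ring. }
  induction N as [|N IH]; cbn [deficit_sum Fejer].
  - rewrite HD; reflexivity.
  - rewrite IH, HD, <- avg_plus by cts. apply avg_ext; intros; ring.
Qed.

Lemma autocorr_le f x : cts f -> per f -> autocorr f x <= autocorr f 0.
Proof.
  intros Hf Pf.
  assert (E : avg (fun t => f (t + x) ^ 2) = avg (fun t => f t ^ 2)).
  { apply (avg_shift (fun t => f t ^ 2)); [cts|]. intros t; now rewrite Pf. }
  assert (H : 0 <= avg (fun t => (f (t + x) - f t) ^ 2)).
  { apply avg_ge_0; [cts|]. intros; apply pow2_ge_0. }
  rewrite (avg_ext _ (fun t => f (t + x) ^ 2 - 2 * (f (t + x) * f t) + f t ^ 2)) in H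
    by (intros; ring).
  rewrite avg_plus, avg_minus, avg_scal, E in H by cts.
  unfold autocorr. rewrite (avg_ext (fun t => f (t + 0) * f t) (fun t => f t ^ 2))
    by (intros; rewrite Rplus_0_r; ring).
  lra.
Qed.

Lemma per_autocorr f : per f -> per (autocorr f).
Proof. intros Pf x; apply avg_ext; intros t. now rewrite <- Rplus_assoc, Pf. Qed.

(** Near 0 and 2 pi continuity gives B <= e; elsewhere 1 - cos x is
    bounded away from 0 and absorbs the maximum of B.  The point of this form is
    that the average of 1 - cos x against the Fejér kernel is 1. *)
Lemma modulus_bound B e : cts B -> per B -> B 0 = 0 -> 0 < e ->
  exists M, 0 <= M /\ forall x, 0 <= x <= 2 * PI -> B x <= e + M * (1 - cos x).
Proof.
  intros HB PB H0 He.
  destruct (cts_pos_near (fun x => e - B x) 0 ltac:(cts)) as [d [Hd Hd']]; [lra|].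
  destruct (cts_pos_near (fun x => e - B x) (2 * PI) ltac:(cts)) as [d2 [Hd2 Hd2']].
  { rewrite <- (Rplus_0_l (2 * PI)), PB; lra. }
  set (r := Rmin (Rmin d d2) PI).
  assert (Hr : 0 < r) by (unfold r; pose proof PI_RGT_0; repeat apply Rmin_glb_lt; lra).
  assert (r <= d) by (unfold r; eapply Rle_trans; [apply Rmin_l|apply Rmin_l]).
  assert (r <= d2) by (unfold r; eapply Rle_trans; [apply Rmin_l|apply Rmin_r]).
  assert (r <= PI) by apply Rmin_r.
  destruct (continuity_ab_maj B 0 (2 * PI)) as [m [Hm _]].
  { pose proof PI_RGT_0; lra. }
  { intros c _; apply continuity_pt_filterlim, HB. }
  set (q := 1 - cos r).
  assert (Hq : 0 < q).
  { unfold q. assert (cos r < cos 0); [|rewrite cos_0 in *; lra].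
    apply cos_decreasing_1; lra. }
  exists (Rabs (B m) / q); split.
  { apply Rdiv_le_0_compat; [apply Rabs_pos|exact Hq]. }
  intros x Hx.
  assert (HM0 : 0 <= Rabs (B m) / q) by (apply Rdiv_le_0_compat; [apply Rabs_pos|exact Hq]).
  pose proof (COS_bound x).
  destruct (Rlt_dec x r) as [Hxr | Hxr].
  - specialize (Hd' x ltac:(apply Rabs_def1; lra)). nra.
  - destruct (Rlt_dec (2 * PI - r) x) as [Hxr2 | Hxr2].
    + specialize (Hd2' x ltac:(apply Rabs_def1; lra)). nra.
    + apply Rnot_lt_le in Hxr. apply Rnot_lt_le in Hxr2.
      assert (Hc : cos x <= cos r).
      { destruct (Rle_dec x PI).
        - apply cos_decr_1; lra.
        - replace (cos x) with (cos (2 * PI - x)).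
          + apply cos_decr_1; lra.
          + rewrite cos_minus, cos_2PI, sin_2PI; ring. }
      specialize (Hm x Hx). pose proof (Rle_abs (B m)).
      assert (Rabs (B m) / q * q <= Rabs (B m) / q * (1 - cos x)).
      { apply Rmult_le_compat_l; [exact HM0|unfold q; lra]. }
      replace (Rabs (B m) / q * q) with (Rabs (B m)) in * by (field; lra). lra.
Qed.

Lemma avg_Fejer N : avg (Fejer N) = INR (S N).
Proof.
  rewrite (avg_ext _ (fun x => cos (INR 0 * x) * Fejer N x)).
  - rewrite avg_cos_Fejer by lia. simpl INR at 2; ring.
  - intros x; simpl INR; rewrite Rmult_0_l, cos_0; ring.
Qed.
Lemma avg_Fejer_cos N : avg (fun x => Fejer N x * (1 - cos x)) = 1.
Proof.
  rewrite (avg_ext _ (fun x => 1 - cos (IZR (Z.of_nat (S N)) * x))).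
  - rewrite avg_minus, avg_const, avg_cos by (cts || lia). ring.
  - intros x; rewrite Fejer_eq, INR_IZR_INZ; reflexivity.
Qed.

Lemma deficit_sum_bounds f e : cts f -> per f -> 0 < e ->
  exists M, 0 <= M /\ forall N, 0 <= deficit_sum f N <= INR (S N) * e + M.
Proof.
  intros Hf Pf He.
  destruct (modulus_bound (fun x => autocorr f 0 - autocorr f x) e) as [M [HM HB]]; auto.
  { cts. }
  { intros x; now rewrite (per_autocorr f Pf x). }
  { ring. }
  exists M; split; [exact HM|]. intros N; rewrite deficit_sum_eq by auto; split.
  - apply avg_ge_0; [cts|]. intros x _. apply Rmult_le_pos; [apply Fejer_nonneg|].
    pose proof (autocorr_le f x Hf Pf); lra.
  - apply Rle_trans with (avg (fun x => e * Fejer N x + M * (Fejer N x * (1 - cos x)))).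
    + apply avg_le; [cts|cts|]. intros x Hx.
      pose proof (Fejer_nonneg N x). specialize (HB x ltac:(lra)). nra.
    + rewrite avg_plus, !avg_scal, avg_Fejer, avg_Fejer_cos by cts. lra.
Qed.

(** The defects decrease.  If one of them were negative, their sums would tend
    to minus infinity, whereas a nonnegative kernel makes them nonnegative. *)
Lemma energy_le_avg f N : cts f -> per f -> energy f N <= avg (fun t => f t ^ 2).
Proof.
  intros Hf Pf. apply Rnot_lt_le; intros H.
  set (d := energy f N - avg (fun t => f t ^ 2)). assert (Hd : 0 < d) by (unfold d; lra).
  assert (HL : forall L, deficit_sum f (N + L) <= deficit_sum f N - INR L * d).
  { induction L as [|L IH].
    - rewrite Nat.add_0_r; simpl; lra.
    - rewrite Nat.add_succ_r, S_INR; cbn [deficit_sum].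
      pose proof (energy_le f N (S (N + L)) ltac:(lia)). unfold d in *; lra. }
  destruct (deficit_sum_bounds f 1 Hf Pf ltac:(lra)) as [M [_ HM]].
  destruct (INR_unbounded (deficit_sum f N / d)) as [L HLd].
  pose proof (HL L). pose proof (HM (N + L)%nat).
  assert (deficit_sum f N < INR L * d); [|lra].
  apply Rlt_div_l in HLd; lra.
Qed.

(** The defects decrease, so N + 1 times the last one is at most their sum,
    which [deficit_sum_bounds] makes o(N). *)
Lemma parseval_real f : cts f -> per f ->
  is_lim_seq (energy f) (avg (fun t => f t ^ 2)).
Proof.
  intros Hf Pf. apply is_lim_seq_spec; intros e.
  destruct (deficit_sum_bounds f (e / 2) Hf Pf) as [M [HM HB]].
  { pose proof (cond_pos e); lra. }
  destruct (INR_unbounded (2 * M / e)) as [N0 HN0].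
  exists N0; intros N HN.
  pose proof (energy_le_avg f N Hf Pf). rewrite Rabs_left1 by lra.
  assert (HS : INR (S N) * (avg (fun t => f t ^ 2) - energy f N) <= deficit_sum f N).
  { assert (HK : forall k, (k <= N)%nat ->
       INR (S k) * (avg (fun t => f t ^ 2) - energy f N) <= deficit_sum f k).
    { induction k as [|k IH]; intros Hk.
      - cbn [deficit_sum]. pose proof (energy_le f 0 N ltac:(lia)). simpl INR; lra.
      - cbn [deficit_sum]. pose proof (energy_le f (S k) N ltac:(lia)).
        specialize (IH ltac:(lia)). rewrite (S_INR (S k)); lra. }
    apply HK; lia. }
  specialize (HB N). pose proof (cond_pos e) as He.
  assert (HNN : INR N0 <= INR N) by (apply le_INR; lia).
  apply Rlt_div_l in HN0; [|exact He].
  rewrite S_INR in *. pose proof (pos_INR N).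
  apply Rmult_lt_reg_l with (INR N + 1); [lra|]. nra.
Qed.

(** * Complex Fourier coefficients *)

Definition dot (z w : C) : R := Re z * Re w + Im z * Im w.

Fixpoint zsum (a : Z -> R) (N : nat) : R :=
  match N with
  | O => a 0%Z
  | S M => zsum a M + (a (Z.of_nat (S M)) + a (- Z.of_nat (S M))%Z)
  end.

Lemma zsum_ext a b N : (forall n, (Z.abs n <= Z.of_nat N)%Z -> a n = b n) -> zsum a N = zsum b
  N.
Proof.
  induction N as [|N IH]; intros H; cbn [zsum]; [apply H; lia|].
  rewrite IH, !H by (intros; try apply H; lia). reflexivity.
Qed.
Lemma zsum_plus a b N : zsum (fun n => a n + b n) N = zsum a N + zsum b N.
Proof. induction N as [|N IH]; cbn [zsum]; rewrite ?IH; ring. Qed.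
Lemma zsum_minus a b N : zsum (fun n => a n - b n) N = zsum a N - zsum b N.
Proof. induction N as [|N IH]; cbn [zsum]; rewrite ?IH; ring. Qed.
Lemma zsum_scal c a N : zsum (fun n => c * a n) N = c * zsum a N.
Proof. induction N as [|N IH]; cbn [zsum]; rewrite ?IH; ring. Qed.
Lemma zsum_mono a M N : (forall n, 0 <= a n) -> (M <= N)%nat -> zsum a M <= zsum a N.
Proof.
  intros H; induction 1 as [|N _ IH]; [lra|]; cbn [zsum].
  pose proof (H (Z.of_nat (S N))); pose proof (H (- Z.of_nat (S N))%Z); lra.
Qed.
Lemma zsum_term a n : (forall m, 0 <= a m) -> a n <= zsum a (Z.abs_nat n).
Proof.
  intros H. assert (H0 : forall N, 0 <= zsum a N).
  { induction N as [|N IH]; cbn [zsum]; [apply H|].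
    pose proof (H (Z.of_nat (S N))); pose proof (H (- Z.of_nat (S N))%Z); lra. }
  destruct n as [|p|p]; [simpl; lra|..];
    replace (Z.abs_nat _) with (S (pred (Pos.to_nat p))) by (simpl; lia);
    cbn [zsum]; specialize (H0 (pred (Pos.to_nat p)));
    pose proof (H (Z.of_nat (S (pred (Pos.to_nat p)))));
    pose proof (H (- Z.of_nat (S (pred (Pos.to_nat p))))%Z).
  - replace (Z.pos p) with (Z.of_nat (S (pred (Pos.to_nat p)))) by lia. lra.
  - replace (Z.neg p) with (- Z.of_nat (S (pred (Pos.to_nat p))))%Z by lia. lra.
Qed.

Definition ccts (f : R -> C) : Prop := cts (fun t => Re (f t)) /\ cts (fun t => Im (f t)).
Definition cper (f : R -> C) : Prop := forall t, f (t + 2 * PI) = f t.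

(** The average of f(t) e^(-int), with its real and imaginary parts written
    out. *)
Definition coef (f : R -> C) (n : Z) : C :=
  (ca (fun t => Re (f t)) (IZR n) + sa (fun t => Im (f t)) (IZR n),
   ca (fun t => Im (f t)) (IZR n) - sa (fun t => Re (f t)) (IZR n)).

Lemma ca_plus f g n : cts f -> cts g -> ca (fun t => f t + g t) n = ca f n + ca g n.
Proof.
  intros; unfold ca; rewrite <- avg_plus by cts; apply avg_ext; intros; ring.
Qed.
Lemma sa_plus f g n : cts f -> cts g -> sa (fun t => f t + g t) n = sa f n + sa g n.
Proof.
  intros; unfold sa; rewrite <- avg_plus by cts; apply avg_ext; intros; ring.
Qed.
Lemma ca_minus f g n : cts f -> cts g -> ca (fun t => f t - g t) n = ca f n - ca g n.
Proof.
  intros; unfold ca; rewrite <- avg_minus by cts; apply avg_ext; intros; ring.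
Qed.
Lemma sa_minus f g n : cts f -> cts g -> sa (fun t => f t - g t) n = sa f n - sa g n.
Proof.
  intros; unfold sa; rewrite <- avg_minus by cts; apply avg_ext; intros; ring.
Qed.
Lemma ca_opp f n : cts f -> ca (fun t => - f t) n = - ca f n.
Proof.
  intros; unfold ca; transitivity ((-1) * avg (fun t => f t * cos (n * t))); [|ring].
  rewrite <- avg_scal by cts; apply avg_ext; intros; ring.
Qed.
Lemma sa_opp f n : cts f -> sa (fun t => - f t) n = - sa f n.
Proof.
  intros; unfold sa; transitivity ((-1) * avg (fun t => f t * sin (n * t))); [|ring].
  rewrite <- avg_scal by cts; apply avg_ext; intros; ring.
Qed.
Lemma ca_even f n : ca f (- n) = ca f n.
Proof.
  apply avg_ext; intros t. replace (- n * t) with (- (n * t)) by ring. now rewrite cos_neg.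
Qed.
Lemma sa_odd f n : cts f -> sa f (- n) = - sa f n.
Proof.
  intros; unfold sa; transitivity ((-1) * avg (fun t => f t * sin (n * t))); [|ring].
  rewrite <- avg_scal by cts; apply avg_ext; intros t.
  replace (- n * t) with (- (n * t)) by ring. rewrite sin_neg; ring.
Qed.

Lemma zsum_coef_energy f N : ccts f ->
  zsum (fun n => dot (coef f n) (coef f n)) N
  = energy (fun t => Re (f t)) N + energy (fun t => Im (f t)) N.
Proof.
  intros [Hr Hi]; induction N as [|N IH]; cbn [zsum energy].
  - assert (H0 : forall g, sa g 0 = 0).
    { intros g; unfold sa; transitivity (avg (fun _ => 0)); [|apply avg_const].
      apply avg_ext; intros t.
      rewrite Rmult_0_l, sin_0; ring. }
    unfold dot, coef; cbn [Re Im fst snd]. rewrite !H0; ring.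
  - rewrite IH. unfold dot, coef; cbn [Re Im fst snd].
    rewrite opp_IZR, !ca_even, !sa_odd, <- INR_IZR_INZ by assumption. ring.
Qed.

Lemma bessel f N : ccts f -> cper f ->
  zsum (fun n => dot (coef f n) (coef f n)) N <= avg (fun t => dot (f t) (f t)).
Proof.
  intros Hf Pf; rewrite zsum_coef_energy by auto. destruct Hf as [Hr Hi].
  rewrite (avg_ext _ (fun t => Re (f t) ^ 2 + Im (f t) ^ 2)) by (intros; unfold dot; ring).
  rewrite avg_plus by cts.
  apply Rplus_le_compat; apply energy_le_avg; auto; intros t; now rewrite Pf.
Qed.

Lemma parseval_sq f : ccts f -> cper f ->
  is_lim_seq (zsum (fun n => dot (coef f n) (coef f n))) (avg (fun t => dot (f t) (f t))).
Proof.
  intros Hf Pf.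
  apply (is_lim_seq_ext (fun N => energy (fun t => Re (f t)) N + energy (fun t => Im (f t))
    N)).
  { intros N; symmetry; now apply zsum_coef_energy. }
  destruct Hf as [Hr Hi].
  rewrite (avg_ext _ (fun t => Re (f t) ^ 2 + Im (f t) ^ 2)) by (intros; unfold dot; ring).
  rewrite avg_plus by cts.
  apply is_lim_seq_plus'; apply parseval_real; auto; intros t; now rewrite Pf.
Qed.

Lemma coef_plus f g n : ccts f -> ccts g ->
  coef (fun t => f t + g t)%C n = (coef f n + coef g n)%C.
Proof.
  intros [Hf1 Hf2] [Hg1 Hg2]; unfold coef, Cplus; cbn [fst snd Re Im].
  rewrite (ca_plus (fun t => fst (f t)) (fun t => fst (g t))),
    (ca_plus (fun t => snd (f t)) (fun t => snd (g t))),
    (sa_plus (fun t => fst (f t)) (fun t => fst (g t))),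
    (sa_plus (fun t => snd (f t)) (fun t => snd (g t))) by assumption.
  f_equal; unfold Re, Im; ring.
Qed.
Lemma coef_minus f g n : ccts f -> ccts g ->
  coef (fun t => f t - g t)%C n = (coef f n - coef g n)%C.
Proof.
  intros [Hf1 Hf2] [Hg1 Hg2]; unfold coef, Cminus, Cplus, Copp; cbn [fst snd Re Im].
  rewrite (ca_minus (fun t => fst (f t)) (fun t => fst (g t))),
    (ca_minus (fun t => snd (f t)) (fun t => snd (g t))),
    (sa_minus (fun t => fst (f t)) (fun t => fst (g t))),
    (sa_minus (fun t => snd (f t)) (fun t => snd (g t))) by assumption.
  f_equal; unfold Re, Im; ring.
Qed.

Lemma ccts_plus f g : ccts f -> ccts g -> ccts (fun t => f t + g t)%C.
Proof. intros [? ?] [? ?]; split; simpl; [apply (cts_plus _ _ H H1)|apply (cts_plus _ _ H0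
  H2)]. Qed.
Lemma ccts_minus f g : ccts f -> ccts g -> ccts (fun t => f t - g t)%C.
Proof. intros [? ?] [? ?]; split; simpl; [apply (cts_minus _ _ H H1)|apply (cts_minus _ _ H0
  H2)]. Qed.

Lemma cts_dot f g : ccts f -> ccts g -> cts (fun t => dot (f t) (g t)).
Proof. intros [? ?] [? ?]; unfold dot; cts. Qed.
#[export] Hint Resolve ccts_plus ccts_minus cts_dot : cts.

(** By polarisation from [parseval_sq]. *)
Lemma parseval f g : ccts f -> ccts g -> cper f -> cper g ->
  is_lim_seq (zsum (fun n => dot (coef f n) (coef g n))) (avg (fun t => dot (f t) (g t))).
Proof.
  intros Hf Hg Pf Pg.
  pose proof (parseval_sq (fun t => f t + g t)%C ltac:(cts) ltac:(intros t; now rewrite Pf,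
    Pg)) as H1.
  pose proof (parseval_sq (fun t => f t - g t)%C ltac:(cts) ltac:(intros t; now rewrite Pf,
    Pg)) as H2.
  pose proof (is_lim_seq_scal_l _ (/ 4) _ (is_lim_seq_minus' _ _ _ _ H1 H2)) as H.
  cbn [Rbar_mult] in H.
  replace (avg (fun t => dot (f t) (g t))) with
    (/ 4 * (avg (fun t => dot (f t + g t)%C (f t + g t)%C) - avg (fun t => dot (f t - g t)%C
      (f t - g t)%C))).
  - revert H; apply is_lim_seq_ext; intros N.
    rewrite <- zsum_minus, <- zsum_scal. apply zsum_ext; intros n _.
    rewrite coef_plus, coef_minus by assumption.
    unfold dot, Cminus, Cplus, Copp; simpl; unfold Re, Im; field.
  - rewrite <- avg_minus, <- avg_scal by cts. apply avg_ext; intros t.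
    unfold dot, Cminus, Cplus, Copp; simpl; unfold Re, Im; field.
Qed.

Lemma ccts_Ci f : ccts f -> ccts (fun t => Ci * f t)%C.
Proof.
  intros [H1 H2]; split.
  - apply (cts_ext (fun t => - Im (f t))); [|cts]. intros t; simpl; unfold Im; ring.
  - apply (cts_ext (fun t => Re (f t))); [|cts]. intros t; simpl; unfold Re; ring.
Qed.
#[export] Hint Resolve ccts_Ci : cts.

Lemma coef_Ci f n : ccts f -> coef (fun t => Ci * f t)%C n = (Ci * coef f n)%C.
Proof.
  intros [H1 H2].
  assert (E1 : forall t, Re (Ci * f t)%C = - Im (f t)) by (intros; simpl; unfold Im; ring).
  assert (E2 : forall t, Im (Ci * f t)%C = Re (f t)) by (intros; simpl; unfold Re; ring).
  transitivity
    (ca (fun t => - Im (f t)) (IZR n) + sa (fun t => Re (f t)) (IZR n),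
     ca (fun t => Re (f t)) (IZR n) - sa (fun t => - Im (f t)) (IZR n)).
  - unfold coef; f_equal; f_equal; apply avg_ext; intros t; now rewrite ?E1, ?E2.
  - rewrite (ca_opp (fun t => Im (f t))), (sa_opp (fun t => Im (f t))) by assumption.
    unfold coef, Cmult; cbn [Ci fst snd]. f_equal; ring.
Qed.

Lemma ca_derive f df (n : Z) : (forall t, is_derive f t (df t)) -> cts df -> per f ->
  ca df (IZR n) = IZR n * sa f (IZR n).
Proof.
  intros Hd Hc Hp; unfold ca, sa.
  pose proof (cts_derive _ _ Hd).
  rewrite (avg_by_parts f df (fun t => cos (IZR n * t)) (fun t => - IZR n * sin (IZR n * t)));
    auto using is_derive_cos_lin, per_cos; [|cts].
  rewrite <- avg_scal by cts.
  rewrite (avg_ext _ (fun t => (-1) * (IZR n * (f t * sin (IZR n * t))))) by (intros; ring).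
  rewrite avg_scal by cts. ring.
Qed.
Lemma sa_derive f df (n : Z) : (forall t, is_derive f t (df t)) -> cts df -> per f ->
  sa df (IZR n) = - (IZR n * ca f (IZR n)).
Proof.
  intros Hd Hc Hp; unfold ca, sa.
  pose proof (cts_derive _ _ Hd).
  rewrite (avg_by_parts f df (fun t => sin (IZR n * t)) (fun t => IZR n * cos (IZR n * t)));
    auto using is_derive_sin_lin, per_sin; [|cts].
  rewrite <- avg_scal by cts. f_equal. apply avg_ext; intros; ring.
Qed.

Lemma coef_derive f df n : ccts df -> cper f ->
  (forall t, is_derive (fun t => Re (f t)) t (Re (df t))) ->
  (forall t, is_derive (fun t => Im (f t)) t (Im (df t))) ->
  coef df n = (IZR n * (Ci * coef f n))%C.
Proof.
  intros [H1 H2] Pf D1 D2. unfold coef, Cmult, RtoC, Ci; cbn [fst snd].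
  assert (Pr : per (fun t => Re (f t))) by (intros t; now rewrite Pf).
  assert (Pi : per (fun t => Im (f t))) by (intros t; now rewrite Pf).
  assert (E1 : ca (fun t => Re (df t)) (IZR n) = IZR n * sa (fun t => Re (f t)) (IZR n))
    by now apply ca_derive.
  assert (E2 : ca (fun t => Im (df t)) (IZR n) = IZR n * sa (fun t => Im (f t)) (IZR n))
    by now apply ca_derive.
  assert (E3 : sa (fun t => Re (df t)) (IZR n) = - (IZR n * ca (fun t => Re (f t)) (IZR n)))
    by now apply sa_derive.
  assert (E4 : sa (fun t => Im (df t)) (IZR n) = - (IZR n * ca (fun t => Im (f t)) (IZR n)))
    by now apply sa_derive.
  rewrite E1, E2, E3, E4. f_equal; ring.
Qed.

Lemma coef_shift f x n : ccts f -> cper f ->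
  coef (fun t => f (t + x)) n = (cis (IZR n * x) * coef f n)%C.
Proof.
  intros [H1 H2] Pf.
  assert (HC : forall g, cts g -> per g ->
    ca (fun t => g (t + x)) (IZR n) = cos (IZR n * x) * ca g (IZR n) + sin (IZR n * x) * sa g
      (IZR n)
    /\ sa (fun t => g (t + x)) (IZR n) = cos (IZR n * x) * sa g (IZR n) - sin (IZR n * x) * ca
      g (IZR n)).
  { intros g Hg Pg; unfold ca, sa; split.
    - rewrite <- (avg_shift (fun t => g (t + x) * cos (IZR n * t)) (- x)).
      + rewrite <- !avg_scal, <- avg_plus by cts. apply avg_ext; intros t.
        replace (t + - x + x) with t by ring.
        replace (IZR n * (t + - x)) with (IZR n * t - IZR n * x) by ring.
        rewrite cos_minus; ring.
      + cts.
      + intros t. rewrite (per_cos n t). f_equal.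
        replace (t + 2 * PI + x) with (t + x + 2 * PI) by ring. apply Pg.
    - rewrite <- (avg_shift (fun t => g (t + x) * sin (IZR n * t)) (- x)).
      + rewrite <- !avg_scal, <- avg_minus by cts. apply avg_ext; intros t.
        replace (t + - x + x) with t by ring.
        replace (IZR n * (t + - x)) with (IZR n * t - IZR n * x) by ring.
        rewrite sin_minus; ring.
      + cts.
      + intros t. rewrite (per_sin n t). f_equal.
        replace (t + 2 * PI + x) with (t + x + 2 * PI) by ring. apply Pg. }
  destruct (HC (fun t => Re (f t)) H1 ltac:(intros t; now rewrite Pf)) as [E1 E2].
  destruct (HC (fun t => Im (f t)) H2 ltac:(intros t; now rewrite Pf)) as [E3 E4].
  unfold coef. rewrite E1, E2, E3, E4. unfold cis, Cmult; cbn [fst snd]. f_equal; ring.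
Qed.

Lemma avg_dot_cis f c : ccts f ->
  avg (fun t => dot (f t) (c * cis t)%C) = dot (coef f 1) c.
Proof.
  intros [H1 H2].
  rewrite (avg_ext _ (fun t => Re c * (Re (f t) * cos (1 * t)) + Re c * (Im (f t) * sin (1
    * t))
    + (Im c * (Im (f t) * cos (1 * t)) - Im c * (Re (f t) * sin (1 * t))))).
  - rewrite !avg_plus, avg_minus, !avg_scal by cts. unfold dot, coef;
      cbn [Re Im fst snd]. unfold ca, sa; ring.
  - intros t. rewrite Rmult_1_l. unfold dot, cis; destruct c; simpl; ring.
Qed.

(** * The moment inequality for degree-one circle maps *)

(** The cosine polynomial equal to sin (n x) cot (x / 2).  It lets an
    inequality between sine sums be divided by sin x and still be integrated
    termwise. *)
Fixpoint half_conj (n : nat) (x : R) : R :=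
  match n with
  | O => 0
  | S m => half_conj m x + (cos (INR m * x) + cos (INR (S m) * x))
  end.

Lemma half_conj_eq n x : sin (INR n * x) * (1 + cos x) = sin x * half_conj n x.
Proof.
  induction n as [|n IH].
  - simpl; rewrite Rmult_0_l, sin_0; ring.
  - cbn [half_conj]. rewrite (Rmult_plus_distr_l (sin x)), <- IH, S_INR.
    replace ((INR n + 1) * x) with (INR n * x + x) by ring.
    rewrite sin_plus, cos_plus.
    pose proof (sin2_cos2 x) as H; unfold Rsqr in H.
    replace (sin x * (cos (INR n * x) + (cos (INR n * x) * cos x - sin (INR n * x) * sin x)))
      with (sin x * cos (INR n * x) * (1 + cos x) - sin (INR n * x) * (sin x * sin x)) by ring.
    replace (sin x * sin x) with (1 - cos x * cos x) by lra. ring.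
Qed.

Lemma cts_half_conj n : cts (half_conj n).
Proof. induction n; cbn [half_conj]; cts. Qed.
#[export] Hint Resolve cts_half_conj : cts.

(** The quadratic term in n on the right is the reason for this kernel: with
    N of the size of the largest frequency, integrating the sine inequality
    produces the moment n |n|. *)
Lemma avg_half_conj_Fejer n N : (n <= S N)%nat ->
  avg (fun x => half_conj n x * Fejer N x) = INR n * (2 * INR (S N) - INR n).
Proof.
  induction n as [|n IH]; intros H.
  - rewrite (avg_ext _ (fun _ => 0)) by (intros; simpl; ring). rewrite avg_const; simpl; ring.
  - rewrite (avg_ext _ (fun x => half_conj n x * Fejer N x
      + (cos (INR n * x) * Fejer N x + cos (INR (S n) * x) * Fejer N x)))
      by (intros; cbn [half_conj]; ring).
    rewrite !avg_plus, IH, !avg_cos_Fejer by (cts || lia).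
    rewrite (S_INR n); ring.
Qed.

Lemma half_conj_pi n : half_conj n PI = 0.
Proof.
  induction n as [|n IH]; cbn [half_conj]; [reflexivity|].
  rewrite IH, S_INR, Rmult_plus_distr_r, Rmult_1_l, cos_plus, cos_PI, sin_PI; ring.
Qed.

Lemma half_conj_reflect n x : half_conj n (2 * PI - x) = half_conj n x.
Proof.
  assert (H : forall k, cos (INR k * (2 * PI - x)) = cos (INR k * x)).
  { intros k; rewrite Rmult_minus_distr_l, cos_minus.
    rewrite (INR_IZR_INZ k). destruct (cos_sin_2PI_Z (Z.of_nat k)) as [-> ->]; ring. }
  induction n as [|n IH]; cbn [half_conj]; [reflexivity|].
  now rewrite IH, !H.
Qed.

Definition half_conjZ (n : Z) (x : R) := IZR (Z.sgn n) * half_conj (Z.abs_nat n) x.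

Lemma IZR_sgn_abs n : IZR n = IZR (Z.sgn n) * INR (Z.abs_nat n).
Proof. rewrite INR_IZR_INZ, <- mult_IZR; f_equal; lia. Qed.

Lemma half_conjZ_eq n x : sin (IZR n * x) * (1 + cos x) = sin x * half_conjZ n x.
Proof.
  unfold half_conjZ.
  transitivity (IZR (Z.sgn n) * (sin (INR (Z.abs_nat n) * x) * (1 + cos x))).
  2: { rewrite half_conj_eq; ring. }
  rewrite (IZR_sgn_abs n) at 1.
  destruct n; simpl Z.sgn.
  - rewrite !Rmult_0_l, sin_0; ring.
  - rewrite !Rmult_1_l; reflexivity.
  - replace (-1 * INR (Z.abs_nat (Z.neg p)) * x) with (- (INR (Z.abs_nat (Z.neg p)) * x))
      by ring.
    rewrite sin_neg; ring.
Qed.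

Lemma cts_zsum (F : Z -> R -> R) N : (forall n, cts (F n)) -> cts (fun x => zsum (fun n => F n
  x) N).
Proof. intros H; induction N as [|N IH]; cbn [zsum]; auto with cts. Qed.
Lemma avg_zsum (F : Z -> R -> R) N : (forall n, cts (F n)) ->
  avg (fun x => zsum (fun n => F n x) N) = zsum (fun n => avg (F n)) N.
Proof.
  intros H; induction N as [|N IH]; cbn [zsum].
  - apply avg_ext; reflexivity.
  - pose proof (cts_zsum F N H). rewrite !avg_plus, IH by auto with cts. reflexivity.
Qed.

(** Multiply the hypothesis (1 + T/N) sin x >= sum a_n sin (n x) by
    cot (x / 2) times the Fejér kernel, which is nonnegative on [0, pi], and
    average.  The left-hand side gives (1 + T/N) (2 N - 1), the right-hand side
    2 N sum n a_n - sum n |n| a_n, and the leading terms 2 N cancel up to the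
    errors T. *)
Lemma abs_moment_finite (a : Z -> R) (T : R) (N : nat) : (1 <= N)%nat -> 0 <= T ->
  (forall x, 0 <= x <= PI -> zsum (fun n => a n * sin (IZR n * x)) N <= (1 + T / INR N) * sin
    x) ->
  1 - T / INR N <= zsum (fun n => IZR n * a n) N ->
  1 - 4 * T <= zsum (fun n => IZR n * Rabs (IZR n) * a n) N.
Proof.
  intros HN HT0 Hs H1.
  set (c := 1 + T / INR N).
  assert (HC : forall n, cts (fun x => a n * half_conjZ n x)) by (intros n; unfold half_conjZ;
    cts).
  pose proof (cts_zsum _ N HC) as HCz. cbv beta in HCz.
  set (E := fun x => c * half_conj 1 x - zsum (fun n => a n * half_conjZ n x) N).
  assert (CE : cts E) by (unfold E; auto with cts).
  (* On (0, pi) multiply E by sin x; (pi, 2 pi) follows by reflection. *)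
  assert (HE1 : forall x, 0 < x < PI -> 0 <= E x).
  { intros x Hx. assert (Hsx : 0 < sin x) by (apply sin_gt_0; lra).
    apply Rmult_le_reg_l with (sin x); [exact Hsx|].
    rewrite Rmult_0_r. unfold E. rewrite Rmult_minus_distr_l.
    replace (sin x * (c * half_conj 1 x)) with (c * sin x * (1 + cos x)).
    2: { replace (sin x * (c * half_conj 1 x)) with (c * (sin x * half_conj 1 x)) by ring.
         rewrite <- half_conj_eq. simpl INR; rewrite Rmult_1_l; ring. }
    replace (sin x * zsum (fun n => a n * half_conjZ n x) N) with
      ((1 + cos x) * zsum (fun n => a n * sin (IZR n * x)) N).
    2: { rewrite <- !zsum_scal. apply zsum_ext; intros n _.
         replace (sin x * (a n * half_conjZ n x)) with (a n * (sin x * half_conjZ n x))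
           by ring.
         rewrite <- half_conjZ_eq; ring. }
    specialize (Hs x ltac:(lra)). fold c in Hs. pose proof (COS_bound x).
    replace (c * sin x * (1 + cos x) - (1 + cos x) * zsum (fun n => a n * sin (IZR n * x)) N)
      with ((1 + cos x) * (c * sin x - zsum (fun n => a n * sin (IZR n * x)) N)) by ring.
    apply Rmult_le_pos; lra. }
  assert (HE : forall x, 0 < x < 2 * PI -> 0 <= E x).
  { intros x Hx. destruct (total_order_T x PI) as [[H|H]|H].
    - apply HE1; lra.
    - subst x; unfold E. rewrite half_conj_pi.
      rewrite (zsum_ext _ (fun n => 0 * a n)).
      + rewrite zsum_scal; lra.
      + intros n _; unfold half_conjZ; rewrite half_conj_pi; ring.
    - replace (E x) with (E (2 * PI - x)); [apply HE1; lra|].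
      unfold E; rewrite half_conj_reflect. f_equal. apply zsum_ext; intros n _.
      unfold half_conjZ; now rewrite half_conj_reflect. }
  destruct N as [|M]; [lia|].
  assert (HA : 0 <= avg (fun x => E x * Fejer M x)).
  { apply avg_ge_0; [auto with cts|]. intros x Hx. apply Rmult_le_pos;
      [now apply HE|apply Fejer_nonneg]. }
  rewrite (avg_ext _ (fun x => c * (half_conj 1 x * Fejer M x)
     - zsum (fun n => a n * IZR (Z.sgn n) * (half_conj (Z.abs_nat n) x * Fejer M x)) (S M)))
         in HA.
  2: { intros x; unfold E. rewrite Rmult_minus_distr_r. f_equal; [ring|].
       rewrite (Rmult_comm (zsum _ _)), <- zsum_scal. apply zsum_ext; intros n _.
       unfold half_conjZ; ring. }
  rewrite avg_minus in HA; [|cts|apply cts_zsum; intros; cts].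
  rewrite avg_scal, avg_zsum in HA by (intros; cts).
  rewrite avg_half_conj_Fejer in HA by lia.
  rewrite (zsum_ext _ (fun n => 2 * INR (S M) * (IZR n * a n) - IZR n * Rabs (IZR n) * a n))
    in HA.
  2: { intros n Hn. rewrite avg_scal, avg_half_conj_Fejer by (cts || lia).
       replace (Rabs (IZR n)) with (INR (Z.abs_nat n))
         by (rewrite INR_IZR_INZ, <- abs_IZR; f_equal; lia).
       rewrite (IZR_sgn_abs n). ring. }
  rewrite zsum_minus, zsum_scal in HA.
  assert (HM : 0 < INR (S M)) by (apply lt_0_INR; lia).
  assert (HcM : c * INR (S M) = INR (S M) + T) by (unfold c; field; lra).
  assert (H1M : INR (S M) - T <= INR (S M) * zsum (fun n => IZR n * a n) (S M)).
  { replace (INR (S M) - T) with (INR (S M) * (1 - T / INR (S M))) by (field; lra).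
    apply Rmult_le_compat_l; lra. }
  simpl (INR 1) in HA.
  assert (Hc : c * (1 * (2 * INR (S M) - 1)) = 2 * (INR (S M) + T) - c) by (rewrite <- HcM;
    ring).
  rewrite Hc in HA.
  assert (1 <= c).
  { unfold c; assert (0 <= T / INR (S M)) by (apply Rdiv_le_0_compat; lra). lra. }
  lra.
Qed.

Lemma sin_nat_le (n : nat) x : 0 <= sin x -> Rabs (sin (INR n * x)) <= INR n * sin x.
Proof.
  intros Hx; induction n as [|n IH].
  - simpl; rewrite Rmult_0_l, sin_0, Rabs_R0; lra.
  - rewrite S_INR, Rmult_plus_distr_r, Rmult_1_l, sin_plus.
    eapply Rle_trans; [apply Rabs_triang|]. rewrite !Rabs_mult, (Rabs_pos_eq (sin x)) by lra.
    assert (Hc : forall y, Rabs (cos y) <= 1) by (intros y; apply Rabs_le, COS_bound).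
    pose proof (Hc x). pose proof (Hc (INR n * x)). pose proof (Rabs_pos (sin (INR n * x))).
      nra.
Qed.

Lemma sin_Z_le (n : Z) x : 0 <= sin x -> Rabs (sin (IZR n * x)) <= Rabs (IZR n) * sin x.
Proof.
  intros Hx. replace (Rabs (IZR n)) with (INR (Z.abs_nat n))
    by (rewrite INR_IZR_INZ, <- abs_IZR; f_equal; lia).
  replace (Rabs (sin (IZR n * x))) with (Rabs (sin (INR (Z.abs_nat n) * x))).
  - now apply sin_nat_le.
  - destruct (Z.le_gt_cases 0 n).
    + do 3 f_equal. rewrite INR_IZR_INZ; f_equal; lia.
    + rewrite <- (Rabs_Ropp (sin (IZR n * x))), <- sin_neg. do 2 f_equal.
      rewrite INR_IZR_INZ. replace (Z.of_nat (Z.abs_nat n)) with (- n)%Z by lia.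
      rewrite opp_IZR; ring.
Qed.

(** Cutting the sums at N costs at most T/N for the first moment and
    (T/N) sin x for the sine sum, where T is the tail of the second moment; here
    |sin (n x)| <= |n| sin x is used, so that the error is again a multiple of
    sin x. *)
Lemma abs_moment (a : Z -> R) (E : R) (A : R -> R) :
  (forall n, 0 <= a n) ->
  is_lim_seq (zsum (fun n => IZR n ^ 2 * a n)) E ->
  is_lim_seq (zsum (fun n => IZR n * a n)) 1 ->
  (forall x, 0 <= x <= PI -> A x <= sin x /\
     is_lim_seq (zsum (fun n => a n * sin (IZR n * x))) (A x)) ->
  forall N, (1 <= N)%nat ->
  1 - 4 * (E - zsum (fun n => IZR n ^ 2 * a n) N)
    <= zsum (fun n => IZR n * Rabs (IZR n) * a n) N.
Proof.
  intros Ha HE H1 HA N HN.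
  set (S2 := zsum (fun n => IZR n ^ 2 * a n)) in *.
  assert (HNp : 0 < INR N) by (apply lt_0_INR; lia).
  assert (HS : forall M, S2 M <= E).
  { intros M. assert (HI : forall k, S2 k <= S2 (S k)).
    { intros k; apply zsum_mono; [|lia]. intros n; apply Rmult_le_pos;
        [apply pow2_ge_0|auto]. }
    exact (is_lim_seq_incr_compare S2 E HE HI M). }
  set (S1 := zsum (fun n => Rabs (IZR n) * a n)).
  assert (HT : forall M, (N <= M)%nat -> S1 M - S1 N <= (E - S2 N) / INR N).
  { intros M HM. apply Rle_trans with ((S2 M - S2 N) / INR N).
    2: { apply Rmult_le_compat_r; [left; now apply Rinv_0_lt_compat|]. pose proof (HS M);
      lra. }
    induction HM as [|M HM IH].
    - unfold Rminus; rewrite !Rplus_opp_r; unfold Rdiv; lra.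
    - assert (HD : S1 (S M) - S1 M <= (S2 (S M) - S2 M) / INR N).
      { unfold S1, S2; cbn [zsum]. apply Rle_div_r; [exact HNp|].
        assert (Hb : forall n, (Z.of_nat N <= Z.abs n)%Z ->
          Rabs (IZR n) * a n * INR N <= IZR n ^ 2 * a n).
        { intros n Hn. rewrite <- (pow2_abs (IZR n)).
          assert (INR N <= Rabs (IZR n)) by (rewrite <- abs_IZR, INR_IZR_INZ; apply IZR_le;
            lia).
          pose proof (Ha n). pose proof (Rabs_pos (IZR n)).
          replace (Rabs (IZR n) ^ 2 * a n) with (Rabs (IZR n) * a n * Rabs (IZR n)) by ring.
          apply Rmult_le_compat_l; [apply Rmult_le_pos|]; assumption. }
        pose proof (Hb (Z.of_nat (S M)) ltac:(lia)).
        pose proof (Hb (- Z.of_nat (S M))%Z ltac:(lia)). lra. }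
      unfold Rdiv in *. lra. }
  assert (Habs : forall (b : Z -> R) c M, (forall n, Rabs (b n) <= c * (Rabs (IZR n) * a n)) ->
     (N <= M)%nat -> Rabs (zsum b M - zsum b N) <= c * (S1 M - S1 N)).
  { intros b c M Hb HM. induction HM as [|M HM IH].
    - unfold Rminus; rewrite !Rplus_opp_r, Rabs_R0; lra.
    - unfold S1 in *; cbn [zsum].
      replace (zsum b M + (b (Z.of_nat (S M)) + b (- Z.of_nat (S M))%Z) - zsum b N) with
        ((zsum b M - zsum b N) + (b (Z.of_nat (S M)) + b (- Z.of_nat (S M))%Z)) by ring.
      eapply Rle_trans; [apply Rabs_triang|].
      pose proof (Rabs_triang (b (Z.of_nat (S M))) (b (- Z.of_nat (S M))%Z)).
      pose proof (Hb (Z.of_nat (S M))). pose proof (Hb (- Z.of_nat (S M))%Z). lra. }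
  apply abs_moment_finite; [exact HN|pose proof (HS N); lra| |].
  - intros x Hx. destruct (HA x Hx) as [HAx HL].
    assert (Hsx : 0 <= sin x) by (apply sin_ge_0; lra).
    assert (HB : forall n, Rabs (a n * sin (IZR n * x)) <= sin x * (Rabs (IZR n) * a n)).
    { intros n; rewrite Rabs_mult, (Rabs_pos_eq (a n)) by auto.
      pose proof (sin_Z_le n x Hsx). pose proof (Ha n). nra. }
    set (b := fun n => a n * sin (IZR n * x)) in *.
    assert (HLle : Rbar_le (zsum b N - sin x * ((E - S2 N) / INR N)) (A x)).
    { apply (is_lim_seq_le_loc (fun _ => zsum b N - sin x * ((E - S2 N) / INR N)) (zsum b));
        [|apply is_lim_seq_const|exact HL].
      exists N; intros M HM. pose proof (Habs b (sin x) M HB HM) as H.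
      apply Rabs_le_between in H. specialize (HT M HM). nra. }
    simpl in HLle. lra.
  - assert (HB : forall n, Rabs (IZR n * a n) <= 1 * (Rabs (IZR n) * a n)).
    { intros n; rewrite Rabs_mult, (Rabs_pos_eq (a n)) by auto. lra. }
    assert (HLle : Rbar_le 1 (zsum (fun n => IZR n * a n) N + (E - S2 N) / INR N)).
    { apply (is_lim_seq_le_loc (zsum (fun n => IZR n * a n)) (fun _ => zsum (fun n => IZR n
        * a n) N + (E - S2 N) / INR N)); [|exact H1|apply is_lim_seq_const].
      exists N; intros M HM. pose proof (Habs _ 1 M HB HM) as H.
      apply Rabs_le_between in H. specialize (HT M HM). lra. }
    simpl in HLle. lra.
Qed.

(** * Harmonic functions in polar coordinates *)

Definition D1 (f : R -> R -> R) (x y : R) := Derive (fun z => f z y) x.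
Definition D2 (f : R -> R -> R) (x y : R) := Derive (fun z => f x z) y.

Lemma Cmod_polar r t : 0 <= r -> Cmod (r * cos t, r * sin t) = r.
Proof.
  intros Hr; unfold Cmod; simpl fst; simpl snd.
  pose proof (sin2_cos2 t) as H; unfold Rsqr in H.
  replace ((r * cos t) ^ 2 + (r * sin t) ^ 2) with (r * r * (sin t * sin t + cos t * cos t))
    by ring.
  rewrite H, Rmult_1_r; now apply sqrt_square.
Qed.

Lemma open_annulus_open rho x y : open_annulus rho (x, y) ->
  locally_2d (fun u v => open_annulus rho (u, v)) x y.
Proof.
  unfold open_annulus. intros H.
  assert (HC : continuity_2d_pt (fun u v => Cmod (u, v)) x y).
  { unfold Cmod; simpl fst; simpl snd.
    apply (continuity_1d_2d_pt_comp sqrt (fun u v => u ^ 2 + v ^ 2)).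
    - apply continuity_pt_filterlim, continuous_sqrt.
    - apply (cts2_plus (fun u _ => u ^ 2) (fun _ v => v ^ 2)); cts. }
  set (e := Rmin (Cmod (x, y) - 1) (rho - Cmod (x, y))).
  assert (He : 0 < e) by (unfold e; apply Rmin_glb_lt; lra).
  destruct (HC (mkposreal e He)) as [d Hd].
  exists d; intros u v Hu Hv. specialize (Hd u v Hu Hv). simpl in Hd.
  apply Rabs_def2 in Hd.
  assert (e <= Cmod (x, y) - 1) by apply Rmin_l.
  assert (e <= rho - Cmod (x, y)) by apply Rmin_r. lra.
Qed.

Lemma differentiable_from_partials f x y (f1 : R -> R -> R) f2 :
  locally_2d (fun u v => is_derive (fun z => f z v) u (f1 u v)) x y ->
  is_derive (fun z => f x z) y f2 -> continuity_2d_pt f1 x y ->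
  differentiable_pt_lim f x y (f1 x y) f2.
Proof.
  intros H1 H2 H3. apply filterdiff_differentiable_pt_lim.
  apply (is_derive_filterdiff f x y f1 f2).
  - now apply locally_2d_locally in H1.
  - exact H2.
  - now apply continuity_2d_pt_filterlim in H3.
Qed.

Lemma ex_diff_n_1_differentiable D f x y :
  locally_2d (fun u v => D u v) x y -> (forall u v, D u v -> ex_diff_n f 1 u v) ->
  D x y -> differentiable_pt_lim f x y (D1 f x y) (D2 f x y).
Proof.
  intros HD Hf Hxy.
  apply (differentiable_from_partials f x y (D1 f)).
  - revert HD; apply locally_2d_impl, locally_2d_forall. intros u v Huv.
    destruct (Hf u v Huv) as [_ [H _]]. now apply Derive_correct.
  - destruct (Hf x y Hxy) as [_ [_ [H _]]]. now apply Derive_correct.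
  - destruct (Hf x y Hxy) as [_ [_ [_ [[H _] _]]]]. exact H.
Qed.

Lemma is_derive_polar_r f r t a b :
  differentiable_pt_lim f (r * cos t) (r * sin t) a b ->
  is_derive (fun s => f (s * cos t) (s * sin t)) r (a * cos t + b * sin t).
Proof.
  intros H; apply is_derive_Reals.
  apply (derivable_pt_lim_comp_2d f (fun s => s * cos t) (fun s => s * sin t) r a b (cos t)
    (sin t) H);
    apply is_derive_Reals; auto_derive; auto; ring.
Qed.
Lemma is_derive_polar_t f r t a b :
  differentiable_pt_lim f (r * cos t) (r * sin t) a b ->
  is_derive (fun s => f (r * cos s) (r * sin s)) t (r * (b * cos t - a * sin t)).
Proof.
  intros H; apply is_derive_Reals.
  replace (r * (b * cos t - a * sin t)) with (a * (- (r * sin t)) + b * (r * cos t)) by ring.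
  apply (derivable_pt_lim_comp_2d f (fun s => r * cos s) (fun s => r * sin s) t a b _ _ H);
    apply is_derive_Reals; auto_derive; auto; ring.
Qed.

Lemma continuity_2d_polar f r t :
  continuity_2d_pt f (r * cos t) (r * sin t) ->
  continuity_2d_pt (fun r t => f (r * cos t) (r * sin t)) r t.
Proof.
  intros H e. destruct (H e) as [d Hd].
  assert (H1 : cts2 (fun r t => r * cos t)) by cts.
  assert (H2 : cts2 (fun r t => r * sin t)) by cts.
  pose proof (locally_2d_and _ _ _ _ (H1 r t d) (H2 r t d)) as H12.
  revert H12; apply locally_2d_impl, locally_2d_forall.
  intros u v [Hu Hv]; now apply Hd.
Qed.

Definition polar (f : R -> R -> R) (r t : R) := f (r * cos t) (r * sin t).
(** The Euler derivative x u_x + y u_y = r u_r in polar coordinates. *)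
Definition radial (fx fy : R -> R -> R) (r t : R) :=
  r * (polar fx r t * cos t + polar fy r t * sin t).
(** The rotation derivative x u_y - y u_x = u_t in polar coordinates. *)
Definition angular (fx fy : R -> R -> R) (r t : R) :=
  r * (polar fy r t * cos t - polar fx r t * sin t).

(** The Euler derivative applied twice; for harmonic u it is minus the second
    angular derivative. *)
Definition euler2 (u : R -> R -> R) (x y : R) :=
  x * D1 u x y + y * D2 u x y
  + (x ^ 2 * D1 (D1 u) x y + x * y * (D2 (D1 u) x y + D1 (D2 u) x y) + y ^ 2 * D2 (D2 u) x y).

Lemma is_derive_radial (f g : R -> R) a b x df dg :
  is_derive f x df -> is_derive g x dg ->
  is_derive (fun s => s * (f s * a + g s * b)) x
    ((f x * a + g x * b) + x * (df * a + dg * b)).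
Proof.
  intros Hf Hg.
  pose proof (is_derive_Rmult f (fun _ => a) x df 0 Hf (is_derive_const a x)) as H1.
  pose proof (is_derive_Rmult g (fun _ => b) x dg 0 Hg (is_derive_const b x)) as H2.
  evar_last.
  - exact (is_derive_Rmult (fun s => s) _ x 1 _ (is_derive_id x) (is_derive_plus _ _ x _ _ H1
      H2)).
  - unfold plus; simpl; ring.
Qed.
Lemma is_derive_angular (f g : R -> R) r x df dg :
  is_derive f x df -> is_derive g x dg ->
  is_derive (fun s => r * (g s * cos s - f s * sin s)) x
    (r * (dg * cos x - g x * sin x - df * sin x - f x * cos x)).
Proof.
  intros Hf Hg.
  pose proof (is_derive_Rmult f sin x df (cos x) Hf (is_derive_sin x)) as H1.
  pose proof (is_derive_Rmult g cos x dg (- sin x) Hg (is_derive_cos x)) as H2.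
  evar_last.
  - exact (is_derive_scal _ x r _ (is_derive_minus _ _ x _ _ H2 H1)).
  - unfold minus, plus, opp; simpl; ring.
Qed.

(** The only place where the Laplace equation enters: r d/dr (r u_r) + u_tt is
    r^2 times the Laplacian.  The mixed second derivatives cancel without
    appeal to their symmetry. *)
Lemma harmonic_polar rho u r t : 1 < r < rho -> harmonic_on (open_annulus rho) u ->
  is_derive (fun s => polar u s t) r (radial (D1 u) (D2 u) r t / r) /\
  is_derive (fun s => polar u r s) t (angular (D1 u) (D2 u) r t) /\
  is_derive (fun s => radial (D1 u) (D2 u) s t) r (polar (euler2 u) r t / r) /\
  is_derive (fun s => angular (D1 u) (D2 u) r s) t (- polar (euler2 u) r t) /\
  continuity_2d_pt (polar (euler2 u)) r t.
Proof.
  intros Hr Hu.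
  set (D := fun x y => open_annulus rho (x, y)).
  assert (HD : D (r * cos t) (r * sin t)).
  { unfold D, open_annulus; rewrite Cmod_polar; lra. }
  assert (HO : locally_2d D (r * cos t) (r * sin t)) by now apply open_annulus_open.
  assert (H1 : forall x y, D x y -> ex_diff_n u 1 x y).
  { intros x y Hxy; destruct (Hu x y Hxy) as [[A [B [C [[E0 _] [F0 _]]]]] _].
    repeat split; auto. }
  assert (H2 : forall x y, D x y -> ex_diff_n (D1 u) 1 x y).
  { intros x y Hxy; destruct (Hu x y Hxy) as [[A [B [C [E0 F0]]]] _]. exact E0. }
  assert (H3 : forall x y, D x y -> ex_diff_n (D2 u) 1 x y).
  { intros x y Hxy; destruct (Hu x y Hxy) as [[A [B [C [E0 F0]]]] _]. exact F0. }
  pose proof (ex_diff_n_1_differentiable D u _ _ HO H1 HD) as E1.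
  pose proof (ex_diff_n_1_differentiable D (D1 u) _ _ HO H2 HD) as E2.
  pose proof (ex_diff_n_1_differentiable D (D2 u) _ _ HO H3 HD) as E3.
  assert (HL : D1 (D1 u) (r * cos t) (r * sin t) + D2 (D2 u) (r * cos t) (r * sin t) = 0)
    by (destruct (Hu _ _ HD) as [_ H]; exact H).
  split; [|split; [|split; [|split]]].
  - unfold radial. replace (r * _ / r) with (polar (D1 u) r t * cos t + polar (D2 u) r t * sin
      t)
      by (field; lra).
    now apply is_derive_polar_r.
  - now apply is_derive_polar_t.
  - unfold radial.
    pose proof (is_derive_polar_r _ _ _ _ _ E2) as G2. pose proof (is_derive_polar_r _ _ _ _ _
      E3) as G3.
    evar_last; [exact (is_derive_radial _ _ _ _ _ _ _ G2 G3)|].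
    unfold polar, euler2. field. lra.
  - unfold angular.
    pose proof (is_derive_polar_t _ _ _ _ _ E2) as G2. pose proof (is_derive_polar_t _ _ _ _ _
      E3) as G3.
    evar_last; [exact (is_derive_angular _ _ _ _ _ _ G2 G3)|].
    unfold polar, euler2.
    replace (D2 (D2 u) (r * cos t) (r * sin t)) with (- D1 (D1 u) (r * cos t) (r * sin t))
      by lra.
    ring.
  - assert (Hc : continuity_2d_pt (euler2 u) (r * cos t) (r * sin t)).
    { destruct (Hu _ _ HD) as [[A [B [C [[E0 [_ [_ [[X1 _] [X2 _]]]]] [F0 [_ [_ [[X3 _] [X4
        _]]]]]]]]] _].
      unfold euler2.
      repeat first [apply continuity_2d_pt_plus | apply continuity_2d_pt_mult].
      all: try exact E0; try exact F0; try exact X1; try exact X2; try exact X3; try exact X4.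
      all: try apply continuity_2d_pt_id1; try apply continuity_2d_pt_id2;
        try apply continuity_2d_pt_const. }
    now apply continuity_2d_polar.
Qed.

(** * Evolution of the Fourier modes across the annulus *)

Lemma locally_interval a b r : a < r < b -> locally r (fun s => a < s < b).
Proof.
  intros H. exists (mkposreal (Rmin (r - a) (b - r)) ltac:(apply Rmin_glb_lt; lra)).
  intros s Hs. change (Rabs (s - r) < Rmin (r - a) (b - r)) in Hs.
  pose proof (Rmin_l (r - a) (b - r)). pose proof (Rmin_r (r - a) (b - r)).
  apply Rabs_def2 in Hs. lra.
Qed.

Lemma is_derive_avg_param (F dF : R -> R -> R) a b r : a < r < b ->
  (forall s t, a < s < b -> is_derive (fun z => F z t) s (dF s t)) ->
  (forall s, a < s < b -> cts (F s)) ->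
  (forall t, continuity_2d_pt dF r t) ->
  is_derive (fun s => avg (F s)) r (avg (dF r)).
Proof.
  intros Hr HF HC Hd. pose proof (locally_interval a b r Hr) as HL.
  assert (E : forall s t, a < s < b -> Derive (fun z => F z t) s = dF s t).
  { intros; now apply is_derive_unique, HF. }
  unfold avg.
  apply (is_derive_ext (fun s => / (2 * PI) * RInt (F s) 0 (2 * PI))).
  { intros; unfold Rdiv; apply Rmult_comm. }
  replace (RInt (dF r) 0 (2 * PI) / (2 * PI)) with (/ (2 * PI) * RInt (dF r) 0 (2 * PI))
    by (unfold Rdiv; apply Rmult_comm).
  apply is_derive_scal.
  rewrite (RInt_ext_all (dF r) (fun t => Derive (fun z => F z t) r))
    by (intros; now rewrite E).
  apply (is_derive_RInt_param F).
  - revert HL; apply filter_imp; intros s Hs t _. exists (dF s t); now apply HF.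
  - intros t _. apply (continuity_2d_pt_ext_loc dF); [|apply Hd].
    destruct HL as [d HL]; exists d; intros u v Hu _. now rewrite E by now apply HL.
  - revert HL; apply filter_imp; intros s Hs. apply cts_ex_RInt. now apply HC.
Qed.

(** Passes identities from the open annulus to its two boundary circles. *)
Lemma eq_at_ends (f g : R -> R) a b : a < b -> cts f -> cts g ->
  (forall r, a < r < b -> f r = g r) -> forall r, a <= r <= b -> f r = g r.
Proof.
  intros Hab Hf Hg H r Hr.
  destruct (Req_dec (f r) (g r)) as [|Hn]; [assumption|exfalso].
  assert (Hp : 0 < (f r - g r) ^ 2) by (apply pow2_gt_0; lra).
  destruct (cts_pos_near (fun s => (f s - g s) ^ 2) r ltac:(cts) Hp) as [d [Hd Hd']].
  assert (exists s, a < s < b /\ Rabs (s - r) < d) as [s [Hs1 Hs2]].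
  { set (e := Rmin (d / 2) ((b - a) / 2)).
    assert (He : 0 < e) by (unfold e; apply Rmin_glb_lt; lra).
    assert (e <= d / 2) by apply Rmin_l. assert (e <= (b - a) / 2) by apply Rmin_r.
    destruct (Rle_dec r ((a + b) / 2)).
    - exists (r + e / 2); split; [lra|]. apply Rabs_def1; lra.
    - exists (r - e / 2); split; [lra|]. apply Rabs_def1; lra. }
  specialize (Hd' s Hs2). rewrite (H s Hs1), Rminus_diag in Hd'. simpl in Hd'. lra.
Qed.

Lemma polar_per f r : per (polar f r).
Proof.
  intros t; unfold polar. now rewrite cos_plus, sin_plus, cos_2PI, sin_2PI,
    !Rmult_0_r, !Rmult_1_r, Rminus_0_r, Rplus_0_r.
Qed.

Lemma cos_sin_per t : cos (t + 2 * PI) = cos t /\ sin (t + 2 * PI) = sin t.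
Proof. rewrite cos_plus, sin_plus, cos_2PI, sin_2PI; split; ring. Qed.

Lemma angular_per f g r : per (angular f g r).
Proof.
  intros t; unfold angular. rewrite !(polar_per _ r t).
  destruct (cos_sin_per t) as [-> ->]. reflexivity.
Qed.

Lemma is_derive_ch n r : 0 < r -> is_derive (ch n) r (n ^ 2 * sh n r / r).
Proof.
  intros Hr; unfold ch, sh. destruct (Req_EM_T n 0) as [-> | Hn].
  - apply (is_derive_ext (fun _ => cosh 0)).
    + intros t; now rewrite Rmult_0_l.
    + evar_last; [apply is_derive_const|]. unfold zero; simpl; field; lra.
  - unfold cosh, sinh. auto_derive; [auto|]. field; lra.
Qed.
Lemma is_derive_sh n r : 0 < r -> is_derive (sh n) r (ch n r / r).
Proof.
  intros Hr; unfold ch, sh. destruct (Req_EM_T n 0) as [-> | Hn].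
  - rewrite Rmult_0_l, cosh_0. auto_derive; [auto|]. field; lra.
  - unfold cosh, sinh. auto_derive; [auto|]. field; lra.
Qed.

(** The Wronskians of (A, B) with the two fundamental solutions have zero
    derivative in the open interval and are continuous up to its ends. *)
Lemma euler_ode n rho (A B : R -> R) : 1 < rho -> cts A -> cts B ->
  (forall r, 1 < r < rho -> is_derive A r (B r / r)) ->
  (forall r, 1 < r < rho -> is_derive B r (n ^ 2 * A r / r)) ->
  forall r, 1 <= r <= rho -> A r = ch n r * A 1 + sh n r * B 1.
Proof.
  intros Hrho HA HB DA DB.
  assert (Cc : forall r, 0 < r -> continuous (ch n) r).
  { intros r Hr; apply @ex_derive_continuous; eexists; now apply is_derive_ch. }
  assert (Cs : forall r, 0 < r -> continuous (sh n) r).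
  { intros r Hr; apply @ex_derive_continuous; eexists; now apply is_derive_sh. }
  set (W1 := fun r => A r * ch n r - B r * sh n r).
  set (W2 := fun r => B r * ch n r - n ^ 2 * (A r * sh n r)).
  assert (DW1 : forall r, 1 < r < rho -> is_derive W1 r 0).
  { intros r Hr. unfold W1. evar_last.
    - apply @is_derive_minus; apply is_derive_Rmult; [apply DA; lra|apply is_derive_ch;
        lra|apply DB; lra|apply is_derive_sh; lra].
    - unfold minus, plus, opp; simpl. field; lra. }
  assert (DW2 : forall r, 1 < r < rho -> is_derive W2 r 0).
  { intros r Hr. unfold W2. evar_last.
    - apply @is_derive_minus; [apply is_derive_Rmult; [apply DB; lra|apply is_derive_ch;
        lra]|].
      apply is_derive_scal, is_derive_Rmult; [apply DA; lra|apply is_derive_sh; lra].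
    - unfold minus, plus, opp; simpl. field; lra. }
  assert (CW1 : forall r, 0 < r -> continuous W1 r).
  { intros r Hr; apply @continuous_minus; apply @continuous_mult; auto. }
  assert (CW2 : forall r, 0 < r -> continuous W2 r).
  { intros r Hr; apply @continuous_minus; [apply @continuous_mult; auto|].
    apply @continuous_mult; [apply continuous_const|]. apply @continuous_mult; auto. }
  assert (HW : forall W : R -> R, (forall r, 1 < r < rho -> is_derive W r 0) ->
     (forall r, 0 < r -> continuous W r) -> forall r, 1 <= r <= rho -> W r = W 1).
  { intros W DW CW r Hr. destruct (Req_dec r 1) as [-> | Hr1]; [reflexivity|].
    destruct (MVT_gen W 1 r (fun _ => 0)) as [c [_ Hc]].
    - rewrite Rmin_left, Rmax_right by lra. intros; apply DW; lra.
    - rewrite Rmin_left, Rmax_right by lra. intros x Hx.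
      apply continuity_pt_filterlim, CW; lra.
    - lra. }
  assert (E1 : ch n 1 = 1) by (unfold ch; rewrite ln_1, Rmult_0_r; apply cosh_0).
  assert (E2 : sh n 1 = 0).
  { unfold sh; rewrite ln_1; destruct (Req_EM_T n 0); [reflexivity|].
    rewrite Rmult_0_r, sinh_0; field; assumption. }
  intros r Hr.
  pose proof (HW W1 DW1 CW1 r Hr) as H1. pose proof (HW W2 DW2 CW2 r Hr) as H2.
  unfold W1, W2 in H1, H2. rewrite E1, E2 in H1, H2.
  pose proof (ch_sh_sq n r) as Hq.
  replace (A r) with (A r * (ch n r ^ 2 - n ^ 2 * sh n r ^ 2)) by (rewrite Hq; ring).
  replace (A r * (ch n r ^ 2 - n ^ 2 * sh n r ^ 2)) with
    (ch n r * (A r * ch n r - B r * sh n r)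
     + sh n r * (B r * ch n r - n ^ 2 * (A r * sh n r))) by ring.
  rewrite H1, H2; ring.
Qed.

(** Differentiation under the integral gives the Euler system for the
    average of u g and of r u_r g: two integrations by parts in t move the
    second angular derivative of u to g. *)
Lemma mode_evolution rho u (U P : R -> R -> R) (g gd : R -> R) n : 1 < rho ->
  harmonic_on (open_annulus rho) u -> cts2 U -> cts2 P ->
  (forall r t, 1 < r < rho -> U r t = polar u r t) ->
  (forall r t, 1 < r < rho -> P r t = radial (D1 u) (D2 u) r t) ->
  (forall t, is_derive g t (gd t)) -> (forall t, is_derive gd t (- n ^ 2 * g t)) ->
  per g -> per gd ->
  forall r, 1 <= r <= rho ->
  avg (fun t => U r t * g t)
  = ch n r * avg (fun t => U 1 t * g t) + sh n r * avg (fun t => P 1 t * g t).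
Proof.
  intros Hrho Hu CU CP EU EP Dg Dgd Pg Pgd.
  pose proof (cts_derive _ _ Dg) as Cg. pose proof (cts_derive _ _ Dgd) as Cgd.
  assert (HP : forall r t, 1 < r < rho -> _) by (intros r t Hr;
    exact (harmonic_polar rho u r t Hr Hu)).
  assert (CUs : forall r, cts (U r)) by (intros; cts).
  assert (CPs : forall r, cts (P r)) by (intros; cts).
  assert (HCPP : forall r, 1 < r < rho -> cts (polar (euler2 u) r)).
  { intros r Hr t. pose proof (proj2 (proj2 (proj2 (proj2 (HP r t Hr))))) as H.
    intros V [e He]. destruct (H e) as [d Hd]. exists d; intros z Hz; apply He.
    apply (Hd r z); [rewrite Rminus_diag, Rabs_R0; apply cond_pos|exact Hz]. }
  assert (HQ : forall r, 1 < r < rho -> cts (angular (D1 u) (D2 u) r)).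
  { intros r Hr. apply (cts_derive _ (fun t => - polar (euler2 u) r t)).
    intros t; apply (HP r t Hr). }
  apply (euler_ode n rho (fun r => avg (fun t => U r t * g t)) (fun r => avg (fun t => P r t
    * g t)) Hrho).
  - apply (cts_avg_param (fun r t => U r t * g t)); cts.
  - apply (cts_avg_param (fun r t => P r t * g t)); cts.
  - intros r Hr.
    replace (avg (fun t => P r t * g t) / r) with (avg (fun t => P r t / r * g t)).
    2: { unfold Rdiv; rewrite (Rmult_comm _ (/ r)), <- avg_scal by cts. apply avg_ext; intros;
      ring. }
    apply (is_derive_avg_param (fun r t => U r t * g t) (fun r t => P r t / r * g t) 1 rho r
      Hr).
    + intros s t Hs. evar_last.
      * apply is_derive_Rmult; [|apply is_derive_const].
        apply (is_derive_ext_loc (fun s => polar u s t)).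
        -- generalize (locally_interval 1 rho s Hs); apply filter_imp. intros; symmetry;
            now apply EU.
        -- exact (proj1 (HP s t Hs)).
      * rewrite EP by assumption. unfold zero; simpl; ring.
    + intros; cts.
    + intros t. apply continuity_2d_pt_mult; [|apply (cts2_2 g Cg)].
      apply continuity_2d_pt_mult; [apply CP|].
      apply continuity_2d_pt_inv; [apply continuity_2d_pt_id1|lra].
  - intros r Hr.
    replace (n ^ 2 * avg (fun t => U r t * g t) / r) with (avg (fun t => polar (euler2 u) r t
      / r * g t)).
    + apply (is_derive_avg_param (fun r t => P r t * g t) (fun r t => polar (euler2 u) r t / r
        * g t) 1 rho r Hr).
      * intros s t Hs. evar_last.
        -- apply is_derive_Rmult; [|apply is_derive_const].
           apply (is_derive_ext_loc (fun s => radial (D1 u) (D2 u) s t)).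
           ++ generalize (locally_interval 1 rho s Hs); apply filter_imp. intros; symmetry;
               now apply EP.
           ++ apply (proj1 (proj2 (proj2 (HP s t Hs)))).
        -- unfold zero; simpl; ring.
      * intros; cts.
      * intros t. apply continuity_2d_pt_mult; [|apply (cts2_2 g Cg)].
        apply continuity_2d_pt_mult; [apply (HP r t Hr)|].
        apply continuity_2d_pt_inv; [apply continuity_2d_pt_id1|lra].
    + assert (HPP := HCPP r Hr). assert (HQr := HQ r Hr).
      transitivity (/ r * - avg (fun t => - polar (euler2 u) r t * g t)).
      { rewrite <- (Rmult_1_l (- avg _)).
        replace (1 * - avg (fun t => - polar (euler2 u) r t * g t)) with ((-1) * avg (fun t =>
          - polar (euler2 u) r t * g t)) by ring.
        rewrite <- !avg_scal by cts. apply avg_ext; intros; field; lra. }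
      rewrite (avg_by_parts (angular (D1 u) (D2 u) r) (fun t => - polar (euler2 u) r t) g gd);
        auto using angular_per; try cts; try (intros t; apply (HP r t Hr)).
      rewrite (avg_by_parts (U r) (angular (D1 u) (D2 u) r) gd (fun t => - n ^ 2 * g t));
        auto; try cts.
      * rewrite (avg_ext (fun x => U r x * (- n ^ 2 * g x)) (fun x => - n ^ 2 * (U r x * g
          x))) by (intros; ring).
        rewrite avg_scal by cts. field; lra.
      * intros t. apply (is_derive_ext (polar u r)); [intros; symmetry;
          now apply EU|]. apply (HP r t Hr).
      * intros t. rewrite !EU by assumption. apply polar_per.
Qed.

(** * The boundary map and its dilatation *)

(** Freezing the radius outside [1, rho] turns functions that are continuous
    on the closed annulus into functions continuous on the whole (r, t) plane,
    so that one-sided limits at the boundary circles need no separate treatment. *)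
Definition clamp (rho r : R) := Rmax 1 (Rmin r rho).
Lemma clamp_range rho r : 1 < rho -> 1 <= clamp rho r <= rho.
Proof.
  intros H; unfold clamp; split; [apply Rmax_l|]. apply Rmax_lub; [lra|apply Rmin_r].
Qed.
Lemma clamp_id rho r : 1 <= r <= rho -> clamp rho r = r.
Proof. intros H; unfold clamp; rewrite Rmin_left, Rmax_right; lra. Qed.
Lemma cts_clamp rho : cts (clamp rho).
Proof.
  apply (cts_ext (fun r => (1 + (r + rho - Rabs (r - rho)) / 2 + Rabs (1 - (r + rho - Rabs (r
    - rho)) / 2)) / 2)).
  - intros r; unfold clamp, Rmax, Rmin.
    destruct (Rle_dec r rho) as [H1|H1].
    + rewrite (Rabs_left1 (r - rho)) by lra. destruct (Rle_dec 1 r).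
      * rewrite Rabs_left1; lra.
      * rewrite Rabs_pos_eq; lra.
    + rewrite (Rabs_pos_eq (r - rho)) by lra. destruct (Rle_dec 1 rho).
      * rewrite Rabs_left1; lra.
      * rewrite Rabs_pos_eq; lra.
  - assert (HA : cts Rabs) by (intros x; apply continuous_Rabs).
    pose proof (cts_comp Rabs (fun r => r - rho) HA ltac:(cts)) as H1.
    pose proof (cts_comp Rabs (fun r => 1 - (r + rho - Rabs (r - rho)) / 2) HA ltac:(cts)) as
      H2.
    cbv beta in H1, H2. cts.
Qed.

Definition at_polar (rho : R) (f : C -> C) (r t : R) : C :=
  f (clamp rho r * cos t, clamp rho r * sin t).

Lemma at_polar_per rho f r : cper (at_polar rho f r).
Proof. intros t; unfold at_polar. now destruct (cos_sin_per t) as [-> ->]. Qed.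

Lemma cts2_at_polar rho f : 1 < rho -> continuous_on (closed_annulus rho) f ->
  cts2 (fun r t => Re (at_polar rho f r t)) /\ cts2 (fun r t => Im (at_polar rho f r t)).
Proof.
  intros Hr Hf.
  assert (HD : forall r t, closed_annulus rho (clamp rho r * cos t, clamp rho r * sin t)).
  { intros r t. pose proof (clamp_range rho r Hr). unfold closed_annulus. rewrite Cmod_polar;
      lra. }
  pose proof (cts_clamp rho) as Hc.
  assert (C1 : cts2 (fun r t => clamp rho r * cos t)) by cts.
  assert (C2 : cts2 (fun r t => clamp rho r * sin t)) by cts.
  assert (key : forall r t (e : posreal), locally_2d (fun r' t' =>
     ball (at_polar rho f r t) e (at_polar rho f r' t')) r t).
  { intros r t e.
    destruct (Hf _ (HD r t) (ball (at_polar rho f r t) e)) as [d Hd].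
    { exists e; intros w Hw; exact Hw. }
    pose proof (locally_2d_and _ _ _ _ (C1 r t d) (C2 r t d)) as H12.
    revert H12; apply locally_2d_impl, locally_2d_forall.
    intros r' t' [H1 H2]. apply Hd; [|apply HD]. split; assumption. }
  split; intros r t e; generalize (key r t e); apply locally_2d_impl, locally_2d_forall;
    intros r' t' [H1 H2]; assumption.
Qed.

Lemma is_derive_Re (f : R -> C) x l : is_derive f x l -> is_derive (fun t => Re (f t)) x (Re
  l).
Proof.
  intros H.
  apply (filterdiff_comp' f (fun z : C => fst z) x (fun y => scal y l) (fun z : C => fst z) H).
  apply filterdiff_linear, is_linear_fst.
Qed.
Lemma is_derive_Im (f : R -> C) x l : is_derive f x l -> is_derive (fun t => Im (f t)) x (Im
  l).
Proof.
  intros H.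
  apply (filterdiff_comp' f (fun z : C => snd z) x (fun y => scal y l) (fun z : C => snd z) H).
  apply filterdiff_linear, is_linear_snd.
Qed.

(** For one real component u of h: the evolution of its Fourier coefficients,
    and its tangential derivative on the unit circle.  The latter is the limit
    of the fundamental theorem of calculus on circles of radius r > 1. *)
Lemma component_facts rho (u ux uy : R -> R -> R) (U Ux Uy : R -> R -> R) : 1 < rho ->
  harmonic_on (open_annulus rho) u ->
  (forall x y, open_annulus rho (x, y) -> is_derive (fun s => u s y) x (ux x y)
     /\ is_derive (fun s => u x s) y (uy x y)) ->
  cts2 U -> cts2 Ux -> cts2 Uy ->
  (forall r t, 1 <= r <= rho -> U r t = polar u r t /\ Ux r t = polar ux r t /\ Uy r t = polar
    uy r t) ->
  (forall (n : Z) r, 1 <= r <= rho ->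
     ca (U r) (IZR n) = ch (IZR n) r * ca (U 1) (IZR n)
        + sh (IZR n) r * ca (fun t => Ux 1 t * cos t + Uy 1 t * sin t) (IZR n)
     /\ sa (U r) (IZR n) = ch (IZR n) r * sa (U 1) (IZR n)
        + sh (IZR n) r * sa (fun t => Ux 1 t * cos t + Uy 1 t * sin t) (IZR n))
  /\ (forall t, is_derive (U 1) t (Uy 1 t * cos t - Ux 1 t * sin t)).
Proof.
  intros Hrho Hu Hd CU CUx CUy HE.
  assert (Hopen : forall r t, 1 < r < rho -> open_annulus rho (r * cos t, r * sin t)).
  { intros r t Hr; unfold open_annulus; rewrite Cmod_polar; lra. }
  assert (HD1 : forall r t, 1 < r < rho -> polar (D1 u) r t = Ux r t).
  { intros r t Hr. destruct (HE r t ltac:(lra)) as [_ [-> _]].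
    apply is_derive_unique, (Hd _ _ (Hopen r t Hr)). }
  assert (HD2 : forall r t, 1 < r < rho -> polar (D2 u) r t = Uy r t).
  { intros r t Hr. destruct (HE r t ltac:(lra)) as [_ [_ ->]].
    apply is_derive_unique, (Hd _ _ (Hopen r t Hr)). }
  split.
  - intros n r Hr.
    set (P := fun r t => r * (Ux r t * cos t + Uy r t * sin t)).
    assert (CP : cts2 P) by (unfold P; cts).
    assert (HP1 : forall t, P 1 t = Ux 1 t * cos t + Uy 1 t * sin t) by (intros; unfold P;
      ring).
    assert (EU : forall r t, 1 < r < rho -> U r t = polar u r t) by (intros; apply HE; lra).
    assert (EP : forall r t, 1 < r < rho -> P r t = radial (D1 u) (D2 u) r t).
    { intros s t Hs. unfold P, radial. now rewrite HD1, HD2. }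
    unfold ca, sa. split.
    + rewrite (mode_evolution rho u U P (fun t => cos (IZR n * t)) (fun t => - IZR n * sin
        (IZR n * t)) (IZR n)); auto using per_cos, is_derive_cos_lin.
      * f_equal. f_equal. apply avg_ext; intros t; now rewrite HP1.
      * intros t. evar_last; [apply (is_derive_scal (fun t => sin (IZR n * t)) t (- IZR n)),
          is_derive_sin_lin|simpl; ring].
      * intros t. now rewrite (per_sin n t).
    + rewrite (mode_evolution rho u U P (fun t => sin (IZR n * t)) (fun t => IZR n * cos (IZR
        n * t)) (IZR n)); auto using per_sin, is_derive_sin_lin.
      * f_equal. f_equal. apply avg_ext; intros t; now rewrite HP1.
      * intros t. evar_last; [apply (is_derive_scal (fun t => cos (IZR n * t)) t (IZR n)),
          is_derive_cos_lin|simpl; ring].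
      * intros t. now rewrite (per_cos n t).
  - set (Q := fun r t => r * (Uy r t * cos t - Ux r t * sin t)).
    assert (CQ : cts2 Q) by (unfold Q; cts).
    assert (HI : forall t, U 1 t - U 1 0 = RInt (Q 1) 0 t).
    { intros t. apply (eq_at_ends (fun r => U r t - U r 0) (fun r => RInt (Q r) 0 t) 1 rho
        Hrho); [cts|cts| |lra].
      intros r Hr. symmetry.
      assert (EUr : forall t, U r t = polar u r t) by (intros; apply HE; lra).
      rewrite !EUr. apply RInt_primitive; [|cts].
      intros x. pose proof (proj1 (proj2 (harmonic_polar rho u r x Hr Hu))) as H.
      evar_last; [exact H|]. unfold angular, Q. now rewrite HD1, HD2. }
    intros t. apply (is_derive_ext (fun t => U 1 0 + RInt (Q 1) 0 t)).
    + intros s; rewrite <- HI. apply Rplus_minus.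
    + evar_last; [apply @is_derive_plus; [apply is_derive_const|apply is_derive_primitive;
        cts]|].
      unfold plus, zero, Q; simpl; ring.
Qed.

Lemma cis_eq_diff a b : cis a = cis b -> exists k : Z, a - b = IZR k * (2 * PI).
Proof.
  unfold cis; intros H; injection H as Hc Hs.
  assert (H1 : sin ((a - b) / 2) = 0).
  { assert (Hcos : cos (a - b) = 1).
    { rewrite cos_minus, Hc, Hs. pose proof (sin2_cos2 b) as E; unfold Rsqr in E; lra. }
    replace (a - b) with (2 * ((a - b) / 2)) in Hcos by field.
    rewrite cos_2a_sin in Hcos. nra. }
  destruct (sin_eq_0_0 _ H1) as [k Hk]. exists k. lra.
Qed.

Lemma cis_2PI a : cis (a + 2 * PI) = cis a.
Proof. unfold cis. now destruct (cos_sin_per a) as [-> ->]. Qed.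

(** The increment of the lift over a period is 2 pi k with k >= 1; for k >= 2
    the value phi t + 2 pi would be attained inside the period, contradicting
    injectivity on the circle. *)
Lemma lift_period (h : C -> C) (phi : R -> R) :
  (forall s t, h (cis s) = h (cis t) -> cis s = cis t) ->
  (forall t, continuous phi t) -> (forall s t, s < t -> phi s < phi t) ->
  (forall t, h (cis t) = cis (phi t)) ->
  forall t, phi (t + 2 * PI) = phi t + 2 * PI.
Proof.
  intros Hinj Hc Hm Hh t. pose proof PI_RGT_0 as HPI.
  assert (H1 : cis (phi (t + 2 * PI)) = cis (phi t)) by (rewrite <- !Hh, cis_2PI; reflexivity).
  destruct (cis_eq_diff _ _ H1) as [k Hk].
  pose proof (Hm t (t + 2 * PI) ltac:(lra)) as Hlt.
  assert (Hk0 : (0 < k)%Z).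
  { apply lt_IZR. apply Rmult_lt_reg_r with (2 * PI); lra. }
  destruct (Z.eq_dec k 1) as [-> | Hk1]; [lra|exfalso].
  assert (Hk2 : 2 <= IZR k) by (apply IZR_le; lia).
  destruct (IVT_gen phi t (t + 2 * PI) (phi t + 2 * PI)) as [s [Hs Es]].
  { intros x; apply continuity_pt_filterlim, Hc. }
  { rewrite Rmin_left, Rmax_right by lra. nra. }
  rewrite Rmin_left, Rmax_right in Hs by lra.
  assert (Hcs : cis s = cis t) by (apply Hinj; rewrite !Hh, Es; apply cis_2PI).
  destruct (cis_eq_diff _ _ Hcs) as [m Hm'].
  assert (Hs1 : s <> t) by (intros ->; lra).
  assert (Hs2 : s <> t + 2 * PI) by (intros ->; nra).
  assert (Hm0 : (0 < m)%Z) by (apply lt_IZR, Rmult_lt_reg_r with (2 * PI); lra).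
  assert (Hm1 : (m < 1)%Z) by (apply lt_IZR, Rmult_lt_reg_r with (2 * PI); lra).
  lia.
Qed.

(** Near t, the increment of phi is the arcsine of sin (phi x - phi t), which
    is a combination of cos phi and sin phi. *)
Lemma lift_derive (phi : R -> R) (c s : R -> R) t : continuous phi t ->
  is_derive (fun x => cos (phi x)) t (c t) -> is_derive (fun x => sin (phi x)) t (s t) ->
  is_derive phi t (cos (phi t) * s t - sin (phi t) * c t).
Proof.
  intros Hc D1 D2. pose proof PI_RGT_0 as HPI.
  apply (is_derive_ext_loc (fun x => phi t + asin (sin (phi x) * cos (phi t) - cos (phi x)
    * sin (phi t)))).
  - assert (HL : locally t (fun x => Rabs (phi x - phi t) < PI / 2)).
    { apply (Hc (fun y => Rabs (y - phi t) < PI / 2)).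
      exists (mkposreal (PI / 2) ltac:(lra)); intros y Hy; exact Hy. }
    revert HL; apply filter_imp; intros x Hx. apply Rabs_def2 in Hx.
    rewrite <- sin_minus, asin_sin by lra. apply Rplus_minus.
  - set (f := fun x => sin (phi x) * cos (phi t) - cos (phi x) * sin (phi t)).
    assert (Df : is_derive f t (cos (phi t) * s t - sin (phi t) * c t)).
    { unfold f. evar_last.
      - apply @is_derive_minus; apply is_derive_Rmult; [exact D2|apply is_derive_const|exact
          D1|apply is_derive_const].
      - unfold minus, plus, opp, zero; simpl; ring. }
    assert (Hf0 : f t = 0) by (unfold f; ring).
    assert (Da : is_derive asin (f t) 1).
    { apply is_derive_Reals. rewrite Hf0.
      assert (H0 : -1 < 0 < 1) by lra.
      replace 1 with (derive_pt asin 0 (derivable_pt_asin 0 H0)) at 1.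
      - apply derive_pt_eq_1 with (derivable_pt_asin 0 H0). reflexivity.
      - rewrite derive_pt_asin. replace (1 - 0²) with 1 by (unfold Rsqr; ring).
        rewrite sqrt_1; field. }
    evar_last.
    + apply @is_derive_plus; [apply is_derive_const|]. apply (is_derive_comp asin f t 1 _ Da
        Df).
    + unfold plus, zero, scal; simpl; unfold mult; simpl; ring.
Qed.

Lemma derive_of_increasing (f : R -> R) t l :
  (forall a b, a < b -> f a < f b) -> is_derive f t l -> 0 <= l.
Proof.
  intros Hm Hd. apply Rnot_lt_le; intros Hl.
  apply is_derive_Reals in Hd. destruct (Hd (- l) ltac:(lra)) as [d Hd'].
  specialize (Hd' (d / 2)). pose proof (cond_pos d).
  assert (H1 : Rabs ((f (t + d / 2) - f t) / (d / 2) - l) < - l).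
  { apply Hd'; [lra|]. rewrite Rabs_pos_eq; lra. }
  apply Rabs_def2 in H1. pose proof (Hm t (t + d / 2) ltac:(lra)).
  assert (0 < (f (t + d / 2) - f t) / (d / 2)) by (apply Rdiv_lt_0_compat; lra). lra.
Qed.

Lemma Cmod_cis t : Cmod (cis t) = 1.
Proof.
  unfold cis; rewrite <- (Rmult_1_l (cos t)), <- (Rmult_1_l (sin t)). apply Cmod_polar; lra.
Qed.

(** The left-hand sides are directional derivatives in orthonormal directions;
    in terms of h_z and h_zbar they are sums of two terms with moduli |h_z| and
    |h_zbar|. *)
Lemma wirtinger_bounds (hx hy : C -> C) z t :
  Cmod (hx z * cos t + hy z * sin t)%C <= opnorm hx hy z /\
  Cmod (hy z * cos t - hx z * sin t)%C <= opnorm hx hy z.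
Proof.
  pose proof (sin2_cos2 t) as E; unfold Rsqr in E.
  unfold opnorm; split.
  - replace (hx z * cos t + hy z * sin t)%C
      with (cis t * wirtinger_z hx hy z + cis (- t) * wirtinger_zbar hx hy z)%C.
    + eapply Rle_trans; [apply Cmod_triangle|]. rewrite !Cmod_mult, !Cmod_cis. lra.
    + unfold wirtinger_z, wirtinger_zbar, cis. rewrite cos_neg, sin_neg.
      destruct (hx z) as [a b], (hy z) as [c d].
      apply injective_projections; simpl; field.
  - replace (hy z * cos t - hx z * sin t)%C
      with (Ci * cis t * wirtinger_z hx hy z + - (Ci * cis (- t)) * wirtinger_zbar hx hy z)%C.
    + eapply Rle_trans; [apply Cmod_triangle|].
      rewrite !Cmod_mult, Cmod_opp, !Cmod_mult, !Cmod_cis, Cmod_Ci. lra.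
    + unfold wirtinger_z, wirtinger_zbar, cis. rewrite cos_neg, sin_neg.
      destruct (hx z) as [a b], (hy z) as [c d].
      apply injective_projections; simpl; field.
Qed.

Lemma Cmod_sq z : Cmod z ^ 2 = dot z z.
Proof.
  unfold Cmod, dot; rewrite pow2_sqrt; [unfold Re, Im; ring|].
  pose proof (pow2_ge_0 (fst z)); pose proof (pow2_ge_0 (snd z)); lra.
Qed.

Lemma jacobian_det hx hy z : jacobian hx hy z = Re (hx z) * Im (hy z) - Im (hx z) * Re (hy z).
Proof.
  unfold jacobian; rewrite !Cmod_sq. unfold wirtinger_z, wirtinger_zbar, dot.
  destruct (hx z) as [a b], (hy z) as [c d]. simpl. field.
Qed.

(** Write N for the normal derivative.  The Jacobian is v Re (conj h * N) and
    v is at most the operator norm, so v^2 <= K v Re (conj h * N); divide by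
    v.  Where v = 0 the distortion condition forces the whole differential to
    vanish. *)
Lemma normal_derivative_bound (hx hy : C -> C) z t K p v : 1 <= K -> 0 <= v ->
  opnorm hx hy z ^ 2 <= K * jacobian hx hy z ->
  (hy z * cos t - hx z * sin t)%C = (v * (Ci * cis p))%C ->
  v / K <= dot (cis p) (hx z * cos t + hy z * sin t)%C.
Proof.
  intros HK Hv HJ HT.
  destruct (wirtinger_bounds hx hy z t) as [B1 B2].
  set (N := (hx z * cos t + hy z * sin t)%C) in *.
  assert (EJ : jacobian hx hy z = v * dot (cis p) N).
  { rewrite jacobian_det.
    assert (E : Re N * Im (hy z * cos t - hx z * sin t)%C - Im N * Re (hy z * cos t - hx z
      * sin t)%C
             = Re (hx z) * Im (hy z) - Im (hx z) * Re (hy z)).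
    { unfold N. destruct (hx z) as [a b], (hy z) as [c d]. simpl.
      pose proof (sin2_cos2 t) as E; unfold Rsqr in E.
      transitivity ((a * d - b * c) * (sin t * sin t + cos t * cos t)); [ring|rewrite E;
        ring]. }
    rewrite <- E, HT. unfold dot, cis; simpl. ring. }
  assert (Hp0 : 0 <= opnorm hx hy z) by (eapply Rle_trans; [apply Cmod_ge_0|exact B1]).
  assert (HTm : Cmod (hy z * cos t - hx z * sin t)%C ^ 2 = v ^ 2).
  { rewrite HT, Cmod_sq. unfold dot, cis; simpl.
    pose proof (sin2_cos2 p) as E; unfold Rsqr in E.
    transitivity (v ^ 2 * (sin p * sin p + cos p * cos p)); [ring|rewrite E; ring]. }
  assert (Hvv : v ^ 2 <= K * (v * dot (cis p) N)).
  { rewrite <- HTm, <- EJ. eapply Rle_trans; [|exact HJ].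
    apply pow_incr; split; [apply Cmod_ge_0|exact B2]. }
  destruct (Req_dec v 0) as [-> | Hv0].
  - rewrite Rmult_0_l in EJ. rewrite EJ, Rmult_0_r in HJ.
    assert (Hop : opnorm hx hy z = 0) by nra.
    rewrite Hop in B1.
    assert (HN : N = 0) by (apply Cmod_eq_0; pose proof (Cmod_ge_0 N); lra).
    rewrite HN. unfold dot; simpl. unfold Rdiv; rewrite Rmult_0_l; lra.
  - apply Rle_div_l; [lra|]. apply Rmult_le_reg_l with v; [lra|]. simpl in Hvv. nra.
Qed.

(** What the argument retains of an admissible map: its values F on circles,
    its normal derivative W and the lift phi, with derivative v, on the unit
    circle. *)
Definition boundary_data (rho K : R) (h : C -> C) (F : R -> R -> C) (W : R -> C)
    (phi v : R -> R) : Prop :=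
  (forall r t, 1 <= r <= rho -> F r t = h (r * cis t)%C) /\
  (forall r, ccts (F r)) /\ (forall r, cper (F r)) /\ ccts W /\ cper W /\
  (forall (n : Z) r, 1 <= r <= rho ->
     coef (F r) n = (ch (IZR n) r * coef (F 1) n + sh (IZR n) r * coef W n)%C) /\
  (forall t, F 1 t = cis (phi t)) /\
  (forall s t, s < t -> phi s < phi t) /\ (forall t, phi (t + 2 * PI) = phi t + 2 * PI) /\
  (forall t, is_derive phi t (v t)) /\ cts v /\ (forall t, 0 <= v t) /\
  (forall t, v t / K <= dot (F 1 t) (W t)).

Lemma admissible_boundary_data rho K h : 1 < rho -> 1 <= K -> admissible rho K h ->
  exists F W phi v, boundary_data rho K h F W phi v.
Proof.
  intros Hrho HK [[HhR HhI] [[_ [_ [g [_ [_ [Hg _]]]]]] [[phi [Hpc [Hpm Hph]]] [hx [hy [[Ch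
    [Chx [Chy Hd]]] HJ]]]]]].
  set (F := at_polar rho h).
  set (Fx := at_polar rho hx). set (Fy := at_polar rho hy).
  destruct (cts2_at_polar rho h Hrho Ch) as [cF1 cF2].
  destruct (cts2_at_polar rho hx Hrho Chx) as [cX1 cX2].
  destruct (cts2_at_polar rho hy Hrho Chy) as [cY1 cY2].
  fold F in cF1, cF2. fold Fx in cX1, cX2. fold Fy in cY1, cY2.
  assert (Hpt : forall (f : C -> C) r t, 1 <= r <= rho -> at_polar rho f r t = f (r * cos t,
    r * sin t)).
  { intros f r t Hr; unfold at_polar; now rewrite clamp_id. }
  destruct (component_facts rho (fun x y => Re (h (x, y))) (fun x y => Re (hx (x,
    y))) (fun x y => Re (hy (x, y)))
     (fun r t => Re (F r t)) (fun r t => Re (Fx r t)) (fun r t => Re (Fy r t))) as [ER DR];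
       auto.
  { intros x y Hxy; destruct (Hd x y Hxy) as [A B]; split; [exact (is_derive_Re _ _ _ A)|exact
      (is_derive_Re _ _ _ B)]. }
  { intros r t Hr; unfold F, Fx, Fy, polar; rewrite !Hpt by assumption; auto. }
  destruct (component_facts rho (fun x y => Im (h (x, y))) (fun x y => Im (hx (x,
    y))) (fun x y => Im (hy (x, y)))
     (fun r t => Im (F r t)) (fun r t => Im (Fx r t)) (fun r t => Im (Fy r t))) as [EI DI];
       auto.
  { intros x y Hxy; destruct (Hd x y Hxy) as [A B]; split; [exact (is_derive_Im _ _ _ A)|exact
      (is_derive_Im _ _ _ B)]. }
  { intros r t Hr; unfold F, Fx, Fy, polar; rewrite !Hpt by assumption; auto. }
  set (W := fun t => (Fx 1 t * cos t + Fy 1 t * sin t)%C).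
  set (T := fun t => (Fy 1 t * cos t - Fx 1 t * sin t)%C).
  assert (HF1 : forall t, F 1 t = cis (phi t)).
  { intros t; unfold F; rewrite Hpt by lra. rewrite !Rmult_1_l. apply Hph. }
  assert (DRe : forall t, is_derive (fun x => cos (phi x)) t (Re (T t))).
  { intros t. apply (is_derive_ext (fun t => Re (F 1 t))); [intros s; now rewrite HF1|].
    evar_last; [exact (DR t)|]. unfold T, Re; simpl; ring. }
  assert (DIm : forall t, is_derive (fun x => sin (phi x)) t (Im (T t))).
  { intros t. apply (is_derive_ext (fun t => Im (F 1 t))); [intros s; now rewrite HF1|].
    evar_last; [exact (DI t)|]. unfold T, Im; simpl; ring. }
  set (v := fun t => cos (phi t) * Im (T t) - sin (phi t) * Re (T t)).
  assert (Dphi : forall t, is_derive phi t (v t)).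
  { intros t; apply lift_derive with (c := fun t => Re (T t)) (s := fun t => Im (T t)); auto. }
  assert (Hv0 : forall t, 0 <= v t) by (intros t; now apply (derive_of_increasing phi t)).
  assert (CT : cts (fun t => Re (T t)) /\ cts (fun t => Im (T t))).
  { split.
    - apply (cts_ext (fun t => Re (Fy 1 t) * cos t - Re (Fx 1 t) * sin t)).
      + intros t; unfold T, Re; simpl; ring.
      + apply cts_minus; apply cts_mult; auto with cts.
        * apply (cts2_section _ 1 cY1).
        * apply (cts2_section _ 1 cX1).
    - apply (cts_ext (fun t => Im (Fy 1 t) * cos t - Im (Fx 1 t) * sin t)).
      + intros t; unfold T, Im; simpl; ring.
      + apply cts_minus; apply cts_mult; auto with cts.
        * apply (cts2_section _ 1 cY2).
        * apply (cts2_section _ 1 cX2). }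
  assert (HT : forall t, T t = (v t * (Ci * cis (phi t)))%C).
  { intros t.
    assert (E1 : Re (T t) = - sin (phi t) * v t).
    { rewrite <- (is_derive_unique _ _ _ (DRe t)). apply is_derive_unique.
      evar_last; [apply (is_derive_comp cos phi t _ _ (is_derive_cos _) (Dphi t))|].
      unfold scal; simpl; unfold mult; simpl; ring. }
    assert (E2 : Im (T t) = cos (phi t) * v t).
    { rewrite <- (is_derive_unique _ _ _ (DIm t)). apply is_derive_unique.
      evar_last; [apply (is_derive_comp sin phi t _ _ (is_derive_sin _) (Dphi t))|].
      unfold scal; simpl; unfold mult; simpl; ring. }
    apply injective_projections.
    - change (fst (T t)) with (Re (T t)); rewrite E1; unfold cis; simpl; ring.
    - change (snd (T t)) with (Im (T t)); rewrite E2; unfold cis; simpl; ring. }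
  assert (ReW : forall t, Re (W t) = Re (Fx 1 t) * cos t + Re (Fy 1 t) * sin t)
    by (intros; unfold W, Re; simpl; ring).
  assert (ImW : forall t, Im (W t) = Im (Fx 1 t) * cos t + Im (Fy 1 t) * sin t)
    by (intros; unfold W, Im; simpl; ring).
  exists F, W, phi, v; unfold boundary_data.
  repeat match goal with |- _ /\ _ => split end; auto.
  - intros r t Hr; unfold F; rewrite Hpt by assumption. f_equal.
    unfold cis; apply injective_projections; simpl; ring.
  - intros r; split; [apply (cts2_section _ r cF1)|apply (cts2_section _ r cF2)].
  - intros r; apply at_polar_per.
  - split.
    + apply (cts_ext _ _ (fun t => eq_sym (ReW t))).
      apply cts_plus; apply cts_mult; auto with cts; [apply (cts2_section _ 1 cX1)|apply
        (cts2_section _ 1 cY1)].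
    + apply (cts_ext _ _ (fun t => eq_sym (ImW t))).
      apply cts_plus; apply cts_mult; auto with cts; [apply (cts2_section _ 1 cX2)|apply
        (cts2_section _ 1 cY2)].
  - intros t; unfold W, Fx, Fy. rewrite !(at_polar_per rho _ 1 t).
    now destruct (cos_sin_per t) as [-> ->].
  - intros n r Hr. destruct (ER n r Hr) as [A1 A2]. destruct (EI n r Hr) as [A3 A4].
    assert (B1 : ca (fun t => Re (W t)) (IZR n) = ca (fun t => Re (Fx 1 t) * cos t + Re (Fy 1
      t) * sin t) (IZR n))
      by (apply avg_ext; intros; now rewrite ReW).
    assert (B2 : sa (fun t => Re (W t)) (IZR n) = sa (fun t => Re (Fx 1 t) * cos t + Re (Fy 1
      t) * sin t) (IZR n))
      by (apply avg_ext; intros; now rewrite ReW).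
    assert (B3 : ca (fun t => Im (W t)) (IZR n) = ca (fun t => Im (Fx 1 t) * cos t + Im (Fy 1
      t) * sin t) (IZR n))
      by (apply avg_ext; intros; now rewrite ImW).
    assert (B4 : sa (fun t => Im (W t)) (IZR n) = sa (fun t => Im (Fx 1 t) * cos t + Im (Fy 1
      t) * sin t) (IZR n))
      by (apply avg_ext; intros; now rewrite ImW).
    unfold coef. rewrite A1, A2, A3, A4, B1, B2, B3, B4.
    apply injective_projections; simpl; ring.
  - intros t. apply lift_period with (h := h); auto.
    intros a b Hab. rewrite <- (Hg (cis a)), <- (Hg (cis b)), Hab; auto;
      apply Cmod_cis.
  - assert (Cp : cts phi) by exact Hpc. destruct CT.
    unfold v; cts.
  - intros t. rewrite HF1. unfold W, Fx, Fy. rewrite !Hpt by lra. rewrite !Rmult_1_l.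
    apply normal_derivative_bound; auto.
    + apply HJ, (Cmod_cis t).
    + rewrite <- HT. unfold T, Fx, Fy. rewrite !Hpt by lra. now rewrite !Rmult_1_l.
Qed.

(** * The lower bound and its equality case *)

Lemma sin_below_tangent m x : 0 <= m <= PI -> 0 <= x <= PI ->
  sin m <= sin x + cos x * (m - x).
Proof.
  intros Hm Hx.
  destruct (total_order_T m x) as [[H | ->] | H]; [| lra |].
  - destruct (MVT_cor2 sin cos m x H) as [c [Hc Hc']].
    { intros; apply derivable_pt_lim_sin. }
    assert (cos x <= cos c) by (apply cos_decr_1; lra). nra.
  - destruct (MVT_cor2 sin cos x m H) as [c [Hc Hc']].
    { intros; apply derivable_pt_lim_sin. }
    assert (cos c <= cos x) by (apply cos_decr_1; lra). nra.
Qed.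

Lemma sin_plus_le a b : 0 <= a + b <= 2 * PI -> sin a + sin b <= 2 * sin ((a + b) / 2).
Proof.
  intros H.
  assert (E : sin a + sin b = 2 * (sin ((a + b) / 2) * cos ((a - b) / 2))).
  { transitivity (sin ((a + b) / 2 + (a - b) / 2) + sin ((a + b) / 2 - (a - b) / 2)).
    - f_equal; f_equal; field.
    - rewrite sin_plus, sin_minus; ring. }
  rewrite E. pose proof (COS_bound ((a - b) / 2)).
  assert (0 <= sin ((a + b) / 2)) by (apply sin_ge_0; lra). nra.
Qed.

(** The increments theta(t) = phi(t + x) - phi(t) have mean x, but sin is not
    concave on [0, 2 pi].  For x <= pi the arcs from t and from t + pi are
    disjoint, so (theta(t) + theta(t + pi)) / 2 lies in [0, pi], where sin is
    concave and lies below its tangent at x. *)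
Lemma avg_sin_increment (phi : R -> R) x : cts phi ->
  (forall s t, s < t -> phi s < phi t) -> (forall t, phi (t + 2 * PI) = phi t + 2 * PI) ->
  0 <= x <= PI -> avg (fun t => sin (phi (t + x) - phi t)) <= sin x.
Proof.
  intros Hc Hm Hp Hx. pose proof PI_RGT_0 as HPI.
  assert (Hle : forall s t, s <= t -> phi s <= phi t).
  { intros s t [H | ->]; [left; auto|lra]. }
  set (th := fun t => phi (t + x) - phi t).
  assert (Cth : cts th) by (unfold th; cts).
  assert (Pth : per th).
  { intros t; unfold th. replace (t + 2 * PI + x) with (t + x + 2 * PI) by ring. rewrite !Hp;
      ring. }
  assert (Hth : avg th = x).
  { pose proof (avg_shift (fun t => phi t - t) x ltac:(cts)) as H.
    rewrite (avg_ext th (fun t => x + ((phi (t + x) - (t + x)) - (phi t - t)))) by (intros;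
      unfold th; ring).
    rewrite avg_plus, avg_const, avg_minus, H by (cts || (intros t; rewrite Hp; ring)). ring. }
  assert (HS : avg (fun t => sin (th t)) = avg (fun t => / 2 * (sin (th t) + sin (th (t
    + PI))))).
  { rewrite avg_scal, avg_plus by cts.
    rewrite (avg_shift (fun t => sin (th t)) PI); [field|cts|].
    intros t; now rewrite Pth. }
  fold th in HS |- *. change (avg (fun t => sin (th t)) <= sin x). rewrite HS.
  apply Rle_trans with (avg (fun t => sin x + cos x * (/ 2 * (th t + th (t + PI)) - x))).
  - apply avg_le; [cts|cts|]. intros t _.
    assert (H0 : 0 <= th t + th (t + PI) <= 2 * PI).
    { unfold th. pose proof (Hle t (t + x)). pose proof (Hle (t + PI) (t + PI + x)).
      pose proof (Hle (t + x) (t + PI)). pose proof (Hle (t + PI + x) (t + 2 * PI)).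
      rewrite Hp in *. lra. }
    pose proof (sin_plus_le _ _ H0).
    pose proof (sin_below_tangent ((th t + th (t + PI)) / 2) x ltac:(lra) Hx). lra.
  - rewrite avg_plus, avg_const, avg_scal, avg_minus, avg_const, avg_scal, avg_plus by cts.
    rewrite (avg_shift th PI Cth Pth), Hth. lra.
Qed.

Lemma dot_RtoC_l a z w : dot (RtoC a * z) w = a * dot z w.
Proof. unfold dot; simpl; unfold Re, Im; ring. Qed.
Lemma dot_RtoC_r a z w : dot z (RtoC a * w) = a * dot z w.
Proof. unfold dot; simpl; unfold Re, Im; ring. Qed.
Lemma dot_cis t : dot (cis t) (cis t) = 1.
Proof. unfold dot, cis; simpl. pose proof (sin2_cos2 t) as E; unfold Rsqr in E; lra. Qed.
Lemma dot_ge_0 z : 0 <= dot z z.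
Proof. unfold dot; nra. Qed.
Lemma dot_eq_0 z : dot z z = 0 -> z = RtoC 0.
Proof.
  unfold dot; intros H. destruct z as [a b]; simpl in H.
  assert (a = 0) by nra. assert (b = 0) by nra. subst; reflexivity.
Qed.

Lemma zsum_const_tail (a : Z -> R) N : (1 <= N)%nat -> (forall n, n <> 1%Z -> a n = 0) ->
  zsum a N = a 1%Z.
Proof.
  intros HN Ha; induction HN as [|N HN IH].
  - cbn [zsum]. rewrite (Ha 0%Z), (Ha (- Z.of_nat 1)%Z) by lia.
    change (Z.of_nat 1) with 1%Z. ring.
  - cbn [zsum]. rewrite IH, (Ha (Z.of_nat (S N))), (Ha (- Z.of_nat (S N))%Z) by lia. ring.
Qed.

(** The value of c_n(rho) at which the completed square vanishes. *)
Definition mode_optimum (rho K : R) (p : Z -> C) (n : Z) : C :=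
  (RtoC (sh1 rho * (1 + weight rho K * IZR n) / sh (IZR n) rho) * p n)%C.
(** What the n-th mode contributes beyond the combination of moments: the
    completed square, and the gap of [mode_gap]. *)
Definition mode_slack (rho K : R) (p c : Z -> C) (n : Z) : R :=
  dot (c n - mode_optimum rho K p n)%C (c n - mode_optimum rho K p n)%C
  + (mode_value rho K (IZR n) (mode_coth rho (IZR n)) - mode_target rho K (IZR n)) * dot (p n)
      (p n).

Lemma mode_decomposition rho K (p q c : Z -> C) n : 1 < rho -> 1 <= K ->
  c n = (ch (IZR n) rho * p n + sh (IZR n) rho * q n)%C ->
  dot (c n) (c n) = mode_slack rho K p c n
    + mode_target rho K (IZR n) * dot (p n) (p n)
    + 2 * sh1 rho * (1 + weight rho K * IZR n)
        * (dot (p n) (q n) - IZR n * dot (p n) (p n) / K).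
Proof.
  intros Hr HK Hc. unfold mode_slack, mode_optimum. rewrite Hc.
  pose proof (sh_pos (IZR n) rho Hr) as Hs. pose proof (ch_sh_sq (IZR n) rho) as Hq.
  unfold mode_value, mode_coth.
  set (s := sh (IZR n) rho) in *. set (k := ch (IZR n) rho) in *. set (m := IZR n) in *.
  set (T := mode_target rho K m). set (M := 1 + weight rho K * m). set (S := sh1 rho).
  replace ((S * k / s) ^ 2 - m ^ 2 * S ^ 2) with (S ^ 2 / s ^ 2).
  2: { transitivity (S ^ 2 / s ^ 2 * (k ^ 2 - m ^ 2 * s ^ 2)); [rewrite Hq; ring|field; lra]. }
  unfold tilt; fold S. destruct (p n) as [p1 p2], (q n) as [q1 q2].
  unfold dot; simpl. field. lra.
Qed.

Lemma mode_gap_one rho K : 1 < rho ->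
  mode_value rho K 1 (mode_coth rho 1) = mode_target rho K 1.
Proof.
  intros Hr. assert (E : mode_coth rho 1 = ch1 rho).
  { unfold mode_coth, ch, sh. destruct (Req_EM_T 1 0); [lra|].
    rewrite Rmult_1_l, <- sh1_eq, <- ch1_eq by lra. pose proof (sh1_pos rho Hr); field; lra. }
  assert (Hq : ch1 rho ^ 2 - sh1 rho ^ 2 = 1) by (unfold ch1, sh1; field; lra).
  rewrite E; unfold mode_value, mode_target. rewrite Rabs_R1.
  replace (ch1 rho ^ 2 - 1 ^ 2 * sh1 rho ^ 2) with (ch1 rho ^ 2 - sh1 rho ^ 2) by ring.
  rewrite Hq. unfold weight. ring.
Qed.

Lemma mode_slack_ge_0 rho K p c n : 1 < rho -> 1 <= K -> 0 <= mode_slack rho K p c n.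
Proof.
  intros Hr HK; unfold mode_slack. apply Rplus_le_le_0_compat; [apply dot_ge_0|].
  apply Rmult_le_pos; [|apply dot_ge_0].
  destruct (Z.eq_dec n 1) as [-> | Hn]; [rewrite mode_gap_one by auto; lra|].
  pose proof (mode_gap rho K n Hr HK Hn); lra.
Qed.

(** Sum [mode_decomposition] over |n| <= N and let N tend to infinity: the
    moment terms tend to (1 + y)^2 or more, and the coupling terms tend to
    twice sinh (ln rho) times the average of (1 + y v) (Re (conj h * N) - v / K),
    which is nonnegative.  The slack of finitely many modes may be kept, which is
    what the equality case needs. *)
Lemma slack_bound rho K h F W phi v : 1 < rho -> 1 <= K -> boundary_data rho K h F W phi v ->
  is_lim_seq (zsum (fun n => dot (coef (F 1) n) (coef (F 1) n))) 1 /\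
  forall N, zsum (mode_slack rho K (coef (F 1)) (coef (F rho))) N + (1 + weight rho K) ^ 2
    <= avg (fun t => dot (F rho t) (F rho t)).
Proof.
  intros Hr HK (HFh & CF & PF & CW & PW & Hev & HF1 & Hm & Hp & Dphi & Cv & Hv & Ha).
  set (p := coef (F 1)). set (q := coef W). set (c := coef (F rho)).
  assert (Cphi : cts phi) by exact (cts_derive _ _ Dphi).
  (* G is the tangential derivative of h divided by i. *)
  set (G := fun t => (v t * F 1 t)%C).
  assert (ReF : forall t, Re (F 1 t) = cos (phi t)) by (intros; now rewrite HF1).
  assert (ImF : forall t, Im (F 1 t) = sin (phi t)) by (intros; now rewrite HF1).
  assert (CG : ccts G).
  { split.
    - apply (cts_ext (fun t => v t * cos (phi t))); [|cts].
      intros t; unfold G; rewrite HF1; unfold cis; simpl; ring.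
    - apply (cts_ext (fun t => v t * sin (phi t))); [|cts].
      intros t; unfold G; rewrite HF1; unfold cis; simpl; ring. }
  assert (Pv : per v).
  { intros t. rewrite <- (is_derive_unique _ _ _ (Dphi t)). symmetry. apply is_derive_unique.
    apply (is_derive_ext (fun s => phi (s + 2 * PI) - 2 * PI)); [intros s; rewrite Hp;
      apply Rplus_minus_r|].
    evar_last.
    - apply @is_derive_minus; [|apply is_derive_const].
      apply (is_derive_comp phi (fun s => s + 2 * PI) t); [apply Dphi|].
      apply @is_derive_plus; [apply is_derive_id|apply is_derive_const].
    - unfold minus, plus, opp, zero, one, scal; simpl; unfold mult; simpl; ring. }
  assert (PG : cper G) by (intros t; unfold G; now rewrite (PF 1), Pv).
  assert (HG : forall n, coef G n = (RtoC (IZR n) * p n)%C).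
  { intros n.
    assert (E : coef (fun t => Ci * G t)%C n = (IZR n * (Ci * p n))%C).
    { apply coef_derive; auto with cts; intros t.
      - apply (is_derive_ext (fun t => cos (phi t))); [intros; now rewrite ReF|].
        evar_last; [apply (is_derive_comp cos phi t _ _ (is_derive_cos _) (Dphi t))|].
        unfold G, scal; rewrite HF1; unfold cis; simpl; unfold mult; simpl; ring.
      - apply (is_derive_ext (fun t => sin (phi t))); [intros; now rewrite ImF|].
        evar_last; [apply (is_derive_comp sin phi t _ _ (is_derive_sin _) (Dphi t))|].
        unfold G, scal; rewrite HF1; unfold cis; simpl; unfold mult; simpl; ring. }
    rewrite coef_Ci in E by auto.
    assert (E2 : (- Ci * (Ci * coef G n))%C = (- Ci * (IZR n * (Ci * p n)))%C)
      by now rewrite E.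
    transitivity (- Ci * (Ci * coef G n))%C; [|rewrite E2].
    - destruct (coef G n); apply injective_projections; simpl; ring.
    - destruct (p n); apply injective_projections; simpl; ring. }
  pose proof (parseval (F 1) (F 1) (CF 1) (CF 1) (PF 1) (PF 1)) as L0.
  pose proof (parseval (F 1) G (CF 1) CG (PF 1) PG) as L1.
  pose proof (parseval G G CG CG PG PG) as L2.
  pose proof (parseval (F 1) W (CF 1) CW (PF 1) PW) as L3.
  pose proof (parseval G W CG CW PG PW) as L4.
  fold p q in L0, L1, L2, L3, L4.
  rewrite (avg_ext _ (fun _ => 1)), avg_const in L0 by (intros; rewrite HF1; apply dot_cis).
  assert (Hav : avg v = 1).
  { unfold avg. rewrite (RInt_primitive phi v 0 (2 * PI) Dphi Cv).
    rewrite <- (Rplus_0_l (2 * PI)), Hp. pose proof two_pi_pos. field; lra. }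
  rewrite (avg_ext _ v), Hav in L1.
  2: { intros t; unfold G; rewrite dot_RtoC_r, HF1, dot_cis; ring. }
  set (E := avg (fun t => dot (G t) (G t))) in *.
  assert (HE : E = avg (fun t => v t * v t)).
  { apply avg_ext; intros t; unfold G; rewrite dot_RtoC_l, dot_RtoC_r, HF1, dot_cis; ring. }
  set (a := fun t => dot (F 1 t) (W t)) in *.
  assert (Ca : cts a) by (apply cts_dot; auto).
  rewrite (avg_ext _ (fun t => v t * a t)) in L4 by (intros; unfold G; now rewrite dot_RtoC_l).
  set (Z0 := zsum (fun n => dot (p n) (p n))) in *.
  set (Z1 := zsum (fun n => IZR n * dot (p n) (p n))) in *.
  set (Z2 := zsum (fun n => IZR n ^ 2 * dot (p n) (p n))) in *.
  set (Y0 := zsum (fun n => dot (p n) (q n))) in *.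
  set (Y1 := zsum (fun n => IZR n * dot (p n) (q n))) in *.
  set (ZA := zsum (fun n => IZR n * Rabs (IZR n) * dot (p n) (p n))).
  assert (L1' : is_lim_seq Z1 1).
  { revert L1; apply is_lim_seq_ext; intros N; apply zsum_ext; intros n _. now rewrite HG,
      dot_RtoC_r. }
  assert (L2' : is_lim_seq Z2 E).
  { revert L2; apply is_lim_seq_ext; intros N; apply zsum_ext; intros n _.
    rewrite HG, dot_RtoC_l, dot_RtoC_r; ring. }
  assert (L4' : is_lim_seq Y1 (avg (fun t => v t * a t))).
  { revert L4; apply is_lim_seq_ext; intros N; apply zsum_ext; intros n _. now rewrite HG,
      dot_RtoC_l. }
  assert (HA : forall N, (1 <= N)%nat -> 1 - 4 * (E - Z2 N) <= ZA N).
  { apply (abs_moment (fun n => dot (p n) (p n)) E (fun x => avg (fun t => sin (phi (t + x)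
      - phi t)))); auto.
    - intros; apply dot_ge_0.
    - intros x Hx. split; [now apply avg_sin_increment|].
      assert (CS : ccts (fun t => F 1 (t + x))).
      { destruct (CF 1) as [A B]; split; [exact (cts_shift _ x A)|exact (cts_shift _ x B)]. }
      assert (PS : cper (fun t => F 1 (t + x))).
      { intros t. replace (t + 2 * PI + x) with (t + x + 2 * PI) by ring. apply PF. }
      pose proof (parseval _ _ CS (ccts_Ci _ (CF 1)) PS ltac:(intros t;
        now rewrite (PF 1))) as L.
      rewrite (avg_ext _ (fun t => sin (phi (t + x) - phi t))) in L.
      + revert L; apply is_lim_seq_ext; intros N; apply zsum_ext; intros n _.
        rewrite coef_shift, coef_Ci by auto. fold (p n).
        unfold dot, cis; destruct (p n); simpl; ring.
      + intros t. rewrite !HF1, sin_minus. unfold dot, cis; simpl; ring. }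
  split; [exact L0|].
  set (y := weight rho K) in *. set (S := sh1 rho).
  set (l := lin_slope rho K). set (qs := quad_slope rho K).
  pose proof (weight_pos rho K Hr HK) as Hy. fold y in Hy.
  pose proof (sh1_pos rho Hr) as HS. fold S in HS.
  assert (Hqs : 0 <= qs).
  { unfold qs, quad_slope. pose proof (tilt_le rho K Hr HK). fold y S. fold S in H. apply
      Rmult_le_pos; lra. }
  set (X := mode_slack rho K p c).
  assert (HX : forall n, 0 <= X n) by (intros; now apply mode_slack_ge_0).
  (* A lower bound for the N-th partial sum of everything but the slack, in which
     each term converges. *)
  set (Y := fun N => ((1 + y) ^ 2 - l - qs) * Z0 N + l * Z1 N + qs * (1 - 4 * (E - Z2 N))
     + 2 * S * (Y0 N + y * Y1 N - / K * (Z1 N + y * Z2 N))).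
  assert (LY : is_lim_seq Y (((1 + y) ^ 2 - l - qs) * 1 + l * 1 + qs * (1 - 4 * (E - E))
     + 2 * S * (avg a + y * avg (fun t => v t * a t) - / K * (1 + y * E)))).
  { unfold Y.
    apply is_lim_seq_plus'; [apply is_lim_seq_plus'; [apply is_lim_seq_plus'|]|].
    - exact (is_lim_seq_scal_l _ _ _ L0).
    - exact (is_lim_seq_scal_l _ _ _ L1').
    - apply (is_lim_seq_scal_l _ qs (Finite (1 - 4 * (E - E)))).
      apply is_lim_seq_minus'; [apply is_lim_seq_const|].
      apply (is_lim_seq_scal_l _ 4 (Finite (E - E))).
      apply is_lim_seq_minus'; [apply is_lim_seq_const|exact L2'].
    - apply (is_lim_seq_scal_l _ (2 * S) (Finite (avg a + y * avg (fun t => v t * a t) - / K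
        * (1 + y * E)))).
      apply is_lim_seq_minus'.
      + apply is_lim_seq_plus'; [exact L3|exact (is_lim_seq_scal_l _ _ _ L4')].
      + apply (is_lim_seq_scal_l _ (/ K) (Finite (1 + y * E))).
        apply is_lim_seq_plus'; [exact L1'|exact (is_lim_seq_scal_l _ _ _ L2')]. }
  assert (Hpos : 0 <= avg a + y * avg (fun t => v t * a t) - / K * (1 + y * E)).
  { rewrite HE, <- Hav.
    replace (avg a + y * avg (fun t => v t * a t) - / K * (avg v + y * avg (fun t => v t * v
      t)))
      with (avg (fun t => a t + y * (v t * a t) - / K * (v t + y * (v t * v t)))).
    - apply avg_ge_0; [cts|]. intros t _.
      (* The pointwise form of the distortion condition, tested against 1 + y v. *)
      replace (a t + y * (v t * a t) - / K * (v t + y * (v t * v t))) with ((1 + y * v t) * (a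
        t - v t / K))
        by (unfold Rdiv; ring).
      apply Rmult_le_pos; [pose proof (Rmult_le_pos _ _ (Rlt_le _ _ Hy) (Hv t)); lra|].
      pose proof (Ha t). unfold a; lra.
    - rewrite avg_minus, avg_plus, !avg_scal, avg_plus, avg_scal by cts. reflexivity. }
  intros N0.
  set (U := avg (fun t => dot (F rho t) (F rho t))).
  assert (HL : Rbar_le (((1 + y) ^ 2 - l - qs) * 1 + l * 1 + qs * (1 - 4 * (E - E))
     + 2 * S * (avg a + y * avg (fun t => v t * a t) - / K * (1 + y * E))) (U - zsum X N0)).
  { apply (is_lim_seq_le_loc Y (fun _ => U - zsum X N0)); [|exact LY|apply is_lim_seq_const].
    exists (Nat.max 1 N0); intros N HN.
    pose proof (bessel (F rho) N (CF rho) (PF rho)) as HB. fold c U in HB.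
    rewrite (zsum_ext _ (fun n => X n + (((1 + y) ^ 2 - l - qs) * dot (p n) (p n)
       + l * (IZR n * dot (p n) (p n)) + qs * (IZR n * Rabs (IZR n) * dot (p n) (p n))
       + 2 * S * (dot (p n) (q n) + y * (IZR n * dot (p n) (q n))
           - / K * (IZR n * dot (p n) (p n) + y * (IZR n ^ 2 * dot (p n) (p n))))))) in HB.
    2: { intros n _. rewrite (mode_decomposition rho K p q c n Hr HK) by (apply Hev; lra).
         fold X y S. unfold mode_target; fold y l qs. field. lra. }
    repeat first [rewrite zsum_plus in HB | rewrite zsum_minus in HB |
      rewrite zsum_scal in HB].
    change (zsum (fun n => X n) N) with (zsum X N) in HB. fold Z0 Z1 Z2 Y0 Y1 in HB.
    change (zsum (fun n => dot (p n) (p n)) N) with (Z0 N) in HB.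
    change (zsum (fun n => IZR n * dot (p n) (p n)) N) with (Z1 N) in HB.
    change (zsum (fun n => IZR n ^ 2 * dot (p n) (p n)) N) with (Z2 N) in HB.
    change (zsum (fun n => dot (p n) (q n)) N) with (Y0 N) in HB.
    change (zsum (fun n => IZR n * dot (p n) (q n)) N) with (Y1 N) in HB.
    change (zsum (fun n => IZR n * Rabs (IZR n) * dot (p n) (p n)) N) with (ZA N) in HB.
    pose proof (zsum_mono X N0 N HX ltac:(lia)). pose proof (HA N ltac:(lia)).
    assert (qs * (1 - 4 * (E - Z2 N)) <= qs * ZA N) by (apply Rmult_le_compat_l; auto).
    unfold Y; lra. }
  simpl in HL. pose proof (Rmult_le_pos (2 * S) _ ltac:(lra) Hpos).
  replace (E - E) with 0 in HL by ring. lra.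
Qed.

Lemma unit_polar x y : x ^ 2 + y ^ 2 = 1 -> exists t, cos t = x /\ sin t = y.
Proof.
  intros H. assert (Hx : -1 <= x <= 1) by nra.
  assert (Hs : sin (acos x) = Rabs y).
  { rewrite sin_acos by exact Hx. replace (1 - x²) with (y²) by (unfold Rsqr;
      lra). apply sqrt_Rsqr_abs. }
  destruct (Rle_dec 0 y).
  - exists (acos x). rewrite cos_acos, Hs by exact Hx. split;
      [reflexivity|now apply Rabs_pos_eq].
  - exists (- acos x). rewrite cos_neg, sin_neg, cos_acos, Hs by exact Hx.
    split; [reflexivity|rewrite Rabs_left; lra].
Qed.

Lemma polar_form z : 0 < Cmod z -> exists t, z = (Cmod z * cis t)%C.
Proof.
  intros Hz. destruct z as [x y].
  destruct (unit_polar (x / Cmod (x, y)) (y / Cmod (x, y))) as [t [Hc Hs]].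
  - pose proof (Cmod_sq (x, y)) as E; unfold dot in E; simpl Re in E; simpl Im in E.
    transitivity ((x * x + y * y) / Cmod (x, y) ^ 2); [field; lra|]. rewrite <- E; field; lra.
  - exists t. unfold cis; rewrite Hc, Hs. apply injective_projections; simpl; field; lra.
Qed.

Lemma extremal_polar K r t : 0 < r -> 1 <= K ->
  extremal K (r * cis t)%C = (RtoC ((K + 1) / (2 * K) * r + (K - 1) / (2 * K) * / r) * cis
    t)%C.
Proof.
  intros Hr HK. pose proof (sin2_cos2 t) as E; unfold Rsqr in E.
  unfold extremal.
  assert (EI : (/ Cconj (r * cis t))%C = (RtoC (/ r) * cis t)%C).
  { apply injective_projections; unfold cis; simpl.
    - replace ((r * cos t - 0 * sin t) * ((r * cos t - 0 * sin t) * 1) +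
        - (r * sin t + 0 * cos t) * (- (r * sin t + 0 * cos t) * 1)) with (r * r * (sin t
            * sin t + cos t * cos t)) by ring.
      rewrite E. field; lra.
    - replace ((r * cos t - 0 * sin t) * ((r * cos t - 0 * sin t) * 1) +
        - (r * sin t + 0 * cos t) * (- (r * sin t + 0 * cos t) * 1)) with (r * r * (sin t
            * sin t + cos t * cos t)) by ring.
      rewrite E. field; lra. }
  rewrite EI. unfold cis; apply injective_projections; simpl; ring.
Qed.

(** By Parseval the mean square of f is |c|^2, so that of f - c e^(it) is 0. *)
Lemma single_mode f c : ccts f -> cper f -> coef f 1 = c ->
  (forall n, n <> 1%Z -> coef f n = RtoC 0) -> forall t, f t = (c * cis t)%C.
Proof.
  intros Cf Pf H1 H0.
  assert (Ecis : forall t, dot (c * cis t)%C (c * cis t)%C = dot c c).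
  { intros t. pose proof (sin2_cos2 t) as E; unfold Rsqr in E.
    transitivity (dot c c * (sin t * sin t + cos t * cos t)); [|rewrite E; ring].
    unfold dot, cis; destruct c; simpl; ring. }
  assert (Cc : ccts (fun t => c * cis t)%C).
  { split.
    - apply (cts_ext (fun t => fst c * cos t - snd c * sin t)); [reflexivity|cts].
    - apply (cts_ext (fun t => fst c * sin t + snd c * cos t)); [reflexivity|cts]. }
  assert (HU : avg (fun t => dot (f t) (f t)) = dot c c).
  { pose proof (parseval_sq f Cf Pf) as L. apply is_lim_seq_unique in L.
    assert (L' : is_lim_seq (zsum (fun n => dot (coef f n) (coef f n))) (dot c c)).
    { apply (is_lim_seq_ext_loc (fun _ => dot c c)); [|apply is_lim_seq_const].
      exists 1%nat; intros N HN. rewrite (zsum_const_tail _ N HN), H1; [reflexivity|].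
      intros n Hn; rewrite (H0 n Hn); unfold dot; simpl; ring. }
    apply is_lim_seq_unique in L'. rewrite L in L'. now injection L'. }
  set (g := fun t => dot (f t - c * cis t)%C (f t - c * cis t)%C).
  assert (Cg : cts g).
  { apply cts_dot; apply ccts_minus; auto. }
  assert (Hg : avg g = 0).
  { rewrite (avg_ext g (fun t => dot (f t) (f t) - 2 * dot (f t) (c * cis t)%C + dot c c)).
    - pose proof (cts_dot _ _ Cf Cc) as CD. pose proof (cts_dot _ _ Cf Cf) as CD2. cbv beta in
        CD, CD2.
      rewrite avg_plus, avg_minus, avg_scal, avg_const by cts.
      rewrite avg_dot_cis by auto. rewrite H1, HU. ring.
    - intros t. rewrite <- (Ecis t). unfold g, dot, Cminus, Cplus, Copp.
      destruct (f t), (c * cis t)%C; simpl; ring. }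
  assert (Pg : per g).
  { intros t; unfold g. rewrite Pf. unfold cis. now destruct (cos_sin_per t) as [-> ->]. }
  intros t. pose proof two_pi_pos.
  (* [avg_eq_0] speaks of interior points of the period, so translate t to pi. *)
  assert (Hz : g (PI + (t - PI)) = 0).
  { apply (avg_eq_0 (fun s => g (s + (t - PI)))); [cts| | |lra].
    - intros; apply dot_ge_0.
    - now rewrite avg_shift. }
  replace (PI + (t - PI)) with t in Hz by ring.
  apply dot_eq_0 in Hz.
  replace (f t) with ((f t - c * cis t) + c * cis t)%C by ring. rewrite Hz; ring.
Qed.

(** No slack may remain.  By the strict gap p_n = 0 for n <> 1; the squares then
    give q_n = 0 for n <> 1 and q_1 = p_1 / K, so on every circle h consists
    of its first mode, which is that of the extremal map times p_1. *)
Lemma rigidity rho K h F W phi v : 1 < rho -> 1 <= K -> boundary_data rho K h F W phi v ->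
  avg (fun t => dot (F rho t) (F rho t)) = (1 + weight rho K) ^ 2 ->
  exists c, Cmod c = 1 /\ forall z, closed_annulus rho z -> h z = (c * extremal K z)%C.
Proof.
  intros Hr HK HB HU. pose proof HB as (HFh & CF & PF & CW & PW & Hev & _).
  destruct (slack_bound rho K h F W phi v Hr HK HB) as [L0 HX].
  set (p := coef (F 1)) in *. set (q := coef W) in *. set (c := coef (F rho)) in *.
  assert (HX0 : forall n, mode_slack rho K p c n = 0).
  { intros n. pose proof (zsum_term (mode_slack rho K p c) n ltac:(intros;
      now apply mode_slack_ge_0)).
    pose proof (mode_slack_ge_0 rho K p c n Hr HK). pose proof (HX (Z.abs_nat n)). lra. }
  assert (Hsplit : forall n, c n = mode_optimum rho K p n /\
     (mode_value rho K (IZR n) (mode_coth rho (IZR n)) - mode_target rho K (IZR n)) * dot (p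
       n) (p n) = 0).
  { intros n. pose proof (HX0 n) as H; unfold mode_slack in H.
    set (d := (c n - mode_optimum rho K p n)%C) in *.
    pose proof (dot_ge_0 d). pose proof (dot_ge_0 (p n)).
    assert (0 <= (mode_value rho K (IZR n) (mode_coth rho (IZR n)) - mode_target rho K (IZR
      n)) * dot (p n) (p n)).
    { apply Rmult_le_pos; [|assumption].
      destruct (Z.eq_dec n 1) as [-> | Hn]; [rewrite mode_gap_one by auto; lra|].
      pose proof (mode_gap rho K n Hr HK Hn); lra. }
    split; [|lra].
    assert (Hd : d = 0) by (apply dot_eq_0; lra).
    replace (c n) with (d + mode_optimum rho K p n)%C by (unfold d; ring). rewrite Hd; ring. }
  assert (Hp0 : forall n, n <> 1%Z -> p n = RtoC 0).
  { intros n Hn. destruct (Hsplit n) as [_ H]. pose proof (mode_gap rho K n Hr HK Hn).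
    apply dot_eq_0. apply Rmult_integral in H; destruct H; lra. }
  assert (Hq0 : forall n, n <> 1%Z -> q n = RtoC 0).
  { intros n Hn. destruct (Hsplit n) as [H _]. unfold mode_optimum in H.
    unfold c in H. rewrite (Hev n rho ltac:(lra)) in H. fold p q in H. rewrite (Hp0 n Hn) in H.
    pose proof (sh_pos (IZR n) rho Hr) as Hs.
    destruct (q n) as [q1 q2]. injection H as H1 H2.
    ring_simplify in H1; ring_simplify in H2.
    apply injective_projections; simpl.
    - apply Rmult_integral in H1; destruct H1; lra.
    - apply Rmult_integral in H2; destruct H2; lra. }
  assert (Hq1 : q 1%Z = (RtoC (/ K) * p 1%Z)%C).
  { destruct (Hsplit 1%Z) as [H _]. unfold mode_optimum in H.
    unfold c in H. rewrite (Hev 1%Z rho ltac:(lra)) in H. fold p q in H.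
    assert (Es : sh (IZR 1) rho = sh1 rho).
    { unfold sh; destruct (Req_EM_T (IZR 1) 0); [lra|]. rewrite Rmult_1_l, sh1_eq
        by lra. field. }
    assert (Ec : ch (IZR 1) rho = ch1 rho) by (unfold ch; rewrite Rmult_1_l, ch1_eq by lra;
      reflexivity).
    rewrite Es, Ec in H. pose proof (sh1_pos rho Hr) as Hs.
    assert (Em : sh1 rho * (1 + weight rho K * IZR 1) / sh1 rho = ch1 rho + sh1 rho * / K).
    { unfold weight, tilt. field. lra. }
    rewrite Em in H.
    destruct (q 1%Z) as [q1 q2], (p 1%Z) as [p1 p2]. injection H as H1 H2.
    apply injective_projections; simpl; apply Rmult_eq_reg_l with (sh1 rho); lra. }
  assert (Hp1 : dot (p 1%Z) (p 1%Z) = 1).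
  { assert (L' : is_lim_seq (zsum (fun n => dot (p n) (p n))) (dot (p 1%Z) (p 1%Z))).
    { apply (is_lim_seq_ext_loc (fun _ => dot (p 1%Z) (p 1%Z))); [|apply is_lim_seq_const].
      exists 1%nat; intros N HN. rewrite (zsum_const_tail _ N HN); [reflexivity|].
      intros n Hn; rewrite (Hp0 n Hn); unfold dot; simpl; ring. }
    apply is_lim_seq_unique in L'. apply is_lim_seq_unique in L0. rewrite L0 in L'. now
      injection L'. }
  exists (p 1%Z). split.
  { assert (H : Cmod (p 1%Z) ^ 2 = 1) by now rewrite Cmod_sq.
    pose proof (Cmod_ge_0 (p 1%Z)). nra. }
  intros z Hz. unfold closed_annulus in Hz. set (r := Cmod z) in *.
  destruct (polar_form z) as [t Ht]; [fold r; lra|]. fold r in Ht.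
  rewrite Ht, <- HFh by lra. rewrite extremal_polar by lra.
  rewrite (single_mode (F r) (p 1%Z * RtoC ((K + 1) / (2 * K) * r + (K - 1) / (2 * K) * /
    r))%C); auto.
  - ring.
  - rewrite (Hev 1%Z r) by lra. fold p q. rewrite Hq1.
    assert (Es : sh (IZR 1) r = sh1 r).
    { unfold sh; destruct (Req_EM_T (IZR 1) 0); [lra|]. rewrite Rmult_1_l, sh1_eq
        by lra. field. }
    assert (Ec : ch (IZR 1) r = ch1 r) by (unfold ch; rewrite Rmult_1_l, ch1_eq by lra;
      reflexivity).
    rewrite Es, Ec. unfold sh1, ch1.
    destruct (p 1%Z) as [p1 p2]; apply injective_projections; simpl; field; lra.
  - intros n Hn. rewrite (Hev n r) by lra. fold p q. rewrite (Hp0 n Hn), (Hq0 n Hn). ring.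
Qed.

(** * The extremal map *)

Definition punctured (x y : R) : Prop := x ^ 2 + y ^ 2 <> 0.

Lemma punctured_open x y : punctured x y -> locally_2d punctured x y.
Proof.
  apply (continuity_2d_pt_neq_0 (fun x y => x ^ 2 + y ^ 2)).
  apply (cts2_plus (fun x _ => x ^ 2) (fun _ y => y ^ 2)); cts.
Qed.

(** Replaces the iterated operators [Derive] of the definition of C^2 by
    closed formulas for the partial derivatives. *)
Lemma ex_diff_n_2_explicit (u u1 u2 u11 u12 u21 u22 : R -> R -> R) x y :
  (forall x y, punctured x y ->
     is_derive (fun z => u z y) x (u1 x y) /\ is_derive (fun z => u x z) y (u2 x y) /\
     is_derive (fun z => u1 z y) x (u11 x y) /\ is_derive (fun z => u1 x z) y (u12 x y) /\
     is_derive (fun z => u2 z y) x (u21 x y) /\ is_derive (fun z => u2 x z) y (u22 x y)) ->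
  (forall x y, punctured x y ->
     continuity_2d_pt u x y /\ continuity_2d_pt u1 x y /\ continuity_2d_pt u2 x y /\
     continuity_2d_pt u11 x y /\ continuity_2d_pt u12 x y /\
     continuity_2d_pt u21 x y /\ continuity_2d_pt u22 x y) ->
  punctured x y ->
  ex_diff_n u 2 x y /\
  partial_derive 2 0 u x y + partial_derive 0 2 u x y = u11 x y + u22 x y.
Proof.
  intros HD HC Hxy. pose proof (punctured_open x y Hxy) as HO.
  assert (HE : forall f g : R -> R -> R, (forall x y, punctured x y -> f x y = g x y) ->
    locally_2d (fun u v => f u v = g u v) x y).
  { intros f g H; revert HO; apply locally_2d_impl, locally_2d_forall; auto. }
  assert (E1 : forall x y, punctured x y -> u1 x y = D1 u x y)
    by (intros a b Hab; symmetry; apply is_derive_unique, (HD a b Hab)).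
  assert (E2 : forall x y, punctured x y -> u2 x y = D2 u x y)
    by (intros a b Hab; symmetry; apply is_derive_unique, (HD a b Hab)).
  assert (E11 : forall x y, punctured x y -> u11 x y = D1 u1 x y)
    by (intros a b Hab; symmetry; apply is_derive_unique, (HD a b Hab)).
  assert (E12 : forall x y, punctured x y -> u12 x y = D2 u1 x y)
    by (intros a b Hab; symmetry; apply is_derive_unique, (HD a b Hab)).
  assert (E21 : forall x y, punctured x y -> u21 x y = D1 u2 x y)
    by (intros a b Hab; symmetry; apply is_derive_unique, (HD a b Hab)).
  assert (E22 : forall x y, punctured x y -> u22 x y = D2 u2 x y)
    by (intros a b Hab; symmetry; apply is_derive_unique, (HD a b Hab)).
  destruct (HD x y Hxy) as (A1 & A2 & A3 & A4 & A5 & A6).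
  destruct (HC x y Hxy) as (B0 & B1 & B2 & B3 & B4 & B5 & B6).
  split.
  - split; [exact B0|]. split; [eexists; exact A1|]. split; [eexists; exact A2|]. split.
    + apply (ex_diff_n_ext_loc u1 (D1 u)); [now apply HE|].
      split; [exact B1|]. split; [eexists; exact A3|]. split; [eexists; exact A4|].
      split; (split; [|exact I]).
      * apply (continuity_2d_pt_ext_loc u11 (D1 u1)); [now apply HE|exact B3].
      * apply (continuity_2d_pt_ext_loc u12 (D2 u1)); [now apply HE|exact B4].
    + apply (ex_diff_n_ext_loc u2 (D2 u)); [now apply HE|].
      split; [exact B2|]. split; [eexists; exact A5|]. split; [eexists; exact A6|].
      split; (split; [|exact I]).
      * apply (continuity_2d_pt_ext_loc u21 (D1 u2)); [now apply HE|exact B5].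
      * apply (continuity_2d_pt_ext_loc u22 (D2 u2)); [now apply HE|exact B6].
  - change (D1 (D1 u) x y + D2 (D2 u) x y = u11 x y + u22 x y).
    f_equal.
    + apply is_derive_unique. apply (is_derive_ext_loc (fun z => u1 z y)); [|exact A3].
      apply (locally_2d_1d_const_y (fun a b => u1 a b = D1 u a b)). now apply HE.
    + apply is_derive_unique. apply (is_derive_ext_loc (fun z => u2 x z)); [|exact A6].
      apply (locally_2d_1d_const_x (fun a b => u2 a b = D2 u a b)). now apply HE.
Qed.

(** The real and imaginary parts of a z + b / conj z. *)
Definition ext_re a b (x y : R) := a * x + b * (x / (x ^ 2 + y ^ 2)).
Definition ext_im a b (x y : R) := a * y + b * (y / (x ^ 2 + y ^ 2)).
(** The first partial derivatives; [ext_cross] is both the y-derivative of the real part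
    and the x-derivative of the imaginary part.  The second ones are, up to sign,
    the real and imaginary parts of 2 b / z^3. *)
Definition ext_re_x a b (x y : R) := a + b * ((y ^ 2 - x ^ 2) / (x ^ 2 + y ^ 2) ^ 2).
Definition ext_cross (b x y : R) := b * (- (2 * x * y) / (x ^ 2 + y ^ 2) ^ 2).
Definition ext_im_y a b (x y : R) := a + b * ((x ^ 2 - y ^ 2) / (x ^ 2 + y ^ 2) ^ 2).
Definition ext_cube_re (b x y : R) := b * (2 * (x ^ 3 - 3 * x * y ^ 2) / (x ^ 2 + y ^ 2) ^ 3).
Definition ext_cube_im (b x y : R) := b * (2 * (3 * x ^ 2 * y - y ^ 3) / (x ^ 2 + y ^ 2) ^ 3).

Lemma punctured_pow x y : punctured x y -> forall n, (x ^ 2 + y ^ 2) ^ n <> 0.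
Proof. intros H n; now apply pow_nonzero. Qed.

Lemma inv_pow_cont n x y : punctured x y -> continuity_2d_pt (fun x y => / (x ^ 2
  + y ^ 2) ^ n) x y.
Proof.
  intros H. apply continuity_2d_pt_inv; [|now apply pow_nonzero].
  apply (cts2_comp (fun s => s ^ n) (fun x y => x ^ 2 + y ^ 2)); [cts|].
  apply (cts2_plus (fun x _ => x ^ 2) (fun _ y => y ^ 2)); cts.
Qed.

Lemma quot_cont (g : R -> R -> R) n x y : cts2 g -> punctured x y ->
  continuity_2d_pt (fun x y => g x y / (x ^ 2 + y ^ 2) ^ n) x y.
Proof. intros Hg H; apply continuity_2d_pt_mult; [apply Hg|now apply inv_pow_cont]. Qed.

Lemma rational_cont (g k : R -> R -> R) b n x y : cts2 k -> cts2 g -> punctured x y ->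
  continuity_2d_pt (fun x y => k x y + b * (g x y / (x ^ 2 + y ^ 2) ^ n)) x y.
Proof.
  intros Hk Hg H; apply continuity_2d_pt_plus; [apply Hk|].
  apply continuity_2d_pt_mult; [apply continuity_2d_pt_const|now apply quot_cont].
Qed.

Lemma cts2_poly_mon (c : R) i j : cts2 (fun x y => c * x ^ i * y ^ j).
Proof. apply (cts2_mult (fun x _ => c * x ^ i) (fun _ y => y ^ j)); cts. Qed.

Lemma ext_continuous a b x y : punctured x y -> continuity_2d_pt (ext_re a b) x y /\
  continuity_2d_pt (ext_im a b) x y /\
  continuity_2d_pt (ext_re_x a b) x y /\ continuity_2d_pt (ext_cross b) x y /\
    continuity_2d_pt (ext_im_y a b) x y /\
  continuity_2d_pt (ext_cube_re b) x y /\ continuity_2d_pt (ext_cube_im b) x y.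
Proof.
  intros H.
  assert (HM := cts2_poly_mon).
  assert (Hz : cts2 (fun _ _ => 0)) by apply (cts2_1 (fun _ => 0)), cts_const.
  assert (Ha : cts2 (fun _ _ => a)) by apply (cts2_1 (fun _ => a)), cts_const.
  repeat split.
  - apply (continuity_2d_pt_ext (fun x y => a * x + b * (x / (x ^ 2 + y ^ 2) ^ 1))).
    { intros; unfold ext_re; now rewrite pow_1. }
    apply (rational_cont (fun x y => x) (fun x y => a * x)); auto; cts.
  - apply (continuity_2d_pt_ext (fun x y => a * y + b * (y / (x ^ 2 + y ^ 2) ^ 1))).
    { intros; unfold ext_im; now rewrite pow_1. }
    apply (rational_cont (fun x y => y) (fun x y => a * y)); auto; cts.
  - apply (rational_cont (fun x y => y ^ 2 - x ^ 2) (fun _ _ => a)); auto; cts.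
  - apply (continuity_2d_pt_ext (fun x y => 0 + b * (- (2 * x * y) / (x ^ 2 + y ^ 2) ^ 2))).
    { intros; unfold ext_cross; ring. }
    apply (rational_cont (fun x y => - (2 * x * y)) (fun _ _ => 0)); auto; cts.
  - apply (rational_cont (fun x y => x ^ 2 - y ^ 2) (fun _ _ => a)); auto; cts.
  - apply (continuity_2d_pt_ext (fun x y => 0 + b * ((2 * (x ^ 3 - 3 * x * y ^ 2)) / (x ^ 2
      + y ^ 2) ^ 3))).
    { intros; unfold ext_cube_re; ring. }
    apply (rational_cont (fun x y => 2 * (x ^ 3 - 3 * x * y ^ 2)) (fun _ _ => 0)); auto; cts.
  - apply (continuity_2d_pt_ext (fun x y => 0 + b * ((2 * (3 * x ^ 2 * y - y ^ 3)) / (x ^ 2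
      + y ^ 2) ^ 3))).
    { intros; unfold ext_cube_im; ring. }
    apply (rational_cont (fun x y => 2 * (3 * x ^ 2 * y - y ^ 3)) (fun _ _ => 0)); auto; cts.
Qed.

Lemma ext_re_derive a b x y : punctured x y ->
  is_derive (fun z => ext_re a b z y) x (ext_re_x a b x y) /\ is_derive (fun z => ext_re a b x
    z) y (ext_cross b x y) /\
  is_derive (fun z => ext_re_x a b z y) x (ext_cube_re b x y) /\ is_derive (fun z => ext_re_x
    a b x z) y (ext_cube_im b x y) /\
  is_derive (fun z => ext_cross b z y) x (ext_cube_im b x y) /\ is_derive (fun z => ext_cross
    b x z) y (- ext_cube_re b x y).
Proof.
  intros H. pose proof (punctured_pow x y H 2) as H2. unfold punctured in H. simpl in H, H2.
  unfold ext_re, ext_re_x, ext_cross, ext_cube_re, ext_cube_im.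
  repeat match goal with |- _ /\ _ => split end;
    (auto_derive; [repeat split; auto | field; auto]).
Qed.
Lemma ext_im_derive a b x y : punctured x y ->
  is_derive (fun z => ext_im a b z y) x (ext_cross b x y) /\ is_derive (fun z => ext_im a b x
    z) y (ext_im_y a b x y) /\
  is_derive (fun z => ext_cross b z y) x (ext_cube_im b x y) /\ is_derive (fun z => ext_cross
    b x z) y (- ext_cube_re b x y) /\
  is_derive (fun z => ext_im_y a b z y) x (- ext_cube_re b x y) /\ is_derive (fun z =>
    ext_im_y a b x z) y (- ext_cube_im b x y).
Proof.
  intros H. pose proof (punctured_pow x y H 2) as H2. unfold punctured in H. simpl in H, H2.
  unfold ext_im, ext_im_y, ext_cross, ext_cube_re, ext_cube_im.
  repeat match goal with |- _ /\ _ => split end;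
    (auto_derive; [repeat split; auto | field; auto]).
Qed.

Definition ext_outer (K : R) := (K + 1) / (2 * K).
Definition ext_inner (K : R) := (K - 1) / (2 * K).

Lemma extremal_components K x y : extremal K (x, y) = (ext_re (ext_outer K) (ext_inner K) x y,
  ext_im (ext_outer K) (ext_inner K) x y).
Proof.
  unfold extremal, ext_re, ext_im, ext_outer, ext_inner. unfold Cconj, Cinv, Cmult, Cplus,
    RtoC; cbn [fst snd].
  replace (x ^ 2 + (- y) ^ 2) with (x ^ 2 + y ^ 2) by ring.
  unfold Rdiv; rewrite Ropp_involutive; f_equal; ring.
Qed.

Lemma annulus_punctured x y : 1 <= Cmod (x, y) -> punctured x y.
Proof.
  intros H E. unfold Cmod in H; simpl fst in H; simpl snd in H. rewrite E, sqrt_0 in H. lra.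
Qed.

Lemma is_derive_pair (f g : R -> R) x df dg : is_derive f x df -> is_derive g x dg ->
  is_derive (fun t => (f t, g t) : C) x ((df, dg) : C).
Proof.
  intros Hf Hg.
  pose proof (is_derive_plus (V := C_R_NormedModule) _ _ x _ _
    (is_derive_scal_l (V := C_R_NormedModule) f x df (RtoC 1) Hf)
    (is_derive_scal_l (V := C_R_NormedModule) g x dg Ci Hg)) as H.
  evar_last.
  - refine (is_derive_ext _ _ _ _ _ H). intros t.
    unfold plus, scal; simpl; unfold prod_plus, prod_scal, plus, scal; simpl; unfold mult;
      simpl. f_equal; ring.
  - unfold plus, scal; simpl; unfold prod_plus, prod_scal, plus, scal; simpl; unfold mult;
      simpl. f_equal; ring.
Qed.

Lemma continuous_on_components (D : C -> Prop) (f g : R -> R -> R) :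
  (forall x y, D (x, y) -> continuity_2d_pt f x y /\ continuity_2d_pt g x y) ->
  continuous_on D (fun z => (f (fst z) (snd z), g (fst z) (snd z)) : C).
Proof.
  intros H; apply continuous_on_forall. intros [x y] Hz P [e He].
  destruct (H x y Hz) as [Hf Hg].
  destruct (locally_2d_and _ _ _ _ (Hf e) (Hg e)) as [d Hd].
  exists d. intros [u v] [Hu Hv]. apply He. split; apply (Hd u v Hu Hv).
Qed.

Lemma extremal_admissible rho K : 1 < rho -> 1 <= K -> admissible rho K (extremal K).
Proof.
  intros Hr HK. set (a := ext_outer K). set (b := ext_inner K).
  assert (Hab : a + b = 1) by (unfold a, b, ext_outer, ext_inner; field; lra).
  assert (Hb : 0 <= b) by (unfold b, ext_inner; apply Rdiv_le_0_compat; lra).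
  assert (Ha : 0 <= a) by (unfold a, ext_outer; apply Rdiv_le_0_compat; lra).
  assert (HKab : K * (a - b) = 1) by (unfold a, b, ext_outer, ext_inner; field; lra).
  assert (Hunit : forall z, unit_circle z -> extremal K z = z).
  { intros z Hz. unfold unit_circle in Hz. destruct (polar_form z ltac:(lra)) as [t Ht].
    rewrite Hz in Ht. rewrite Ht, extremal_polar by lra.
    replace ((K + 1) / (2 * K) * 1 + (K - 1) / (2 * K) * / 1) with 1 by (field;
      lra). reflexivity. }
  assert (Hid : continuous_on unit_circle (fun z : C => z)).
  { apply continuous_on_forall; intros z _; apply continuous_id. }
  assert (Hann : forall x y, closed_annulus rho (x, y) -> punctured x y).
  { intros x y Hz; apply annulus_punctured, Hz. }
  assert (Hopen : forall x y, open_annulus rho (x, y) -> punctured x y).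
  { intros x y Hz; apply annulus_punctured; unfold open_annulus in Hz; lra. }
  split; [|split; [|split]].
  - split; intros x y Hxy; apply Hopen in Hxy.
    + replace (fun x y => Re (extremal K (x, y))) with (ext_re a b).
      2: { do 2 (apply functional_extensionality; intro). now rewrite extremal_components. }
      destruct (ex_diff_n_2_explicit (ext_re a b) (ext_re_x a b) (ext_cross b) (ext_cube_re b)
        (ext_cube_im b) (ext_cube_im b) (fun x y => - ext_cube_re b x y) x y) as [H1 H2]; auto.
      * intros; now apply ext_re_derive.
      * intros x' y' H'; destruct (ext_continuous a b x' y' H') as (X1 & X2 & X3 & X4 & X5 &
          X6 & X7).
        repeat split; auto. now apply continuity_2d_pt_opp.
      * split; [exact H1|rewrite H2; ring].
    + replace (fun x y => Im (extremal K (x, y))) with (ext_im a b).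
      2: { do 2 (apply functional_extensionality; intro). now rewrite extremal_components. }
      destruct (ex_diff_n_2_explicit (ext_im a b) (ext_cross b) (ext_im_y a b) (ext_cube_im b)
        (fun x y => - ext_cube_re b x y) (fun x y => - ext_cube_re b x y) (fun x y => -
        ext_cube_im b x y) x y) as [H1 H2]; auto.
      * intros; now apply ext_im_derive.
      * intros x' y' H'; destruct (ext_continuous a b x' y' H') as (X1 & X2 & X3 & X4 & X5 &
          X6 & X7).
        repeat split; auto; now apply continuity_2d_pt_opp.
      * split; [exact H1|rewrite H2; ring].
  - split; [|split].
    + apply (continuous_on_ext unit_circle (fun z => z)); [|exact Hid]. intros; symmetry;
        now apply Hunit.
    + intros z Hz; now rewrite Hunit.
    + exists (fun z => z). repeat split; auto.
  - exists (fun t => t). repeat split; auto.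
    + intros t; apply continuous_id.
    + intros t; apply Hunit, Cmod_cis.
  - exists (fun z => (ext_re_x a b (fst z) (snd z), ext_cross b (fst z) (snd z)) : C),
      (fun z => (ext_cross b (fst z) (snd z), ext_im_y a b (fst z) (snd z)) : C).
    split; [split; [|split; [|split]]|].
    + apply (continuous_on_ext (closed_annulus rho) (fun z => (ext_re a b (fst z) (snd z),
        ext_im a b (fst z) (snd z)) : C)).
      * intros [x y] _. now rewrite extremal_components.
      * apply continuous_on_components. intros x y Hz.
        split; apply (ext_continuous a b x y (Hann x y Hz)).
    + apply continuous_on_components. intros x y Hz.
      split; apply (ext_continuous a b x y (Hann x y Hz)).
    + apply continuous_on_components. intros x y Hz.
      split; apply (ext_continuous a b x y (Hann x y Hz)).
    + intros x y Hxy; apply Hopen in Hxy. cbn [fst snd]. split.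
      * apply (is_derive_ext (fun t => (ext_re a b t y, ext_im a b t y) : C)).
        { intros; now rewrite extremal_components. }
        apply is_derive_pair; [apply (proj1 (ext_re_derive a b x y Hxy))|apply (proj1
          (ext_im_derive a b x y Hxy))].
      * apply (is_derive_ext (fun t => (ext_re a b x t, ext_im a b x t) : C)).
        { intros; now rewrite extremal_components. }
        apply is_derive_pair; [apply (proj1 (proj2 (ext_re_derive a b x y Hxy)))|apply (proj1
          (proj2 (ext_im_derive a b x y Hxy)))].
    + intros [x y] Hz. unfold unit_circle in Hz.
      assert (Hs : x ^ 2 + y ^ 2 = 1).
      { pose proof (Cmod_sq (x, y)) as E; rewrite Hz in E; unfold dot in E; simpl in E. lra. }
      set (hx := fun z : C => (ext_re_x a b (fst z) (snd z), ext_cross b (fst z) (snd z)) : C).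
      set (hy := fun z : C => (ext_cross b (fst z) (snd z), ext_im_y a b (fst z) (snd z)) : C).
      assert (E1 : Cmod (wirtinger_z hx hy (x, y)) = a).
      { replace (wirtinger_z hx hy (x, y)) with (RtoC a).
        - rewrite Cmod_R; now apply Rabs_pos_eq.
        - unfold wirtinger_z, hx, hy, ext_re_x, ext_cross, ext_im_y; cbn [fst snd]; rewrite Hs.
          apply injective_projections; simpl; field. }
      assert (E2 : Cmod (wirtinger_zbar hx hy (x, y)) = b).
      { assert (E : Cmod (wirtinger_zbar hx hy (x, y)) ^ 2 = b ^ 2).
        { rewrite Cmod_sq. transitivity (b ^ 2 * ((x ^ 2 - y ^ 2) ^ 2 + 4 * x ^ 2 * y ^ 2)).
          2: { replace ((x ^ 2 - y ^ 2) ^ 2 + 4 * x ^ 2 * y ^ 2) with ((x ^ 2 + y ^ 2) ^ 2)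
            by ring.
               rewrite Hs; ring. }
          unfold wirtinger_zbar, hx, hy, ext_re_x, ext_cross, ext_im_y, dot; cbn [fst snd];
            rewrite Hs; simpl; field. }
        pose proof (Cmod_ge_0 (wirtinger_zbar hx hy (x, y))). nra. }
      change (opnorm hx hy (x, y) ^ 2 <= K * jacobian hx hy (x, y)).
      unfold opnorm, jacobian. rewrite E1, E2.
      replace (K * (a ^ 2 - b ^ 2)) with (K * (a - b) * (a + b)) by ring.
      rewrite HKab, Hab. lra.
Qed.

Lemma lower_bound_eq rho K : 1 < rho -> 1 <= K -> lower_bound rho K = 1 + weight rho K.
Proof. intros; unfold lower_bound, weight, tilt, ch1, sh1. field; lra. Qed.

Lemma quadratic_mean_eq rho h : 0 < rho -> cts (fun t => Cmod (h (rho * cis t)%C) ^ 2) ->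
  quadratic_mean rho h = sqrt (avg (fun t => Cmod (h (rho * cis t)%C) ^ 2)).
Proof.
  intros Hr HC; unfold quadratic_mean, circle_integral, avg. f_equal.
  set (f := fun t => Cmod (h (rho * cis t)%C) ^ 2) in *.
  rewrite (RInt_ext_all _ (fun t => scal rho (f t)))
    by (intros t; unfold f; apply Rmult_comm).
  rewrite (RInt_scal f) by cts. unfold scal; simpl; unfold mult; simpl.
  pose proof PI_RGT_0. field; lra.
Qed.

Lemma Cmod_cis_scale r t : 0 <= r -> Cmod (r * cis t)%C = r.
Proof. intros H; rewrite Cmod_mult, Cmod_cis, Cmod_R, Rabs_pos_eq; lra. Qed.

Lemma mean_le_sup rho h : 0 < rho -> cts (fun t => Cmod (h (rho * cis t)%C) ^ 2) ->
  Rbar_le (quadratic_mean rho h) (sup_modulus rho h).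
Proof.
  intros Hr HC. rewrite quadratic_mean_eq by assumption. unfold sup_modulus.
  set (A := fun y => exists z : C, Cmod z = rho /\ y = Cmod (h z)). destruct (Lub_Rbar_correct
    A) as [Hub _].
  assert (HA : forall t, A (Cmod (h (rho * cis t)%C))).
  { intros t; exists (rho * cis t)%C; split; [apply Cmod_cis_scale; lra|reflexivity]. }
  destruct (Lub_Rbar A) as [s | |].
  - cbn [Rbar_le]. assert (Hle : forall t, Cmod (h (rho * cis t)%C) <= s) by (intros t;
      exact (Hub _ (HA t))).
    pose proof (Cmod_ge_0 (h (rho * cis 0)%C)). pose proof (Hle 0).
    rewrite <- (sqrt_pow2 s) by lra. apply sqrt_le_1_alt.
    rewrite <- (avg_const (s ^ 2)). apply avg_le; [exact HC|cts|].
    intros t _. apply pow_incr. split; [apply Cmod_ge_0|apply Hle].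
  - exact I.
  - exfalso. exact (Hub _ (HA 0)).
Qed.

Lemma extremal_modulus rho K z : 1 < rho -> 1 <= K -> Cmod z = rho ->
  Cmod (extremal K z) = lower_bound rho K.
Proof.
  intros Hr HK Hz. destruct (polar_form z) as [t Ht]; [lra|].
  rewrite Ht, Hz, extremal_polar by lra. apply Cmod_cis_scale.
  change (0 <= lower_bound rho K). rewrite lower_bound_eq by lra. pose proof (weight_pos rho K
    Hr HK); lra.
Qed.

Lemma constant_modulus_mean rho h l : 0 < rho -> 0 <= l ->
  (forall z, Cmod z = rho -> Cmod (h z) = l) -> quadratic_mean rho h = l.
Proof.
  intros Hr Hl H.
  assert (E : forall t, l ^ 2 = Cmod (h (rho * cis t)%C) ^ 2).
  { intros t; rewrite H; [reflexivity|apply Cmod_cis_scale; lra]. }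
  rewrite quadratic_mean_eq; [|exact Hr|exact (cts_ext _ _ E (cts_const _))].
  rewrite <- (avg_ext _ _ E), avg_const. now apply sqrt_pow2.
Qed.

Theorem theorem1p9 (rho K : R) (hrho : 1 < rho) (hK : 1 <= K) :
  (forall h : C -> C, admissible rho K h ->
     Rbar_le (Finite (quadratic_mean rho h)) (sup_modulus rho h) /\
     lower_bound rho K <= quadratic_mean rho h) /\
  (admissible rho K (extremal K) /\
   sup_modulus rho (extremal K) = Finite (quadratic_mean rho (extremal K)) /\
   quadratic_mean rho (extremal K) = lower_bound rho K) /\
  (forall h : C -> C, admissible rho K h ->
     (quadratic_mean rho h = lower_bound rho K <->
      exists c : C, Cmod c = 1 /\
        forall z : C, closed_annulus rho z -> h z = (c * extremal K z)%C)).
Proof.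
  pose proof (weight_pos rho K hrho hK) as Hw.
  pose proof (lower_bound_eq rho K hrho hK) as EL.
  assert (Hmean : forall h F W phi v, boundary_data rho K h F W phi v ->
    cts (fun t => Cmod (h (rho * cis t)%C) ^ 2) /\
    quadratic_mean rho h = sqrt (avg (fun t => dot (F rho t) (F rho t)))).
  { intros h F W phi v (HFh & CF & _).
    assert (E : forall t, dot (F rho t) (F rho t) = Cmod (h (rho * cis t)%C) ^ 2).
    { intros t; rewrite Cmod_sq, HFh; [reflexivity|lra]. }
    assert (HC : cts (fun t => Cmod (h (rho * cis t)%C) ^ 2)).
    { exact (cts_ext _ _ E (cts_dot _ _ (CF rho) (CF rho))). }
    split; [exact HC|]. rewrite quadratic_mean_eq by (assumption || lra).
    f_equal; apply avg_ext; intros; now rewrite E. }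
  assert (Hbound : forall h F W phi v, boundary_data rho K h F W phi v ->
    (1 + weight rho K) ^ 2 <= avg (fun t => dot (F rho t) (F rho t))).
  { intros h F W phi v HB. destruct (slack_bound rho K h F W phi v hrho hK HB) as [_ H].
    pose proof (H O) as H0; cbn [zsum] in H0.
    pose proof (mode_slack_ge_0 rho K (coef (F 1)) (coef (F rho)) 0 hrho hK). lra. }
  assert (HEm : quadratic_mean rho (extremal K) = lower_bound rho K).
  { apply constant_modulus_mean; [lra|lra|]. intros; now apply extremal_modulus. }
  split; [|split; [split; [|split]|]].
  - intros h Hh. destruct (admissible_boundary_data rho K h hrho hK Hh) as (F & W & phi & v &
      HB).
    destruct (Hmean h F W phi v HB) as [HC Em]. split.
    + apply mean_le_sup; [lra|exact HC].
    + rewrite Em, EL, <- (sqrt_pow2 (1 + weight rho K)) by lra.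
      apply sqrt_le_1_alt, (Hbound h F W phi v HB).
  - now apply extremal_admissible.
  - rewrite HEm. apply is_lub_Rbar_unique. split.
    + intros y [z [Hz ->]]. rewrite (extremal_modulus rho K z); auto. apply Rbar_le_refl.
    + intros b Hb. apply Hb. exists (RtoC rho).
      assert (Hrz : Cmod (RtoC rho) = rho) by (rewrite Cmod_R, Rabs_pos_eq; lra).
      split; [exact Hrz|]. symmetry; now apply extremal_modulus.
  - exact HEm.
  - intros h Hh. split.
    + intros Heq. destruct (admissible_boundary_data rho K h hrho hK Hh) as (F & W & phi & v &
        HB).
      destruct (Hmean h F W phi v HB) as [_ Em].
      apply (rigidity rho K h F W phi v); auto.
      rewrite <- EL, <- Heq, Em. symmetry; apply pow2_sqrt.
      pose proof (Hbound h F W phi v HB). pose proof (pow2_ge_0 (1 + weight rho K)). lra.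
    + intros [c [Hc Hz]]. apply constant_modulus_mean; [lra|lra|].
      intros z Ez. rewrite Hz by (unfold closed_annulus; lra).
      rewrite Cmod_mult, Hc, (extremal_modulus rho K z) by auto. ring.
Qed.
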